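(* Consider the partial-data GROUSE algorithm described in the context, with step length chosen so that $\sin(\sigma_t\eta_t)=\|r_t\|/\|p_t\|$. Suppose that $|\Omega_t|\ge q$ for all $t$, where $q$ and $C_1$ satisfy $$q\ \ge\ C_1(\log n)^2\, d\,\mu(\bar U)\log(20d),\qquad C_1\ge \tfrac{64}{3}.$$ Suppose that there is a quantity $\bar\delta\in(0,0.6)$ such that, with probability at least $1-\bar\delta$, the vector $x_t:=v_t-U_tU_t^Tv_t$ satisfies both $$\mu(x_t)\le \log n\left[\frac{0.045}{\log 10}\,C_1\, d\,\mu(\bar U)\log(20d)\right]^{1/2}\quad\text{and}\quad \mu(x_t)\le(\log n)^2\left[\frac{0.05}{8\log 10}\,C_1\log(20d)\right].$$ Suppose that at each iteration $s_t$ is a random vector whose components are i.i.d. $\mathcal N(0,1)$. Suppose that $$\epsilon_t\le \frac{1}{128}\frac{q^2}{n^2 d},\qquad \epsilon_t\le \frac{d}{16 n}\,\mu(\bar U),$$ and that in addition $$\epsilon_t\le(8\times10^{-6})(0.6-\bar\delta)^2\frac{q^3}{n^3d^2}.$$ Then $$E[\epsilon_{t+1}\mid\epsilon_t]\ \le\ \left(1-(0.16)(0.6-\bar\delta)\frac{q}{nd}\right)\epsilon_t.$$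
   Context: Let $d\ge1$ and $n\ge 2d$ be integers. $\bar U\in\mathbb R^{n\times d}$ has orthonormal columns spanning the target subspace $\mathcal S\subset\mathbb R^n$. $\|\cdot\|$ is the Euclidean (or spectral) norm, $\|\cdot\|_F$ the Frobenius norm, $\log$ the natural logarithm. For an index set $\Omega\subset\{1,\dots,n\}$ with complement $\Omega^c$, $[U]_\Omega$ denotes the submatrix of rows of $U$ indexed by $\Omega$ and $[z]_\Omega$ the corresponding subvector of $z\in\mathbb R^n$. Error measure: for $U_t\in\mathbb R^{n\times d}$ with orthonormal columns, $\epsilon_t:=d-\|\bar U^TU_t\|_F^2=\sum_{i=1}^d\sin^2\phi_i$, where $\cos\phi_i$ are the singular values of $\bar U^TU_t$. Coherence: for $U\in\mathbb R^{n\times d}$ with orthonormal columns, $\mu(U):=\frac nd\max_{1\le i\le n}\|U_{i\cdot}\|_2^2$ where $U_{i\cdot}$ is the $i$th row; for a nonzero vector $x\in\mathbb R^n$, $\mu(x):=n\|x\|_\infty^2/\|x\|_2^2$. Sampling: at each iteration the random index set $\Omega_t\subset\{1,\dots,n\}$ is chosen uniformly with replacement at random, independently at each iteration. GROUSE iteration $t$ (partial data): given the current $U_t$ with orthonormal columns, $\Omega_t$ is drawn and $[v_t]_{\Omega_t}$ is observed, where $v_t=\bar U s_t\in\mathcal S$ with $s_t\in\mathbb R^d$ random. If all eigenvalues of $[U_t]_{\Omega_t}^T[U_t]_{\Omega_t}$ lie in $[0.5|\Omega_t|/n,\,1.5|\Omega_t|/n]$, set $w_t:=\arg\min_w\|[U_t]_{\Omega_t}w-[v_t]_{\Omega_t}\|_2^2$,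 $p_t:=U_tw_t$, define $r_t\in\mathbb R^n$ by $[r_t]_{\Omega_t}:=[v_t]_{\Omega_t}-[p_t]_{\Omega_t}$, $[r_t]_{\Omega_t^c}:=0$, set $\sigma_t:=\|r_t\|\,\|p_t\|$, choose $\eta_t>0$ (with $\sigma_t\eta_t\in[0,\pi/2]$) and set $$U_{t+1}:=U_t+\left[(\cos(\sigma_t\eta_t)-1)\frac{p_t}{\|p_t\|}+\sin(\sigma_t\eta_t)\frac{r_t}{\|r_t\|}\right]\frac{w_t^T}{\|w_t\|}.$$ If the eigenvalue condition fails, no step is taken and $\epsilon_{t+1}=\epsilon_t$. *)

(* Defs.v *)
From HB Require Import structures.
From mathcomp Require Import all_boot all_order all_algebra.
From mathcomp Require Import all_classical all_reals all_analysis.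

Set Implicit Arguments.
Unset Strict Implicit.
Unset Printing Implicit Defensive.

Import Order.TTheory GRing.Theory Num.Theory.
Import numFieldNormedType.Exports.

Local Open Scope classical_set_scope.
Local Open Scope ring_scope.

Section LinearAlgebra.
Context {R : realType}.

(* Frobenius norm; on row and column vectors it is the Euclidean norm.  (The
   library norm `|A| on matrices is the entrywise maximum norm.) *)
Definition fnorm m k (A : 'M[R]_(m, k)) : R :=
  Num.sqrt (\sum_i \sum_j A i j ^+ 2).

Definition orthonormal_cols n d (U : 'M[R]_(n, d)) : Prop := U^T *m U = 1%:M.

Definition subspace_error n d (Ubar U : 'M[R]_(n, d)) : R :=
  d%:R - fnorm (Ubar^T *m U) ^+ 2.

Definition coherence n d (U : 'M[R]_(n, d)) : R :=
  n%:R / d%:R * \big[Num.max/0]_(i < n) fnorm (row i U) ^+ 2.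

(* `|x| is the maximum norm; the value at x = 0 is the junk value 0. *)
Definition vcoherence n (x : 'cV[R]_n) : R :=
  n%:R * `|x| ^+ 2 / fnorm x ^+ 2.

Definition rows_in n k (Om : {set 'I_n}) (A : 'M[R]_(n, k)) : 'M[R]_(#|Om|, k) :=
  rowsub (fun i : 'I_#|Om| => enum_val i) A.

(* A least-squares minimizer (it always exists, and is unique as soon as A has
   full column rank). *)
Definition lstsq m d (A : 'M[R]_(m, d)) (b : 'cV[R]_m) : 'cV[R]_d :=
  xget 0 [set w | forall w' : 'cV[R]_d,
                    fnorm (A *m w - b) ^+ 2 <= fnorm (A *m w' - b) ^+ 2].

End LinearAlgebra.

Section Step.
Context {R : realType} {n d : nat}.
Variables (U : 'M[R]_(n, d)) (v : 'cV[R]_n) (Om : {set 'I_n}).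

Definition well_conditioned : Prop :=
  forall a : R, eigenvalue ((rows_in Om U)^T *m rows_in Om U) a ->
    1 / 2 * (#|Om|%:R / n%:R) <= a <= 3 / 2 * (#|Om|%:R / n%:R).

Definition grouse_w : 'cV[R]_d := lstsq (rows_in Om U) (rows_in Om v).

Definition grouse_p : 'cV[R]_n := U *m grouse_w.

Definition grouse_r : 'cV[R]_n :=
  \col_i (if i \in Om then v i 0 - grouse_p i 0 else 0).

Definition grouse_sigma : R := fnorm grouse_r * fnorm grouse_p.

(* If one of the norms below vanishes then so does the corresponding vector,
   and since 0^-1 = 0 the undefined unit vector is read as 0: then U is
   unchanged. *)
Definition grouse_step (eta : R) : 'M[R]_(n, d) :=
  if `[< well_conditioned >] then
    U + (((cos (grouse_sigma * eta) - 1) / fnorm grouse_p) *: grouse_p +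
         (sin (grouse_sigma * eta) / fnorm grouse_r) *: grouse_r)
        *m ((fnorm grouse_w)^-1 *: grouse_w^T)
  else U.

End Step.

Section Probability.
Context {R : realType} {disp : measure_display} {T : measurableType disp}.
Variable P : probability T R.

Local Open Scope ereal_scope.

(* [h \o Y] is a version of the conditional expectation E[X | Y] (Doob-Dynkin
   form: y |-> h y is E[X | Y = y]). *)
Record is_cond_expectation (X Y : T -> R) (h : R -> R) : Prop := {
  ce_measurable : measurable_fun [set: R] h ;
  ce_integrable : P.-integrable [set: T] (fun x => (h (Y x))%:E) ;
  ce_integral : forall B : set R, measurable B ->
    \int[P]_(x in Y @^-1` B) (h (Y x))%:E = \int[P]_(x in Y @^-1` B) (X x)%:E }.

Definition is_cond_probability (A : set T) (Y : T -> R) (g : R -> R) : Prop :=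
  is_cond_expectation \1_A Y g.

Record is_filtration (F : nat -> set (set T)) : Prop := {
  filt_sigma : forall t, sigma_algebra [set: T] (F t) ;
  filt_measurable : forall t, F t `<=` measurable ;
  filt_incr : forall t, F t `<=` F t.+1 }.

Definition mx_measurable m k (F : set (set T)) (A : T -> 'M[R]_(m, k)) : Prop :=
  forall (i : 'I_m) (j : 'I_k) (B : set R), measurable B ->
    F [set x | B (A x i j)].

Record iid_std_normal d (s : T -> 'cV[R]_d) : Prop := {
  isn_marginal : forall (i : 'I_d) (B : set R), measurable B ->
    P [set x | B (s x i ord0)] = normal_prob 0%R 1%R B ;
  isn_independent : forall B : 'I_d -> set R, (forall i, measurable (B i)) ->
    P [set x | forall i, B i (s x i ord0)] =
    \prod_(i < d) P [set x | B i (s x i ord0)] }.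

(* Mutual independence of the sigma-algebra F, the random vector s and the
   random index set Om; rectangles generate the Borel sets of R^d. *)
Definition independent_of_past n d (F : set (set T)) (s : T -> 'cV[R]_d)
    (Om : T -> {set 'I_n}) : Prop :=
  forall (A : set T) (B : 'I_d -> set R) (C : set {set 'I_n}),
    F A -> (forall i, measurable (B i)) ->
    P (A `&` [set x | forall i, B i (s x i ord0)] `&` [set x | Om x \in C]) =
    P A * P [set x | forall i, B i (s x i ord0)] * P [set x | Om x \in C].

(* Number of sequences of m draws from {0, ..., n-1} whose set of drawn indices
   is J. *)
Definition draws_onto n m (J : {set 'I_n}) : nat :=
  #|[pred f : {ffun 'I_m -> 'I_n} |
       [forall i, (i \in codom f) == (i \in J)]]|.

(* Om is the set of indices obtained by m uniform draws with replacement, each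
   sequence of draws being equally likely.  The set obtained by m unconstrained
   draws is a singleton with positive probability, which would contradict a
   lower bound imposed on #|Om|.  So only the law of Om given its cardinality
   is prescribed: the odds of two sets of the same cardinality are those of the
   draws, and #|Om| itself may have any law on {0, ..., m}. *)
Record sampled_with_replacement n m (Om : T -> {set 'I_n}) : Prop := {
  swr_size : forall x, (#|Om x| <= m)%N ;
  swr_odds : forall J K : {set 'I_n}, #|J| = #|K| ->
    P [set x | Om x = J] * ((draws_onto m K)%:R)%:E =
    P [set x | Om x = K] * ((draws_onto m J)%:R)%:E }.

End Probability.

Section Grouse.
Context {R : realType} {disp : measure_display} {T : measurableType disp}.
Variables (P : probability T R) (n d : nat) (Ubar : 'M[R]_(n, d)).
(* F t: what is known before iteration t;  m t: number of draws at iteration t *)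
Variables (F : nat -> set (set T)) (m : nat -> nat).
Variables (U : nat -> T -> 'M[R]_(n, d)) (s : nat -> T -> 'cV[R]_d).
Variables (Om : nat -> T -> {set 'I_n}) (eta : nat -> T -> R).

Definition observed (t : nat) (x : T) : 'cV[R]_n := Ubar *m s t x.

Definition error (t : nat) (x : T) : R := subspace_error Ubar (U t x).

Definition residual (t : nat) (x : T) : 'cV[R]_n :=
  observed t x - U t x *m (U t x)^T *m observed t x.

Record grouse : Prop := {
  gr_filtration : is_filtration F ;
  gr_U_adapted : forall t, mx_measurable (F t) (U t) ;
  gr_s_adapted : forall t, mx_measurable (F t.+1) (s t) ;
  gr_Om_adapted : forall t (J : {set 'I_n}), F t.+1 [set x | Om t x = J] ;
  gr_normal : forall t, iid_std_normal P (s t) ;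
  gr_sampling : forall t, sampled_with_replacement P (m t) (Om t) ;
  gr_independent : forall t, independent_of_past P (F t) (s t) (Om t) ;
  gr_init : forall x, orthonormal_cols (U 0%N x) ;
  gr_eta : forall t x, well_conditioned (U t x) (Om t x) ->
    0 < eta t x /\
    0 <= grouse_sigma (U t x) (observed t x) (Om t x) * eta t x <= pi / 2 ;
  gr_step : forall t x,
    U t.+1 x = grouse_step (U t x) (observed t x) (Om t x) (eta t x) }.

(* The step length sin (sigma eta) = |r| / |p| exists only if |r| <= |p|;
   nothing is required of the other outcomes. *)
Definition greedy_step_length : Prop :=
  forall t x,
    let r := grouse_r (U t x) (observed t x) (Om t x) in
    let p := grouse_p (U t x) (observed t x) (Om t x) in
    let sigma := grouse_sigma (U t x) (observed t x) (Om t x) in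
    well_conditioned (U t x) (Om t x) -> fnorm r <= fnorm p ->
    sin (sigma * eta t x) = fnorm r / fnorm p.

End Grouse.

(* Main.v *)
(* Put x_t = (I - U U^T) Ubar s, so that the error is |(I - U U^T) Ubar|_F^2.
   A well conditioned step lowers the error by at least (1/2) s^T H s / s^T s, up
   to a second order term, where the matrix H depends on U and on the sampled set
   J only, and s^T H s compares |[x]_J|^2 with |U^T [x]_J|^2.  Sign changes and
   exchanges of the components of s preserve its law, hence E[s^T H s / s^T s] is
   E[tr H] / d.  Given its size c, the set J is uniform; as U^T x = 0, the mean of
   |U^T [x]_J|^2 is of order (c/n) rho |x|^2, where rho bounds the squared rows of
   U, and negligible against the mean (c/n) |x|^2 of |[x]_J|^2.

   Ill conditioned samples are rare by a moment method: for independently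
   selected indices, E tr (gram J)^p obeys a recursion in p in which each rank one
   perturbation u_i u_i^T is replaced by the scalar matrix rho I.  The upper tail
   uses gram J and the lower tail its complement I - gram J. *)

Require Import Defs.
From mathcomp Require Import all_boot all_order all_algebra all_fingroup.
From mathcomp Require Import ring lra zify.
Set Implicit Arguments.
Unset Strict Implicit.
Unset Printing Implicit Defensive.
Import Order.TTheory GRing.Theory Num.Theory.
Local Open Scope ring_scope.

(** * Moments of positive semidefinite matrices *)

Section Psd.
Context {R : realFieldType} {d : nat}.
Implicit Types (x y u : 'cV[R]_d) (B C : 'M[R]_d) (a c rho : R).

(** Powers are used instead of matrix exponentials because exponentials of non-commuting sums do not
    factor, whereas the power recursions only need log-convexity of the moments of a psd matrix at a
    fixed vector. Passing from independent selectors to sets of fixed size costs a factor n + 1; so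
    each tail is pushed down to d / n^2 by taking moment orders proportional to log n. The resulting
    mean failure bound 4 d / n must be compared with c / n, the order of the gain itself, and 40 d
    <= c makes it a tenth of that. The failure bound enters H as a trace, not as an indicator: for
    fixed J it is polynomial in the entries of U, so measurability is immediate and its mean over J
    is what the moment method controls. The quotient s^T H s / s^T s is bounded, so every integral
    converges and only symmetries of the law of s are needed. Conditioning on the error is done by
    integrating against indicators of events in the error; they depend on U alone and can be
    absorbed into the coefficients of H. The rate obtained is q / (4 n d), against at most 0.096 q /
    (n d) in the claim; the margin absorbs the second order term. *)

Definition dotp x y : R := (x^T *m y) 0 0.

Definition psd C : Prop := C^T = C /\ forall x, 0 <= dotp x (C *m x).

Lemma dotpE x y : dotp x y = \sum_i x i 0 * y i 0.
Proof. by rewrite /dotp mxE; apply: eq_bigr => i _; rewrite mxE. Qed.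

Lemma dotpC x y : dotp x y = dotp y x.
Proof. by rewrite !dotpE; apply: eq_bigr => i _; rewrite mulrC. Qed.

Lemma dotpDr x y z : dotp x (y + z) = dotp x y + dotp x z.
Proof. by rewrite /dotp mulmxDr mxE. Qed.

Lemma dotpDl x y z : dotp (x + y) z = dotp x z + dotp y z.
Proof. by rewrite dotpC dotpDr !(dotpC z). Qed.

Lemma dotpZr a x y : dotp x (a *: y) = a * dotp x y.
Proof. by rewrite /dotp -scalemxAr mxE. Qed.

Lemma dotpZl a x y : dotp (a *: x) y = a * dotp x y.
Proof. by rewrite dotpC dotpZr dotpC. Qed.

Lemma dotpNr x y : dotp x (- y) = - dotp x y.
Proof. by rewrite -scaleN1r dotpZr mulN1r. Qed.

Lemma dotpBr x y z : dotp x (y - z) = dotp x y - dotp x z.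
Proof. by rewrite dotpDr dotpNr. Qed.

Lemma dotpBl x y z : dotp (x - y) z = dotp x z - dotp y z.
Proof. by rewrite dotpC dotpBr !(dotpC z). Qed.

Lemma dotp0r x : dotp x 0 = 0.
Proof. by rewrite /dotp mulmx0 mxE. Qed.

Lemma dotp_sumr (I : Type) (r : seq I) (P : pred I) (F : I -> 'cV[R]_d) x :
  dotp x (\sum_(i <- r | P i) F i) = \sum_(i <- r | P i) dotp x (F i).
Proof. by rewrite /dotp mulmx_sumr summxE. Qed.

Lemma dotp_ge0 x : 0 <= dotp x x.
Proof. by rewrite dotpE sumr_ge0// => i _; rewrite -expr2 sqr_ge0. Qed.

Lemma dotp_eq0 x : (dotp x x == 0) = (x == 0).
Proof.
apply/eqP/eqP => [|->]; last by rewrite dotp0r.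
rewrite dotpE => /eqP; rewrite psumr_eq0 => [/allP h|i _]; last first.
  by rewrite -expr2 sqr_ge0.
apply/colP => i; have := h i (mem_index_enum i).
by rewrite -expr2 sqrf_eq0 => /eqP->; rewrite mxE.
Qed.

Lemma dotp_sym C x y : C^T = C -> dotp x (C *m y) = dotp (C *m x) y.
Proof. by move=> sC; rewrite /dotp trmx_mul sC mulmxA. Qed.

Lemma quadratic_discr a b c :
  (forall t, 0 <= a * t ^+ 2 + b * t *+ 2 + c) -> b ^+ 2 <= a * c.
Proof.
move=> h; have [a0|a0|a0] := ltgtP a 0.
- have c0 : 0 <= c by have := h 0; lra.
  (* A concave quadratic is negative far out: this t >= 1 has a t = a - 2|b| - c, so the value at t
     is at most a t - c (t - 1) < 0. *)
  pose t := 1 + (2 * `|b| + c) / - a.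
  have Na : 0 < - a by lra.
  have at_ : a * t = a - 2 * `|b| - c.
    by rewrite /t; field; rewrite lt_eqF.
  have t1 : 1 <= t.
    by rewrite lerDl; apply: divr_ge0; have := normr_ge0 b; lra.
  have bt : b * t <= `|b| * t by rewrite ler_wpM2r ?ler_norm//; lra.
  have ct : 0 <= c * (t - 1) by rewrite mulr_ge0// subr_ge0.
  have at0 : a * t < 0 by rewrite nmulr_rlt0//; lra.
  have := h t; rewrite expr2 mulrA {1}at_ => ht.
  by exfalso; lra.
- have := h (- b / a); rewrite -(ler_pM2l a0) mulr0.
  suff -> : a * (a * (- b / a) ^+ 2 + b * (- b / a) *+ 2 + c) = a * c - b ^+ 2.
    lra.
  by field; rewrite gt_eqF.
- subst a; have [->|b0] := eqVneq b 0; first by rewrite expr0n mul0r.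
  have := h (- (c + 1) / (b *+ 2)); rewrite mul0r add0r -mulrnAl mulrC divfK; first lra.
  by rewrite mulrn_eq0.
Qed.

Lemma psd_cauchy C x y : psd C ->
  dotp x (C *m y) ^+ 2 <= dotp x (C *m x) * dotp y (C *m y).
Proof.
move=> [sC pC]; apply: quadratic_discr => t.
have := pC (t *: x + y).
rewrite mulmxDr -scalemxAr !dotpDl !dotpDr !dotpZl !dotpZr.
by rewrite (dotpC y (C *m x)) -(dotp_sym x y sC) => h; lra.
Qed.

Lemma psd1 : psd 1%:M.
Proof. by split=> [|x]; rewrite ?trmx1// mul1mx dotp_ge0. Qed.

Lemma cauchy_schwarz x y : dotp x y ^+ 2 <= dotp x x * dotp y y.
Proof. by have := psd_cauchy x y psd1; rewrite !mul1mx. Qed.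

Lemma psdD B C : psd B -> psd C -> psd (B + C).
Proof.
move=> [sB pB] [sC pC]; split=> [|x]; first by rewrite raddfD /= sB sC.
by rewrite mulmxDl dotpDr addr_ge0.
Qed.

Lemma psd0 : psd 0.
Proof. by split=> [|x]; rewrite ?trmx0// mul0mx dotp0r. Qed.

Lemma psd_scalar a : 0 <= a -> psd a%:M.
Proof.
move=> a0; split=> [|x]; first by rewrite tr_scalar_mx.
by rewrite mul_scalar_mx dotpZr mulr_ge0 ?dotp_ge0.
Qed.

Lemma mul_rank1 u x : u *m u^T *m x = dotp u x *: u.
Proof. by rewrite -mulmxA [u^T *m x]mx11_scalar mul_mx_scalar. Qed.

Lemma psd_rank1 u : psd (u *m u^T).
Proof.
split=> [|x]; first by rewrite trmx_mul trmxK.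
by rewrite mul_rank1 dotpZr dotpC -expr2 sqr_ge0.
Qed.

Lemma psd_sum (I : Type) (r : seq I) (P : pred I) (F : I -> 'M[R]_d) :
  (forall i, P i -> psd (F i)) -> psd (\sum_(i <- r | P i) F i).
Proof. by move=> h; elim/big_ind: _ => //; [apply: psd0|apply: psdD]. Qed.

Lemma psd_exp B m : psd B -> psd (B ^+ m).
Proof.
move=> pB; have [sB _] := pB.
(* Two consecutive powers are carried because B^(m+2) = B B^m B is the conjugate of a power two
   steps lower. *)
suff: psd (B ^+ m) /\ psd (B ^+ m.+1) by case.
elim: m => [|m [IH1 IH2]]; first by rewrite expr1; split=> //; apply: psd1.
split=> //; split=> [|x].
  by rewrite exprS exprSr -!mulmxE !trmx_mul sB (proj1 IH1) mulmxA.
by rewrite exprS exprSr -!mulmxE -!mulmxA dotp_sym//; apply: (proj2 IH1).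
Qed.

(** No diagonalization is involved: the form of [C] at x_i e_j - x_j e_i is nonnegative, and summed
    over all i and j it is twice the difference of the two sides. *)
Lemma psd_tr_ge x C : psd C -> dotp x (C *m x) <= \tr C * dotp x x.
Proof.
move=> [sC pC].
pose e i : 'cV[R]_d := delta_mx i 0.
have eC i j : dotp (e i) (C *m e j) = C i j.
  by rewrite /dotp /e -colE trmx_delta -rowE !mxE.
have h i j : 0 <= x i 0 ^+ 2 * C j j + x j 0 ^+ 2 * C i i - x i 0 * x j 0 * C i j *+ 2.
  have := pC (x i 0 *: e j - x j 0 *: e i).
  rewrite mulmxBr -!scalemxAr !dotpBl !dotpBr !dotpZl !dotpZr !eC.
  have -> : C j i = C i j by rewrite -{1}sC mxE.
  by move=> hh; lra.
have : 0 <= \sum_i \sum_j (x i 0 ^+ 2 * C j j + x j 0 ^+ 2 * C i i - x i 0 * x j 0 * C i j *+ 2).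
  by apply: sumr_ge0 => i _; apply: sumr_ge0.
have -> : \sum_i \sum_j (x i 0 ^+ 2 * C j j + x j 0 ^+ 2 * C i i - x i 0 * x j 0 * C i j *+ 2)
  = (\tr C * dotp x x - dotp x (C *m x)) *+ 2.
  have E1 : \sum_i \sum_j x i 0 ^+ 2 * C j j = \tr C * dotp x x.
    rewrite dotpE mulr_sumr; apply: eq_bigr => i _.
    by rewrite -expr2 -mulr_sumr mulrC.
  have E2 : \sum_i \sum_j x j 0 ^+ 2 * C i i = \tr C * dotp x x.
    rewrite exchange_big -E1; apply: eq_bigr => i _; exact: eq_bigr.
  have E3 : \sum_i \sum_j x i 0 * x j 0 * C i j = dotp x (C *m x).
    rewrite dotpE; apply: eq_bigr => i _; rewrite mxE mulr_sumr.
    by apply: eq_bigr => j _; ring.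
  transitivity (\sum_i (\sum_j x i 0 ^+ 2 * C j j + \sum_j x j 0 ^+ 2 * C i i
      - (\sum_j x i 0 * x j 0 * C i j) *+ 2)).
    by apply: eq_bigr => i _; rewrite sumrB big_split /= -sumrMnl.
  by rewrite sumrB big_split /= sumrMnl E1 E2 E3; ring.
by rewrite pmulrn_lge0// subr_ge0.
Qed.

Lemma psd_tr_ge0 C : psd C -> 0 <= \tr C.
Proof.
move=> [sC pC]; apply: sumr_ge0 => i _.
have := pC (delta_mx i 0).
by rewrite /dotp -colE trmx_delta -rowE !mxE.
Qed.

(** [eigenvalue] refers to row eigenvectors; by symmetry of [B] the transpose is a column
    eigenvector, at which [psd_tr_ge] for [B ^+ m] gives the bound. *)
Lemma eigenvalue_tr_exp B a m : psd B -> eigenvalue B a -> a ^+ m <= \tr (B ^+ m).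
Proof.
move=> pB /eigenvalueP[v /eqP vB v0]; have [sB _] := pB.
have Bv : B *m v^T = a *: v^T.
  by rewrite -[B]trmxK sB -trmx_mul (eqP vB) linearZ.
have Bmv : B ^+ m *m v^T = a ^+ m *: v^T.
  elim: m => [|m IH]; first by rewrite !expr0 mul1mx scale1r.
  by rewrite exprS -mulmxE -mulmxA IH -scalemxAr Bv scalerA exprSr.
have := psd_tr_ge v^T (psd_exp m pB); rewrite Bmv dotpZr ler_pM2r//.
by rewrite lt_neqAle dotp_ge0 andbT eq_sym dotp_eq0 trmx_eq0.
Qed.

Lemma moment_ge0 B m u : psd B -> 0 <= dotp u (B ^+ m *m u).
Proof. by move=> pB; apply: (proj2 (psd_exp m pB)). Qed.

(** Log-convexity of the moments: Cauchy-Schwarz in the form of [B ^+ m], applied to [u] and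
    [B *m u]. *)
Lemma moment_sqr_le B m u : psd B ->
  dotp u (B ^+ m.+1 *m u) ^+ 2
    <= dotp u (B ^+ m *m u) * dotp u (B ^+ m.+2 *m u).
Proof.
move=> pB; have [sB _] := pB.
have := psd_cauchy u (B *m u) (psd_exp m pB).
rewrite [B ^+ m *m (B *m u)]mulmxA mulmxE -exprSr.
by rewrite -(dotp_sym _ _ sB) mulmxA mulmxE -exprS.
Qed.

(** The correlation inequality for the increasing functions x^i and x^j under the spectral measure
    of [B] at [u]. By log-convexity the ratios of successive moments increase, so units can be moved
    one at a time from the smaller exponent to the larger one until the smaller is 0. *)
Lemma moment_mul_le B i j u : psd B ->
  dotp u (B ^+ i *m u) * dotp u (B ^+ j *m u) <= dotp u u * dotp u (B ^+ (i + j) *m u).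
Proof.
move=> pB; pose b m := dotp u (B ^+ m *m u).
have b0 m : 0 <= b m by apply: moment_ge0.
have bb m : b m.+1 ^+ 2 <= b m * b m.+2 by apply: moment_sqr_le.
have step k l : b k.+1 * b (k + l)%N <= b k * b (k + l).+1.
  elim: l => [|l IH]; first by rewrite addn0 mulrC.
  (* If this moment vanishes the left side is 0; otherwise log-convexity makes the preceding moment
     positive, and one may divide by it. *)
  rewrite addnS; have := b0 (k + l).+1; rewrite le_eqVlt => /orP[/eqP<-|bp].
    by rewrite mulr0 mulr_ge0.
  have bl : 0 < b (k + l)%N.
    rewrite lt_neqAle b0 andbT eq_sym; apply/eqP => bl0.
    by have := bb (k + l)%N; rewrite bl0 mul0r leNgt exprn_gt0.
  rewrite -(ler_pM2r bl).
  apply: (@le_trans _ _ (b k * b (k + l).+1 ^+ 2)).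
    by rewrite expr2 mulrA mulrAC ler_wpM2r.
  by rewrite -mulrA ler_wpM2l// mulrC.
wlog ij : i j / (i <= j)%N => [W|].
  by case/orP: (leq_total i j) => /W//; rewrite mulrC addnC.
suff h k : (k <= i)%N -> b i * b j <= b (i - k)%N * b (j + k)%N.
  by have := h i (leqnn _); rewrite subnn /b expr0 mul1mx addnC.
elim: k => [|k IH] ki; first by rewrite subn0 addn0.
apply: le_trans (IH (ltnW ki)) _; rewrite addnS.
have := step (i - k.+1)%N (j + k - (i - k.+1))%N.
by rewrite subnSK// subnKC//; lia.
Qed.

Lemma moment_shift B rho j m u :
  dotp u (B ^+ j *m (B + rho%:M) ^+ m.+1 *m u) =
  dotp u (B ^+ j.+1 *m (B + rho%:M) ^+ m *m u) +
  rho * dotp u (B ^+ j *m (B + rho%:M) ^+ m *m u).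
Proof.
rewrite exprS !mulmxE mulrA mulrDr -exprSr mulrDl.
rewrite -!mulmxE mulmxDl dotpDr; congr (_ + _).
by rewrite mul_mx_scalar -scalemxAl -scalemxAl dotpZr.
Qed.

Lemma shift_moment_ge0 B rho j m u : psd B -> 0 <= rho ->
  0 <= dotp u (B ^+ j *m (B + rho%:M) ^+ m *m u).
Proof.
move=> pB r0; elim: m j => [|m IH] j.
  by rewrite expr0 mulmx1 moment_ge0.
by rewrite moment_shift addr_ge0// mulr_ge0.
Qed.

Lemma moment_le_shift B rho m u : psd B -> 0 <= rho ->
  dotp u (B ^+ m *m u) <= dotp u ((B + rho%:M) ^+ m *m u).
Proof.
move=> pB r0.
suff h j : dotp u (B ^+ (j + m) *m u) <= dotp u (B ^+ j *m (B + rho%:M) ^+ m *m u).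
  by have := h 0%N; rewrite expr0 mul1mx.
elim: m j => [|m IH] j; first by rewrite addn0 expr0 mulmx1.
rewrite moment_shift -addSnnS (le_trans (IH j.+1))// lerDl.
by rewrite mulr_ge0// shift_moment_ge0.
Qed.

(** Expanding one factor [B + rho%:M] at a time leaves nonnegative combinations of plain moments, to
    which [moment_mul_le] applies; the auxiliary exponent l collects the factors [B] produced on the
    way. *)
Lemma moment_mul_shift_le B rho i j u : psd B -> 0 <= rho ->
  dotp u (B ^+ j *m u) * dotp u ((B + rho%:M) ^+ i *m u) <=
  dotp u u * dotp u (B ^+ j *m (B + rho%:M) ^+ i *m u).
Proof.
move=> pB r0.
suff h l : dotp u (B ^+ j *m u) * dotp u (B ^+ l *m (B + rho%:M) ^+ i *m u) <=
  dotp u u * dotp u (B ^+ (j + l) *m (B + rho%:M) ^+ i *m u).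
  by have := h 0%N; rewrite addn0 expr0 mul1mx.
elim: i l => [|i IH] l; first by rewrite !expr0 !mulmx1 moment_mul_le.
rewrite !moment_shift !mulrDr lerD//; first by rewrite -addnS.
by rewrite mulrCA [leRHS]mulrCA ler_wpM2l.
Qed.

(* In the quadratic form of u itself, u u^T may be replaced by the scalar
   matrix rho, although u u^T <= rho does not pass to powers in general. *)
Lemma rank1_moment_le B rho m u : psd B -> dotp u u <= rho ->
  dotp u ((B + u *m u^T) ^+ m *m u) <= dotp u ((B + rho%:M) ^+ m *m u).
Proof.
move=> pB ur; have r0 : 0 <= rho by apply: le_trans ur; apply: dotp_ge0.
suff h j : dotp u (B ^+ j *m (B + u *m u^T) ^+ m *m u) <=
           dotp u (B ^+ j *m (B + rho%:M) ^+ m *m u).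
  by have := h 0%N; rewrite expr0 !mul1mx.
elim: m j => [|m IH] j; first by rewrite !expr0.
(* Peeling off one factor: its rank one part splits the form into a product of two moments. The
   induction hypothesis at exponent 0 bounds the second, the correlation inequality merges the
   product again, and the factor |u|^2 it produces is at most [rho]. *)
have -> : dotp u (B ^+ j *m (B + u *m u^T) ^+ m.+1 *m u) =
    dotp u (B ^+ j.+1 *m (B + u *m u^T) ^+ m *m u) +
    dotp u (B ^+ j *m u) * dotp u ((B + u *m u^T) ^+ m *m u).
  rewrite exprS !mulmxE mulrA mulrDr -exprSr mulrDl.
  rewrite -!mulmxE mulmxDl dotpDr; congr (_ + _).
  by rewrite -!mulmxA [u *m (u^T *m _)]mulmxA mul_rank1 -scalemxAr dotpZr mulrC.
rewrite moment_shift lerD//.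
apply: (@le_trans _ _ (dotp u (B ^+ j *m u) * dotp u ((B + rho%:M) ^+ m *m u))).
  by rewrite ler_wpM2l ?moment_ge0//; have := IH 0%N; rewrite expr0 !mul1mx.
apply: le_trans (moment_mul_shift_le _ _ _ pB r0) _.
by rewrite ler_wpM2r ?shift_moment_ge0.
Qed.

(** The trace form of (x + rho)^(m+1) - x^(m+1) <= (m+1) rho (x + rho)^m. The induction carries a
    factor [B ^+ j] because each expansion trades a shifted factor for a plain one. *)
Lemma tr_shift_exp_le B rho m : psd B -> 0 <= rho ->
  \tr ((B + rho%:M) ^+ m.+1) <=
  \tr (B ^+ m.+1) + m.+1%:R * rho * \tr ((B + rho%:M) ^+ m).
Proof.
move=> pB r0.
pose t j i := \tr (B ^+ j *m (B + rho%:M) ^+ i).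
have tS j i : t j i.+1 = t j.+1 i + rho * t j i.
  rewrite /t exprS !mulmxE mulrA mulrDr -exprSr mulrDl mxtraceD; congr (_ + _).
  by rewrite -!mulmxE mul_mx_scalar -scalemxAl mxtraceZ.
have t0 j i : 0 <= t j i.
  elim: i j => [|i IH] j; first by rewrite /t expr0 mulmx1 psd_tr_ge0//; apply: psd_exp.
  by rewrite tS addr_ge0// mulr_ge0.
suff h j : t j m.+1 <= t (j + m.+1)%N 0%N + m.+1%:R * rho * t j m.
  by have := h 0%N; rewrite /t add0n !expr0 !mul1mx mulmx1.
elim: m j => [|m IH] j; first by rewrite tS addn1 mul1r.
have := IH j.+1; rewrite addSnnS => h1.
rewrite (tS j m.+1) (tS j m) !mulrDr.
have : 0 <= rho * t j.+1 m by rewrite mulr_ge0.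
have : 0 <= rho * (rho * t j m) by rewrite mulr_ge0 ?mulr_ge0.
have : 0 <= m.+1%:R * rho * (rho * t j m) by rewrite !mulr_ge0.
move: h1; rewrite -[m.+2%:R]natr1.
lra.
Qed.

End Psd.

(** * Independent selectors *)

Section Selectors.
Context {R : realFieldType} {n : nat}.
Implicit Types (k : R) (J : {set 'I_n}).

(* Weight of J when every index is selected independently with probability k. *)
Definition bern_weight k J : R := k ^+ #|J| * (1 - k) ^+ (n - #|J|).

Lemma bern_weight_ge0 k J : 0 <= k <= 1 -> 0 <= bern_weight k J.
Proof. by case/andP=> k0 k1; rewrite mulr_ge0// exprn_ge0// subr_ge0. Qed.

Lemma sum_set_split (i : 'I_n) (F : {set 'I_n} -> R) :
  \sum_J F J = \sum_(J : {set 'I_n} | i \notin J) (F J + F (i |: J)).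
Proof.
rewrite big_split /= (bigID (fun J : {set 'I_n} => i \notin J)) /=; congr (_ + _).
rewrite (reindex_onto (fun J => i |: J) (fun J : {set 'I_n} => J :\ i)) /=; last first.
  by move=> J; rewrite negbK => iJ; rewrite setD1K.
apply: eq_bigl => J; rewrite setU11 /=.
apply/idP/idP => [/eqP<-|iJ]; first by rewrite !inE eqxx.
by rewrite setU1K.
Qed.

(** Pairing each J avoiding i with [i |: J], whose weights are in ratio 1 - k to k: i is selected
    with probability k, independently of the other indices. *)
Lemma bern_weight_mem k (i : 'I_n) (F : {set 'I_n} -> R) :
  \sum_J bern_weight k J * ((i \in J)%:R * F J) =
  k * \sum_J bern_weight k J * F (i |: J).
Proof.
rewrite !(sum_set_split i) mulr_sumr; apply: eq_bigr => J iJ.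
rewrite (negbTE iJ) mul0r mulr0 add0r setU11 mul1r setUA setUid -mulrDl mulrA.
congr (_ * _); rewrite /bern_weight cardsU1 iJ add1n.
have Jn : (#|J| < n)%N.
  rewrite -[X in (_ < X)%N](card_ord n) -(cardsC J) -[X in (X < _)%N]addn0.
  by rewrite ltn_add2l card_gt0; apply/set0Pn; exists i; rewrite inE.
by rewrite -(subnSK Jn) !exprS; ring.
Qed.

Definition binom_weight k (j : nat) : R := 'C(n, j)%:R * (k ^+ j * (1 - k) ^+ (n - j)).

Lemma sum_binom_weight k : \sum_(j < n.+1) binom_weight k j = 1.
Proof.
rewrite -[RHS](expr1n _ n) -[in RHS](subrK k 1) exprDn.
by apply: eq_bigr => j _; rewrite /binom_weight mulr_natl [k ^+ _ * _]mulrC.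
Qed.

Lemma sum_card_set (F : nat -> R) :
  \sum_(J : {set 'I_n}) F #|J| = \sum_(j < n.+1) 'C(n, j)%:R * F j.
Proof.
rewrite (partition_big (fun J => inord #|J| : 'I_n.+1) predT)//=.
apply: eq_bigr => j _.
transitivity (\sum_(J : {set 'I_n} | #|J| == j) F j).
  apply: eq_big => J; last move=> /eqP <-.
    by rewrite -val_eqE /= inordK// ltnS -[X in (_ <= X)%N](card_ord n) max_card.
  by rewrite inordK// ltnS -[X in (_ <= X)%N](card_ord n) max_card.
rewrite sumr_const -[LHS]mulr_natl; congr (_%:R * _).
have := card_draws 'I_n j; rewrite card_ord => <-.
by apply: eq_card => J; rewrite [RHS]inE.
Qed.

Lemma sum_bern_weight k : \sum_J bern_weight k J = 1.
Proof.
rewrite -(sum_binom_weight k).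
exact: (sum_card_set (fun j => k ^+ j * (1 - k) ^+ (n - j))).
Qed.

(* The binomial law B(n, c/n) has its mode at c, hence gives c a mass of at
   least 1/(n+1). *)
Lemma binom_weight_mode (c : nat) : (0 < c <= n)%N ->
  1 <= n.+1%:R * binom_weight (c%:R / n%:R) c.
Proof.
move=> /andP[c0 cn]; have n0 : (0 < n)%N by apply: leq_trans cn.
have nR : 0 < n%:R :> R by rewrite ltr0n.
set k := c%:R / n%:R; pose t := binom_weight k.
have k0 : 0 < k by rewrite divr_gt0 ?ltr0n.
have k1 : k <= 1 by rewrite ler_pdivrMr// mul1r ler_nat.
have k0' := ltW k0.
have t0 j : 0 <= t j by rewrite !mulr_ge0 ?exprn_ge0 ?subr_ge0.
(* The ratio of consecutive binomial masses, cross-multiplied because n - c may vanish. *)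
have rec j : (j < n)%N -> t j.+1 * (j.+1%:R * (n%:R - c%:R)) = t j * ((n%:R - j%:R) * c%:R).
  move=> jn; rewrite /t /binom_weight -(subnSK jn) !exprS.
  have E : 'C(n, j.+1)%:R * j.+1%:R = (n%:R - j%:R) * 'C(n, j)%:R :> R.
    by rewrite -natrB ?(ltnW jn)// -!natrM -mul_bin_left mulnC.
  have -> : c%:R = n%:R * k by rewrite /k mulrC divfK// gt_eqF.
  transitivity (('C(n, j.+1)%:R * j.+1%:R) * (k * k ^+ j * (1 - k) ^+ (n - j.+1) * (n%:R * (1 - k)))).
    by ring.
  by rewrite E; ring.
have tc j : (j <= n)%N -> t j <= t c.
  (* For c = n the law is concentrated at n, and [rec] carries no information about t (j + 1); this
     case is computed directly. *)
  move: cn; rewrite leq_eqVlt => /orP[/eqP cn|cn] jn.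
    move: jn; rewrite leq_eqVlt => /orP[/eqP->|jn]; first by rewrite cn.
    rewrite {1}/t /binom_weight /k cn divff ?gt_eqF// subrr -(subnSK jn) expr0n /=.
    by rewrite !mulr0.
  have ncR : 0 < n%:R - c%:R :> R by rewrite subr_gt0 ltr_nat.
  have [jc|cj] := leqP j c.
    have up i : (i <= c)%N -> t (c - i)%N <= t c.
      elim: i => [|i IH] ic; first by rewrite subn0.
      apply: le_trans (IH (ltnW ic)); set j' := (c - i.+1)%N.
      have Ej : (c - i = j'.+1)%N by rewrite /j' subnSK.
      have j'c : (j' < c)%N by rewrite -Ej leq_subr.
      rewrite Ej; have := rec j' (ltn_trans j'c cn) => r.
      rewrite -(@ler_pM2r _ ((n%:R - j'%:R) * c%:R)); last first.
        by rewrite mulr_gt0 ?ltr0n// subr_gt0 ltr_nat (ltn_trans j'c cn).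
      rewrite -r ler_wpM2l//.
      have : j'%:R + 1 <= c%:R :> R by rewrite natr1 ler_nat.
      rewrite -[j'.+1%:R]natr1 => h; have c0' : 0 <= c%:R :> R by [].
      have : 0 <= n%:R * (c%:R - (j'%:R + 1)) :> R by rewrite mulr_ge0// subr_ge0.
      lra.
    by have := up (c - j)%N (leq_subr _ _); rewrite subKn.
  have down i : (c + i <= n)%N -> t (c + i)%N <= t c.
    elim: i => [|i IH] ic; first by rewrite addn0.
    have ic' : (c + i < n)%N by rewrite -addnS.
    apply: le_trans (IH (ltnW ic')); rewrite addnS; set j' := (c + i)%N.
    have := rec j' ic' => r.
    rewrite -(@ler_pM2r _ (j'.+1%:R * (n%:R - c%:R))); last by rewrite mulr_gt0.
    rewrite r ler_wpM2l//.
    have : c%:R <= j'%:R :> R by rewrite ler_nat leq_addr.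
    rewrite -[j'.+1%:R]natr1 => h.
    have : 0 <= n%:R * (j'%:R - c%:R) :> R by rewrite mulr_ge0// subr_ge0.
    by move: ncR; lra.
  by have := down (j - c)%N; rewrite subnKC ?(ltnW cj)//; apply.
rewrite -[leLHS](sum_binom_weight k) mulr_natl -[X in _ *+ X](card_ord n.+1) -sumr_const.
by apply: ler_sum => j _; apply: tc; rewrite -ltnS.
Qed.

Context {d : nat} (u : 'I_n -> 'cV[R]_d) (rho : R).

Definition gram J : 'M[R]_d := \sum_(i in J) u i *m (u i)^T.

Lemma gram_psd J : psd (gram J).
Proof. by apply: psd_sum => i _; apply: psd_rank1. Qed.

Lemma gramU1 i J : gram (i |: J) = gram (J :\ i) + u i *m (u i)^T.
Proof.
rewrite /gram (big_setD1 i) ?setU11//= addrC; congr (_ + _).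
by apply: eq_bigl => j; rewrite !inE; case: eqP.
Qed.

Lemma gramD1 i J : gram J = gram (J :\ i) + (i \in J)%:R *: (u i *m (u i)^T).
Proof.
have [iJ|iJ] := boolP (i \in J).
  by rewrite scale1r -gramU1; congr gram; apply/setP => j; rewrite !inE; case: eqP => //= ->.
rewrite scale0r addr0; congr gram; apply/setP => j; rewrite !inE.
by case: eqP => [->|]//=; apply/negbTE.
Qed.

Hypothesis tight : gram setT = 1%:M.
Hypothesis rho_ge : forall i, dotp (u i) (u i) <= rho.
Hypothesis rho_ge0 : 0 <= rho.

Lemma gramC J : gram (~: J) = 1%:M - gram J.
Proof.
rewrite -tight /gram [in RHS](bigID (mem J)) /= addrAC [X in X + _](_ : _ = 0).
  by rewrite add0r; apply: eq_bigl => i; rewrite !inE.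
by apply/eqP; rewrite subr_eq0; apply/eqP; apply: eq_bigl => i; rewrite !inE.
Qed.

Lemma tr_rank1_mul (v : 'cV[R]_d) (C : 'M[R]_d) : \tr (v *m v^T *m C) = dotp v (C *m v).
Proof. by rewrite -mulmxA mxtrace_mulC -mulmxA [\tr _]big_ord1. Qed.

Lemma tr_gram_mul J (C : 'M[R]_d) :
  \tr (gram J *m C) = \sum_i (i \in J)%:R * dotp (u i) (C *m u i).
Proof.
rewrite mulmx_suml raddf_sum big_mkcond /=; apply: eq_bigr => i _.
by case: ifP; rewrite ?mul1r ?mul0r// => _; rewrite tr_rank1_mul.
Qed.

Lemma tr_tight (C : 'M[R]_d) : \tr C = \sum_i dotp (u i) (C *m u i).
Proof.
rewrite -[C in LHS]mul1mx -tight tr_gram_mul.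
by apply: eq_bigr => i _; rewrite inE mul1r.
Qed.

(** Decoupling: the trace is a sum over selected i, and selecting i contributes the probability k
    and forces i into the sample seen by [C]. *)
Lemma bern_tr_gram_mul k (C : {set 'I_n} -> 'M[R]_d) :
  \sum_J bern_weight k J * \tr (gram J *m C J) =
  k * \sum_J bern_weight k J * \sum_i dotp (u i) (C (i |: J) *m u i).
Proof.
under eq_bigr do rewrite tr_gram_mul mulr_sumr.
rewrite exchange_big /=.
under [in RHS]eq_bigr do rewrite mulr_sumr.
rewrite [in RHS]exchange_big mulr_sumr /=; apply: eq_bigr => i _.
exact: (bern_weight_mem k i (fun J => dotp (u i) (C J *m u i))).
Qed.

Section Moments.
Variable k : R.
Hypothesis k01 : 0 <= k <= 1.

Let w := bern_weight k.
Let w_ge0 J : 0 <= w J := bern_weight_ge0 J k01.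
Let k_ge0 : 0 <= k. Proof. by case/andP: k01. Qed.

Let bern_le (F G : {set 'I_n} -> R) :
  (forall J, F J <= G J) -> \sum_J w J * F J <= \sum_J w J * G J.
Proof. by move=> h; apply: ler_sum => J _; rewrite ler_wpM2l. Qed.

(** After decoupling, the form at u_i sees the sample with i forced in. If i was absent, the extra
    u_i u_i^T costs at most the shift [rho] by [rank1_moment_le]; if it was present, nothing is
    added. Tightness reassembles the forms at all u_i into one trace. *)
Lemma gram_moment_step m :
  \sum_J w J * \tr (gram J ^+ m.+1) <=
  k * \sum_J w J * \tr ((gram J + rho%:M) ^+ m).
Proof.
under eq_bigr do rewrite exprS -mulmxE.
rewrite bern_tr_gram_mul ler_wpM2l//; apply: bern_le => J.
rewrite [leRHS]tr_tight; apply: ler_sum => i _.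
rewrite gramU1; have [iJ|iJ] := boolP (i \in J).
  have -> : gram J = gram (J :\ i) + u i *m (u i)^T by rewrite [LHS](gramD1 i) iJ scale1r.
  by apply: moment_le_shift => //; rewrite -gramU1; apply: gram_psd.
have -> : gram J = gram (J :\ i) by rewrite [LHS](gramD1 i) (negbTE iJ) scale0r addr0.
exact: rank1_moment_le (gram_psd _) (rho_ge i).
Qed.

Lemma bern_tr_id : \sum_J w J * \tr (1%:M : 'M[R]_d) = d%:R.
Proof. by rewrite -mulr_suml sum_bern_weight mul1r mxtrace1. Qed.

(** The hypothesis makes the powers of [b] a supersolution of the scalar recursion. The shifted
    power is expanded binomially, which involves all lower moments and hence strong induction, and
    the bounds recombine to (b + rho)^m. *)
Lemma gram_moment_le b p :
  (forall m, (m < p)%N -> k * (b + rho) ^+ m <= b ^+ m.+1) ->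
  \sum_J w J * \tr (gram J ^+ p) <= d%:R * b ^+ p.
Proof.
move=> hb; suff h m : (m <= p)%N -> \sum_J w J * \tr (gram J ^+ m) <= d%:R * b ^+ m.
  exact: h.
have [q] := ubnP m; elim: q m => // q IH [|m] mq mp.
  by under eq_bigr do rewrite expr0; rewrite bern_tr_id expr0 mulr1.
apply: le_trans (gram_moment_step m) _.
apply: (@le_trans _ _ (k * (d%:R * (b + rho) ^+ m))); last first.
  by rewrite mulrCA ler_wpM2l// hb.
rewrite ler_wpM2l//.
have -> : \sum_J w J * \tr ((gram J + rho%:M) ^+ m) =
   \sum_(i < m.+1) (rho ^+ i *+ 'C(m, i)) * \sum_J w J * \tr (gram J ^+ (m - i)).
  under [RHS]eq_bigr do rewrite mulr_sumr.
  rewrite exchange_big; apply: eq_bigr => J _ /=.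
  rewrite exprDn_comm; last exact: comm_mx_scalar.
  rewrite raddf_sum mulr_sumr; apply: eq_bigr => i _ /=.
  rewrite raddfMn /= -[(rho%:M) ^+ i]rmorphXn /= -mulmxE mul_mx_scalar mxtraceZ.
  by rewrite mulrnAr mulrnAl mulrCA.
rewrite exprDn mulr_sumr; apply: ler_sum => i _.
rewrite [_ * rho ^+ i]mulrC -mulrnAl mulrCA.
rewrite ler_wpM2l ?mulrn_wge0 ?exprn_ge0// IH//; last by rewrite (leq_trans _ (ltnW mp))// leq_subr.
by rewrite (leq_ltn_trans (leq_subr _ _))// -ltnS.
Qed.

(** With C = gram (~: J) + rho, tightness gives gram J = (1 + rho) - C, hence tr C^(m+1) = (1 + rho)
    tr C^m - tr (gram J C^m). Forcing i into J removes u_i u_i^T from the complement; in the form at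
    u_i the shift already present in C compensates for it. *)
Lemma cogram_moment_step m :
  \sum_J w J * \tr ((gram (~: J) + rho%:M) ^+ m.+1) <=
  (1 + rho) * (\sum_J w J * \tr ((gram (~: J) + rho%:M) ^+ m))
  - k * \sum_J w J * \tr (gram (~: J) ^+ m).
Proof.
have h : k * (\sum_J w J * \tr (gram (~: J) ^+ m)) <=
   \sum_J w J * \tr (gram J *m (gram (~: J) + rho%:M) ^+ m).
  rewrite bern_tr_gram_mul ler_wpM2l//; apply: bern_le => J.
  rewrite [leLHS]tr_tight; apply: ler_sum => i _.
  have -> : ~: (i |: J) = (~: J) :\ i by apply/setP => j; rewrite !inE negb_or.
  rewrite [gram (~: J)](gramD1 i).
  case: (i \in ~: J); rewrite ?scale1r ?scale0r ?addr0.
    exact: rank1_moment_le (gram_psd _) (rho_ge i).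
  exact: moment_le_shift (gram_psd _) _.
apply: le_trans (lerB (lexx _) h); rewrite mulr_sumr -sumrB le_eqVlt.
apply/orP; left; apply/eqP; apply: eq_bigr => J _.
rewrite mulrCA -mulrBr; congr (_ * _).
have -> : gram J = (1 + rho)%:M - (gram (~: J) + rho%:M).
  by rewrite gramC raddfD /= opprD opprB addrACA subrr addr0 addrC subrK.
by rewrite mulmxBl mul_scalar_mx raddfB /= mxtraceZ exprS -mulmxE subKr.
Qed.

(** The term subtracted by [cogram_moment_step] lacks the shift; [tr_shift_exp_le] restores it at
    the price of a lower moment. The outcome is a two-term recursion, and the second hypothesis says
    that powers of [b] dominate it up to order [p]. *)
Lemma cogram_moment_le b p :
  1 + rho - k <= b -> (1 + rho - k) * b + k * p%:R * rho <= b ^+ 2 ->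
  \sum_J w J * \tr ((gram (~: J) + rho%:M) ^+ p) <= d%:R * b ^+ p.
Proof.
move=> b1 b2; pose N m := \sum_J w J * \tr ((gram (~: J) + rho%:M) ^+ m).
have a0 : 0 <= 1 + rho - k by case/andP: k01 => _ k1; rewrite addrAC addr_ge0// subr_ge0.
have b0 : 0 <= b by apply: le_trans b1.
have N0 : N 0%N = d%:R by rewrite /N; under eq_bigr do rewrite expr0; rewrite bern_tr_id.
have N1 : N 1%N <= d%:R * b.
  apply: le_trans (cogram_moment_step 0) _; rewrite -/(N 0%N) N0.
  by rewrite -mulrBl mulrC ler_wpM2l.
have NS m : N m.+2 <= (1 + rho - k) * N m.+1 + k * m.+1%:R * rho * N m.
  apply: le_trans (cogram_moment_step m.+1) _; rewrite -/(N m.+1).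
  have : N m.+1 <= (\sum_J w J * \tr (gram (~: J) ^+ m.+1)) + m.+1%:R * rho * N m.
    rewrite /N mulr_sumr -big_split /=; apply: ler_sum => J _.
    rewrite mulrCA -mulrDr ler_wpM2l// tr_shift_exp_le//; exact: gram_psd.
  rewrite -(subr_ge0 (N m.+1)) => /(mulr_ge0 k_ge0); lra.
suff h m : (m.+1 <= p)%N -> N m <= d%:R * b ^+ m /\ N m.+1 <= d%:R * b ^+ m.+1.
  by case: p b2 h => [|p] _ h; [rewrite -/(N 0%N) N0 expr0 mulr1|have [] := h p (leqnn _)].
elim: m => [|m IH] mp; first by rewrite N0 expr0 mulr1 expr1.
have [h1 h2] := IH (ltnW mp); split=> //.
apply: le_trans (NS m) _.
apply: (@le_trans _ _ ((1 + rho - k) * (d%:R * b ^+ m.+1) + k * p%:R * rho * (d%:R * b ^+ m))).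
  apply: lerD; first by rewrite ler_wpM2l.
  apply: ler_pM => //; last by rewrite ler_wpM2r// ler_wpM2l// ler_nat ltnW.
    by rewrite !mulr_ge0.
  by apply: sumr_ge0 => J _; rewrite mulr_ge0// psd_tr_ge0//; apply/psd_exp/psdD; [apply: gram_psd|apply: psd_scalar].
have -> : (1 + rho - k) * (d%:R * b ^+ m.+1) + k * p%:R * rho * (d%:R * b ^+ m) =
  d%:R * b ^+ m * ((1 + rho - k) * b + k * p%:R * rho) by rewrite exprS; ring.
have -> : d%:R * b ^+ m.+2 = d%:R * b ^+ m * b ^+ 2 by rewrite -mulrA -exprD addn2.
by rewrite ler_wpM2l// mulr_ge0// exprn_ge0.
Qed.

End Moments.
End Selectors.

(** * Uniform sets of given size *)

Section UniformSubsets.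
Context {R : realFieldType} {n : nat}.
Implicit Types (J : {set 'I_n}) (i j : 'I_n) (c : nat).

Lemma sum_card_perm c (s : {perm 'I_n}) (F : {set 'I_n} -> R) :
  \sum_(J : {set 'I_n} | #|J| == c) F (s @: J) = \sum_(J : {set 'I_n} | #|J| == c) F J.
Proof.
rewrite [RHS](reindex_inj (imset_inj (@perm_inj _ s))) /=.
by apply: eq_bigl => J; rewrite card_imset//; apply: perm_inj.
Qed.

Definition incl1 c i : R := \sum_(J : {set 'I_n} | #|J| == c) (i \in J)%:R.
Definition incl2 c i j : R :=
  \sum_(J : {set 'I_n} | #|J| == c) (i \in J)%:R * (j \in J)%:R.

Lemma incl1_perm c (s : {perm 'I_n}) i : incl1 c (s i) = incl1 c i.
Proof.
rewrite /incl1 -(sum_card_perm c s); apply: eq_bigr => J _.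
by rewrite mem_imset//; apply: perm_inj.
Qed.

Lemma incl2_perm c (s : {perm 'I_n}) i j : incl2 c (s i) (s j) = incl2 c i j.
Proof.
rewrite /incl2 -(sum_card_perm c s); apply: eq_bigr => J _.
by rewrite !mem_imset//; apply: perm_inj.
Qed.

Lemma incl1E c i : incl1 c i = c%:R / n%:R * 'C(n, c)%:R.
Proof.
have n0 : n%:R != 0 :> R by rewrite pnatr_eq0; case: (n) i => [[]|].
have : \sum_j incl1 c j = c%:R * 'C(n, c)%:R.
  rewrite /incl1 exchange_big /=.
  transitivity (\sum_(J : {set 'I_n} | #|J| == c) (c%:R : R)).
    apply: eq_bigr => J /eqP <-; rewrite -sumr_const [RHS]big_mkcond /=.
    by apply: eq_bigr => j _; case: (j \in J).
  rewrite sumr_const -[LHS]mulr_natr; congr (_ * _%:R).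
  by have := card_draws 'I_n c; rewrite card_ord => <-; apply: eq_card => J; rewrite [RHS]inE.
have -> : \sum_j incl1 c j = n%:R * incl1 c i.
  rewrite mulr_natl -[X in _ *+ X](card_ord n) -sumr_const; apply: eq_bigr => j _.
  by rewrite -(incl1_perm c (tperm i j)) tpermR.
by move=> h; apply: (mulfI n0); rewrite h mulrA [_ * (_ / _)]mulrC divfK.
Qed.

(** Permutations act transitively on ordered pairs of distinct indices. The value of the constant is
    not computed: in [sum_card_centered] it multiplies the squared norm of a vanishing sum. *)
Lemma incl2_const c : exists2 a, 0 <= a & forall i j, i != j -> incl2 c i j = a.
Proof.
have [[i0 j0] /= ij0|no] := pickP (fun ij : 'I_n * 'I_n => ij.1 != ij.2); last first.
  by exists 0 => // i j ij; have /= := no (i, j); rewrite ij.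
exists (incl2 c i0 j0); first by apply: sumr_ge0 => J _; rewrite mulr_ge0.
have C2 i j : incl2 c i j = incl2 c j i by apply: eq_bigr => J _; rewrite mulrC.
have mv i j j' : i != j -> i != j' -> incl2 c i j = incl2 c i j'.
  move=> ij ij'; rewrite -(incl2_perm c (tperm j j')) tpermL tpermD//.
    by rewrite eq_sym.
  by rewrite eq_sym.
move=> i j ij; have [E|ij0'] := eqVneq i j0.
  by rewrite E in ij *; rewrite (mv _ _ i0)// 1?eq_sym// C2.
by rewrite (mv i j j0)// C2 (mv j0 i i0) 1?eq_sym// C2.
Qed.

Lemma sum_card_sq c (x : 'I_n -> R) :
  \sum_(J : {set 'I_n} | #|J| == c) \sum_(i in J) x i ^+ 2 =
  c%:R / n%:R * 'C(n, c)%:R * \sum_i x i ^+ 2.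
Proof.
transitivity (\sum_i incl1 c i * x i ^+ 2).
  under [RHS]eq_bigr do rewrite mulr_suml.
  rewrite exchange_big; apply: eq_bigr => J _ /=; rewrite big_mkcond /=.
  by apply: eq_bigr => i _; case: (i \in J); rewrite ?mul1r ?mul0r.
by rewrite mulr_sumr; apply: eq_bigr => i _; rewrite incl1E.
Qed.

(** Expanding the square, all off-diagonal pairs carry the same weight a. Completing them with
    diagonal terms of weight a gives a |sum y|^2 = 0, so only (incl1 - a) |y_i|^2 remains, and a >=
    0. *)
Lemma sum_card_centered c d (y : 'I_n -> 'cV[R]_d) : \sum_i y i = 0 ->
  \sum_(J : {set 'I_n} | #|J| == c) dotp (\sum_(i in J) y i) (\sum_(i in J) y i) <=
  c%:R / n%:R * 'C(n, c)%:R * \sum_i dotp (y i) (y i).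
Proof.
move=> y0; have [a a0 Ha] := incl2_const c.
have -> : \sum_(J : {set 'I_n} | #|J| == c) dotp (\sum_(i in J) y i) (\sum_(i in J) y i) =
    \sum_i \sum_j incl2 c i j * dotp (y i) (y j).
  under [RHS]eq_bigr => i _.
    under eq_bigr => j _ do rewrite mulr_suml.
    rewrite exchange_big; over.
  rewrite exchange_big /=; apply: eq_bigr => J _.
  rewrite dotp_sumr big_mkcond exchange_big /=; apply: eq_bigr => i _.
  case: (i \in J); last by rewrite big1// => j _; rewrite mulr0 mul0r.
  rewrite dotpC dotp_sumr big_mkcond /=; apply: eq_bigr => j _.
  by case: (j \in J); rewrite ?mulr1 ?mul0r ?mul1r// dotpC.
have -> : \sum_i \sum_j incl2 c i j * dotp (y i) (y j) =
    \sum_i ((incl1 c i - a) * dotp (y i) (y i) + \sum_j a * dotp (y i) (y j)).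
  apply: eq_bigr => i _; rewrite (bigD1 i)//= [in RHS](bigD1 i)//= addrA -mulrDl subrK.
  congr (_ * _ + _); last by apply: eq_bigr => j ji; rewrite Ha// eq_sym.
  by apply: eq_bigr => J _; case: (i \in J); rewrite ?mulr1 ?mulr0.
rewrite big_split /= [X in _ + X]big1 => [|i _]; last first.
  by rewrite -mulr_sumr -dotp_sumr y0 dotp0r mulr0.
rewrite addr0 mulr_sumr; apply: ler_sum => i _.
by rewrite ler_wpM2r ?dotp_ge0// incl1E gerBl.
Qed.

(* Uniform sets of size c are independent selectors conditioned on their number,
   an event of probability at least 1/(n+1). *)
Lemma sum_card_le_bern c (F : {set 'I_n} -> R) : (0 < c <= n)%N ->
  (forall J, 0 <= F J) ->
  \sum_(J : {set 'I_n} | #|J| == c) F J <=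
  'C(n, c)%:R * n.+1%:R * \sum_J bern_weight (c%:R / n%:R) J * F J.
Proof.
move=> cn F0; have n0 : 0 < n%:R :> R.
  by case/andP: cn => c0 cn; rewrite ltr0n (leq_trans c0).
have k01 : 0 <= (c%:R / n%:R : R) <= 1.
  case/andP: cn => _ cn; apply/andP; split; first exact: divr_ge0.
  by rewrite ler_pdivrMr// mul1r ler_nat.
rewrite mulr_sumr [leRHS](bigID (fun J : {set 'I_n} => #|J| == c)) /=.
rewrite ler_wpDr//; first by apply: sumr_ge0 => J _; rewrite mulr_ge0// mulr_ge0// bern_weight_ge0.
apply: ler_sum => J /eqP Jc; rewrite mulrA ler_peMl//.
have := binom_weight_mode (R := R) cn.
by rewrite /binom_weight /bern_weight Jc mulrA mulrA [n.+1%:R * _]mulrC !mulrA.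
Qed.

End UniformSubsets.

(* Imported only here: the finite set notations used above are shadowed by those
   of classical sets. *)
From mathcomp Require Import all_classical all_reals all_analysis.
From mathcomp Require Import measurable_realfun.

Import numFieldNormedType.Exports.

Local Open Scope classical_set_scope.
Local Open Scope ring_scope.

(** * Eigenvalues of sampled Gram matrices *)

(** The spectral theorem is replaced by a supremum: let l be the largest t with G - t psd. If l < c
    then l is no eigenvalue, so C = G - l is invertible with psd inverse D. Cauchy-Schwarz for C
    between y and D y gives |y|^4 <= <y, C y> <y, D y>, and D is at most its trace; so C >= 1 / (tr
    D + 1), contradicting the choice of l. *)
Lemma psd_eigenvalue_ge (R : realType) (d : nat) (G : 'M[R]_d) (c : R) :
  psd G -> (forall a, eigenvalue G a -> c <= a) ->
  forall x, c * dotp x x <= dotp x (G *m x).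
Proof.
move=> pG ev x; have [->|x0] := eqVneq x 0; first by rewrite mulmx0 dotp0r mulr0.
have pos (y : 'cV[R]_d) : y != 0 -> 0 < dotp y y.
  by move=> y0; rewrite lt_neqAle dotp_ge0 andbT eq_sym dotp_eq0.
have shift t y : dotp y ((G - t%:M) *m y) = dotp y (G *m y) - t * dotp y y.
  by rewrite mulmxBl dotpBr mul_scalar_mx dotpZr.
pose S := [set t : R | forall y, t * dotp y y <= dotp y (G *m y)].
have S0 : S 0 by move=> y; rewrite mul0r; apply: (proj2 pG).
have Sub : has_ubound S.
  exists (dotp x (G *m x) / dotp x x) => t St.
  by rewrite ler_pdivlMr ?pos//; apply: St.
have hS : has_sup S by split=> //; exists 0.
set l := sup S; have Sl : S l.
  move=> y; have [->|y0] := eqVneq y 0; first by rewrite mulmx0 dotp0r mulr0.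
  rewrite leNgt; apply/negP => h.
  have h' : 0 < l - dotp y (G *m y) / dotp y y.
    by rewrite subr_gt0 ltr_pdivrMr ?pos.
  have [t St] := sup_adherent h' hS.
  by rewrite opprB addrCA subrr addr0 ltr_pdivrMr ?pos// ltNge St.
have [cl|lc] := leP c l.
  by apply: le_trans (Sl x); rewrite ler_wpM2r ?dotp_ge0.
set C := G - l%:M; have [sG _] := pG.
have pC : psd C.
  split; first by rewrite /C raddfB /= sG tr_scalar_mx.
  by move=> y; rewrite shift subr_ge0; apply: Sl.
have uC : C \in unitmx.
  rewrite -row_free_unit -kermx_eq0; apply/negPn/negP => h.
  by have := ev l h; rewrite leNgt lc.
set D := invmx C; have pD : psd D.
  split=> [|y]; first by rewrite /D trmx_inv (proj1 pC).
  have -> : dotp y (D *m y) = dotp (D *m y) (C *m (D *m y)).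
    by rewrite mulKVmx// dotpC.
  exact: (proj2 pC).
have tD := psd_tr_ge0 pD.
have s0 : 0 < (\tr D + 1)^-1 by rewrite invr_gt0 ltr_pwDr.
have : S (l + (\tr D + 1)^-1).
  move=> y; have [->|y0] := eqVneq y 0; first by rewrite mulmx0 dotp0r mulr0.
  rewrite mulrDl addrC -lerBrDr -shift -/C mulrC ler_pdivrMr; last by rewrite ltr_pwDr.
  have h0 : 0 <= dotp y (C *m y) by apply: (proj2 pC).
  have := psd_cauchy y (D *m y) pC; rewrite mulKVmx// [dotp (D *m y) y]dotpC.
  move=> h; have h1 := psd_tr_ge y pD.
  rewrite -(ler_pM2r (pos _ y0)) -expr2 (le_trans h)// -mulrA ler_wpM2l//.
  by rewrite (le_trans h1)// ler_wpM2r ?dotp_ge0// lerDl.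
by move/(ub_le_sup Sub); rewrite -/l leNgt ltrDl s0.
Qed.

(** From 1 + x <= exp x at x = -1/10 follows exp (1/10) <= 10/9, and (10/9)^10 is below 3. *)
Lemma expR1_le3 (R : realType) : expR 1 <= 3 :> R.
Proof.
have h : expR (1 / 10) <= 10 / 9 :> R.
  have := expR_ge1Dx (- (1 / 10) : R); rewrite expRN => h.
  rewrite -[expR _]invrK -[10 / 9]invrK lef_pV2 ?posrE ?invr_gt0 ?expR_gt0//; lra.
have -> : 1 = (1 / 10) * 10%:R :> R by lra.
rewrite expRM_natr (@le_trans _ _ ((10 / 9) ^+ 10))//; last by lra.
by rewrite lerXn2r ?nnegrE ?expR_ge0//; lra.
Qed.

Lemma ln_ge_natr (R : realType) (m : nat) (x : R) : 3 ^+ m <= x -> m%:R <= ln x.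
Proof.
move=> h; have x0 : 0 < x by apply: lt_le_trans h; rewrite exprn_gt0.
rewrite -ler_expR lnK ?posrE// -[m%:R]mul1r expRM_natr (le_trans _ h)//.
by rewrite lerXn2r ?nnegrE ?expR_ge0 ?expR1_le3.
Qed.

Section SampledGram.
Context {R : realType} {n d : nat} (u : 'I_n -> 'cV[R]_d) (rho : R).
Variables (p q : nat).
Implicit Types (J : {set 'I_n}) (k : R).

(* A Markov-type upper bound for the probability that an eigenvalue of gram u J
   leaves [k/2, 3k/2] where k = #|J| / n. *)
Definition ill_bound J : R :=
  let k : R := #|J|%:R / n%:R in
  \tr (gram u J ^+ p) / (3 / 2 * k) ^+ p
  + \tr ((gram u (~: J)%SET + rho%:M) ^+ q) / (1 - k / 2 + rho) ^+ q.

Hypothesis tight : gram u [set: 'I_n]%SET = 1%:M.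
Hypothesis rho_ge : forall i, dotp (u i) (u i) <= rho.
Hypothesis rho_ge0 : 0 <= rho.

Let card_le J : (#|J| <= n)%N.
Proof. by rewrite -[X in (_ <= X)%N](card_ord n) max_card. Qed.

Let frac01 (c : nat) (k : R) : k = c%:R / n%:R -> (c <= n)%N -> 0 <= k <= 1.
Proof.
move=> -> cn; rewrite divr_ge0//=; have [n0|n0] := posnP n.
  by rewrite n0 invr0 mulr0.
by rewrite ler_pdivrMr ?ltr0n// mul1r ler_nat.
Qed.

Let cogram_psd J : psd (gram u (~: J)%SET + rho%:M).
Proof. by apply: psdD; [apply: gram_psd|apply: psd_scalar]. Qed.

Lemma ill_bound_terms_ge0 J :
  let k : R := #|J|%:R / n%:R in
  0 <= \tr (gram u J ^+ p) / (3 / 2 * k) ^+ p /\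
  0 <= \tr ((gram u (~: J)%SET + rho%:M) ^+ q) / (1 - k / 2 + rho) ^+ q.
Proof.
move=> k; have /andP[k0 k1] := frac01 (erefl k) (card_le J).
have r0 := rho_ge0; split; apply: divr_ge0.
- by apply/psd_tr_ge0/psd_exp/gram_psd.
- by rewrite exprn_ge0//; lra.
- by apply/psd_tr_ge0/psd_exp/cogram_psd.
- by rewrite exprn_ge0//; lra.
Qed.

Lemma ill_bound_ge0 J : 0 <= ill_bound J.
Proof. by have [h1 h2] := ill_bound_terms_ge0 J; apply: addr_ge0. Qed.

(** An eigenvalue above 3k/2 makes the first summand of [ill_bound] at least 1. An eigenvalue a
    below k/2 corresponds to the eigenvalue 1 - a + rho of the shifted complement, which does the
    same to the second. *)
Lemma gram_eigenvalue_bounds J a : (0 < #|J|)%N -> ill_bound J < 1 ->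
  eigenvalue (gram u J) a ->
  1 / 2 * (#|J|%:R / n%:R) <= a <= 3 / 2 * (#|J|%:R / n%:R).
Proof.
move=> J0 h ea; have [t1 t2] := ill_bound_terms_ge0 J.
have /andP[_ k1] := frac01 erefl (card_le J).
have r0 := rho_ge0.
have k0 : 0 < #|J|%:R / n%:R :> R.
  by rewrite divr_gt0 ?ltr0n// (leq_trans J0).
move: h; rewrite /ill_bound; set k := #|J|%:R / n%:R in t1 t2 k0 k1 * => h.
apply/andP; split; rewrite leNgt; apply/negP => ha.
- have e' : eigenvalue (gram u (~: J)%SET + rho%:M) (1 - a + rho).
    have /eigenvalueP[v va v0] := ea.
    apply/eigenvalueP; exists v => //.
    rewrite (gramC tight) mulmxDr mulmxBr va mulmx1 mul_mx_scalar.
    by rewrite !scalerDl scale1r scaleNr.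
  have := eigenvalue_tr_exp q (cogram_psd J) e'.
  suff : 1 <= \tr ((gram u (~: J)%SET + rho%:M) ^+ q) / (1 - k / 2 + rho) ^+ q by lra.
  rewrite ler_pdivlMr ?mul1r; last by rewrite exprn_gt0//; lra.
  by apply: le_trans (eigenvalue_tr_exp q (cogram_psd J) e'); rewrite lerXn2r ?nnegrE//; lra.
- suff : 1 <= \tr (gram u J ^+ p) / (3 / 2 * k) ^+ p by lra.
  rewrite ler_pdivlMr ?mul1r; last by rewrite exprn_gt0//; lra.
  by apply: le_trans (eigenvalue_tr_exp p (gram_psd u J) ea); rewrite lerXn2r ?nnegrE//; lra.
Qed.

Section Average.
Variable c : nat.
Hypothesis c_bounds : (0 < c <= n)%N.
Let k : R := c%:R / n%:R.
Let L : R := ln n%:R.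
Hypothesis L_ge6 : 6 <= L.
Hypothesis rho_small : 150 * L * rho <= k.
Hypothesis p_bounds : 10 * L <= p%:R <= 11 * L.
Hypothesis q_bounds : 8 * L <= k * q%:R <= 8 * L + 1.

Let n_gt0 : 0 < n%:R :> R.
Proof. by case/andP: c_bounds => c0 cn; rewrite ltr0n (leq_trans c0). Qed.

Let k_gt0 : 0 < k.
Proof. by case/andP: c_bounds => c0 _; rewrite divr_gt0// ltr0n. Qed.

Let k_le1 : k <= 1.
Proof. by case/andP: c_bounds => _ cn; have /andP[] := frac01 erefl cn. Qed.

Let expR_N2L : expR (- (2 * L)) = (n%:R ^+ 2)^-1 :> R.
Proof. by rewrite expRN [2 * L]mulrC expRM_natr lnK. Qed.

(** The moment base b stays below exp (-1/5) times the threshold 3k/2, so p >= 10 L yields exp (-2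
    L) = n^-2. The bound p <= 11 L together with 150 L rho <= k keeps (1 + rho/k)^p below exp
    (11/150). *)
Let upper_tail :
  \sum_J bern_weight k J * (\tr (gram u J ^+ p) / (3 / 2 * k) ^+ p) <= d%:R / n%:R ^+ 2.
Proof.
under eq_bigr do rewrite mulrA; rewrite -mulr_suml.
have [rho0 k0 k1 L6 small] := And5 rho_ge0 k_gt0 k_le1 L_ge6 rho_small.
(* As b >= k, one has b + rho <= b (1 + rho/k); the p spare factors in b pay for the at most p
   factors 1 + rho/k that the recursion produces. *)
pose b := k * (1 + rho / k) ^+ p.
have r0 : 0 <= rho / k by rewrite divr_ge0// ltW.
have kb : k <= b.
  by rewrite ler_peMr// ?exprn_ege1// ?lerDl// ltW.
have b0 : 0 < b by apply: lt_le_trans kb.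
have hb m : (m < p)%N -> k * (b + rho) ^+ m <= b ^+ m.+1.
  move=> mp; apply: (@le_trans _ _ (k * (b * (1 + rho / k)) ^+ m)).
    have bk : b + rho <= b * (1 + rho / k).
      by rewrite mulrDr mulr1 lerD2l mulrCA ler_peMr// ler_pdivlMr// mul1r.
    have br0 : 0 <= b + rho by rewrite addr_ge0// ltW.
    by rewrite ler_wpM2l ?(ltW k0)// lerXn2r// ?nnegrE// (le_trans br0).
  rewrite exprMn mulrCA exprSr ler_wpM2l ?exprn_ge0 ?(ltW b0)//.
  by rewrite ler_wpM2l ?(ltW k0)// ler_weXn2l ?lerDl// ltnW.
have k01 : 0 <= k <= 1 by rewrite k_le1 ltW.
have := gram_moment_le tight rho_ge rho_ge0 k01 hb.
move=> h; rewrite ler_pdivrMr; last by rewrite exprn_gt0// mulr_gt0//; lra.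
apply: le_trans h _; rewrite -[leRHS]mulrA ler_wpM2l// -expR_N2L.
apply: (@le_trans _ _ ((expR (- (1 / 5)) * (3 / 2 * k)) ^+ p)); last first.
  rewrite exprMn ler_wpM2r ?exprn_ge0 ?mulr_ge0// ?(ltW k_gt0)//.
  rewrite -expRM_natr ler_expR; case/andP: p_bounds => *; lra.
suff bk : b <= expR (- (1 / 5)) * (3 / 2 * k).
  by rewrite lerXn2r// nnegrE ?(ltW b0)// (le_trans (ltW b0)).
rewrite /b mulrA [k * _]mulrC ler_wpM2r ?(ltW k_gt0)//.
have e1 : (1 + rho / k) ^+ p <= expR (11 / 150).
  apply: (@le_trans _ _ (expR (rho / k) ^+ p)).
    by rewrite lerXn2r ?nnegrE ?expR_ge0 ?expR_ge1Dx// addr_ge0.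
  rewrite -expRM_natr ler_expR mulrAC ler_pdivrMr//.
  apply: (@le_trans _ _ (rho * (11 * L))); last by lra.
  by rewrite ler_wpM2l//; case/andP: p_bounds.
(* What remains is exp (41/150) <= 3/2, which follows from exp (-41/150) >= 109/150 >= 2/3. *)
apply: le_trans e1 _.
have := expR_ge1Dx (- (11 / 150 + 1 / 5) : R).
rewrite opprD expRD (expRN (11 / 150)) => h2.
have e0 := expR_gt0 (11 / 150 : R).
rewrite -(ler_pM2l (x := (expR (11 / 150))^-1)) ?invr_gt0// mulVf ?gt_eqF//; lra.
Qed.

(** The base b = 1 - 3k/4 lies between the mean level 1 - k and the threshold 1 - k/2, leaving k/4
    for the shift and for the two-term recursion. As b <= (1 - k/4)(1 - k/2), the ratio to the
    threshold is at most exp (-k/4), and k q >= 8 L turns its q-th power into n^-2. *)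
Let lower_tail :
  \sum_J bern_weight k J * (\tr ((gram u (~: J)%SET + rho%:M) ^+ q) / (1 - k / 2 + rho) ^+ q)
    <= d%:R / n%:R ^+ 2.
Proof.
under eq_bigr do rewrite mulrA; rewrite -mulr_suml.
have [rho0 k0 k1 L6 small] := And5 rho_ge0 k_gt0 k_le1 L_ge6 rho_small.
pose b := 1 - 3 / 4 * k.
have k01 : 0 <= k <= 1 by rewrite k_le1 ltW.
have r1 : rho <= k / 900.
  have : 900 * rho <= 150 * L * rho by rewrite ler_wpM2r//; lra.
  lra.
have b1 : 1 + rho - k <= b by rewrite /b; lra.
have b2 : (1 + rho - k) * b + k * q%:R * rho <= b ^+ 2.
  have E : k * q%:R * rho <= k * (49 / 900).
    apply: (@le_trans _ _ ((8 * L + 1) * rho)).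
      by rewrite ler_wpM2r//; case/andP: q_bounds.
    by lra.
  have : 0 <= (b - 1 / 4) * (k / 4 - rho) by rewrite mulr_ge0// /b; lra.
  by rewrite /b => H; lra.
have := cogram_moment_le tight rho_ge rho_ge0 k01 b1 b2.
move=> h; rewrite ler_pdivrMr; last by rewrite exprn_gt0//; lra.
apply: le_trans h _; rewrite -[leRHS]mulrA ler_wpM2l// -expR_N2L.
apply: (@le_trans _ _ ((expR (- (k / 4)) * (1 - k / 2)) ^+ q)).
  rewrite lerXn2r ?nnegrE ?mulr_ge0 ?expR_ge0 /b//; [lra|lra|].
  apply: (@le_trans _ _ ((1 - k / 4) * (1 - k / 2))).
    by have := sqr_ge0 k; lra.
  by rewrite ler_wpM2r//; [lra|have := expR_ge1Dx (- (k / 4)); lra].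
rewrite exprMn ler_pM ?exprn_ge0 ?expR_ge0//; [lra| |].
  rewrite -expRM_natr ler_expR; case/andP: q_bounds => *; lra.
by rewrite lerXn2r ?nnegrE//; lra.
Qed.

(** Two tails of d / n^2 each, times the factor n + 1 <= 2 n for fixing the cardinality. *)
Lemma sum_ill_bound_le :
  \sum_(J : {set 'I_n} | #|J| == c) ill_bound J <=
  'C(n, c)%:R * (4 * d%:R / n%:R).
Proof.
pose F J := \tr (gram u J ^+ p) / (3 / 2 * k) ^+ p
  + \tr ((gram u (~: J)%SET + rho%:M) ^+ q) / (1 - k / 2 + rho) ^+ q.
have -> : \sum_(J : {set 'I_n} | #|J| == c) ill_bound J = \sum_(J : {set 'I_n} | #|J| == c) F J.
  by apply: eq_bigr => J /eqP Jc; rewrite /ill_bound Jc.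
have [rho0 k0 k1] := And3 rho_ge0 k_gt0 k_le1.
have F0 J : 0 <= F J.
  rewrite addr_ge0// divr_ge0//.
  - by apply/psd_tr_ge0/psd_exp/gram_psd.
  - by rewrite exprn_ge0//; lra.
  - by apply/psd_tr_ge0/psd_exp/cogram_psd.
  - by rewrite exprn_ge0//; lra.
apply: le_trans (sum_card_le_bern c_bounds F0) _.
rewrite -mulrA ler_wpM2l// -/k.
have : \sum_J bern_weight k J * F J <= d%:R / n%:R ^+ 2 + d%:R / n%:R ^+ 2.
  by under eq_bigr do rewrite mulrDr; rewrite big_split lerD.
move=> h; apply: (@le_trans _ _ ((2 * n%:R) * (d%:R / n%:R ^+ 2 + d%:R / n%:R ^+ 2))).
  apply: ler_pM => //; first by apply: sumr_ge0 => J _; rewrite mulr_ge0// bern_weight_ge0// k_le1 ltW.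
  rewrite -natr1; have : 1 <= n%:R :> R by rewrite -[1]/(1%:R) ler_nat -(ltr0n R).
  lra.
by rewrite le_eqVlt; apply/orP; left; apply/eqP; field; rewrite gt_eqF.
Qed.

End Average.
End SampledGram.

(** Rounding up costs at most 1 <= L for p, and at most c/n <= 1 for q after multiplication by
    c/n. *)
Lemma moment_orders_exist (R : realType) (n c : nat) :
  (0 < c <= n)%N -> 6 <= ln (n%:R : R) ->
  exists p q : nat, 10 * ln (n%:R : R) <= p%:R <= 11 * ln (n%:R : R) /\
    8 * ln (n%:R : R) <= c%:R / n%:R * q%:R <= 8 * ln (n%:R : R) + 1.
Proof.
move=> /andP[c0 cn] L6; have n0 : 0 < n%:R :> R by rewrite ltr0n (leq_trans c0).
set L := ln _ in L6 *; set k : R := c%:R / n%:R.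
have k0 : 0 < k by rewrite divr_gt0// ltr0n.
have k1 : k <= 1 by rewrite ler_pdivrMr// mul1r ler_nat.
have T (x : R) : 0 <= x -> x <= (Num.truncn x).+1%:R <= x + 1.
  move=> x0; have /andP[h1 h2] := truncn_itv x0.
  by rewrite (ltW h2) -natr1 lerD2r.
exists (Num.truncn (10 * L)).+1, (Num.truncn (8 * L / k)).+1.
have /andP[h1 h2] : 10 * L <= (Num.truncn (10 * L)).+1%:R <= 10 * L + 1 by apply: T; lra.
have /andP[h3 h4] : 8 * L / k <= (Num.truncn (8 * L / k)).+1%:R <= 8 * L / k + 1.
  by apply: T; apply: divr_ge0; [lra|exact: ltW].
split; apply/andP; split => //; first by lra.
- by rewrite [k * _]mulrC -ler_pdivrMr.
- apply: (@le_trans _ _ (k * (8 * L / k + 1))); first by rewrite ler_wpM2l// ltW.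
  by rewrite mulrDr mulrCA divff ?gt_eqF// !mulr1 lerD2l.
Qed.

(** * One step of GROUSE *)

Section Frobenius.
Context {R : realType}.

Lemma fnormE m k (A : 'M[R]_(m, k)) : fnorm A ^+ 2 = \sum_i \sum_j A i j ^+ 2.
Proof.
rewrite /fnorm sqr_sqrtr//; apply: sumr_ge0 => i _.
by apply: sumr_ge0 => j _; apply: sqr_ge0.
Qed.

Lemma fnorm_dotp m (x : 'cV[R]_m) : fnorm x ^+ 2 = dotp x x.
Proof. by rewrite fnormE dotpE; apply: eq_bigr => i _; rewrite big_ord1 expr2. Qed.

Lemma fnorm_sqrt m (x : 'cV[R]_m) : fnorm x = Num.sqrt (dotp x x).
Proof.
by rewrite -fnorm_dotp sqrtr_sqr ger0_norm// /fnorm sqrtr_ge0.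
Qed.

Lemma fnorm_eq0 m (x : 'cV[R]_m) : (fnorm x == 0) = (x == 0).
Proof. by rewrite -[LHS]sqrf_eq0 fnorm_dotp dotp_eq0. Qed.

Lemma fnorm_tr m k (A : 'M[R]_(m, k)) : fnorm A^T ^+ 2 = fnorm A ^+ 2.
Proof.
rewrite !fnormE exchange_big; apply: eq_bigr => i _.
by apply: eq_bigr => j _; rewrite mxE.
Qed.

Lemma fnorm_col m k (A : 'M[R]_(m, k)) : fnorm A ^+ 2 = \sum_j dotp (col j A) (col j A).
Proof.
rewrite fnormE exchange_big; apply: eq_bigr => j _.
by rewrite dotpE; apply: eq_bigr => i _; rewrite !mxE expr2.
Qed.

Lemma fnorm_trace m k (A : 'M[R]_(m, k)) : fnorm A ^+ 2 = \tr (A^T *m A).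
Proof.
rewrite fnorm_col; apply: eq_bigr => j _; rewrite dotpE [RHS]mxE.
by apply: eq_bigr => i _; rewrite !mxE.
Qed.

Lemma dotp_mul m k (A : 'M[R]_(m, k)) x y : dotp (A *m x) y = dotp x (A^T *m y).
Proof. by rewrite /dotp trmx_mul mulmxA. Qed.

Lemma fnorm_mul_le m k (A : 'M[R]_(m, k)) (x : 'cV[R]_k) :
  dotp (A *m x) (A *m x) <= fnorm A ^+ 2 * dotp x x.
Proof.
rewrite -fnorm_tr fnorm_col dotpE mulr_suml; apply: ler_sum => i _.
have -> : (A *m x) i 0 = dotp (col i A^T) x.
  by rewrite mxE dotpE; apply: eq_bigr => j _; rewrite !mxE.
by rewrite -expr2 cauchy_schwarz.
Qed.

Lemma fnorm_rank1_update m k (A : 'M[R]_(m, k)) (g : 'cV[R]_m) (w : 'cV[R]_k) :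
  fnorm (A + g *m w^T) ^+ 2 =
  fnorm A ^+ 2 + 2 * dotp g (A *m w) + dotp g g * dotp w w.
Proof.
rewrite !fnormE !dotpE mulr_sumr mulr_suml -!big_split /=; apply: eq_bigr => i _.
rewrite mxE !mulr_sumr -!big_split /=; apply: eq_bigr => j _.
by rewrite !mxE big_ord1 !mxE; ring.
Qed.

Lemma orthonormal_dotp m k (U : 'M[R]_(m, k)) x y : orthonormal_cols U ->
  dotp (U *m x) (U *m y) = dotp x y.
Proof. by move=> oU; rewrite dotp_mul mulmxA oU mul1mx. Qed.

Definition residual_mx m k (U A : 'M[R]_(m, k)) : 'M[R]_(m, k) := A - U *m (U^T *m A).

Lemma tr_mul_residual_mx m k (U A : 'M[R]_(m, k)) : orthonormal_cols U ->
  U^T *m residual_mx U A = 0.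
Proof. by move=> oU; rewrite mulmxBr [U^T *m (U *m _)]mulmxA oU mul1mx subrr. Qed.

Lemma subspace_error_residual m k (Ubar U : 'M[R]_(m, k)) :
  orthonormal_cols Ubar -> orthonormal_cols U ->
  subspace_error Ubar U = fnorm (residual_mx U Ubar) ^+ 2.
Proof.
move=> oB oU; rewrite /subspace_error -fnorm_tr trmx_mul trmxK !fnorm_trace.
have -> : (residual_mx U Ubar)^T = Ubar^T - (U *m (U^T *m Ubar))^T by exact: raddfB.
rewrite mulmxBl.
have -> : (U *m (U^T *m Ubar))^T *m residual_mx U Ubar = 0.
  by rewrite trmx_mul -mulmxA tr_mul_residual_mx// mulmx0.
by rewrite subr0 mulmxBr oB raddfB /= mxtrace1 trmx_mul trmxK -mulmxA.
Qed.

Lemma subspace_error_ge0 m k (Ubar U : 'M[R]_(m, k)) :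
  orthonormal_cols Ubar -> orthonormal_cols U -> 0 <= subspace_error Ubar U.
Proof. by move=> oB oU; rewrite subspace_error_residual// sqr_ge0. Qed.

Lemma orthonormal_tr_le m k (U : 'M[R]_(m, k)) (x : 'cV[R]_m) : orthonormal_cols U ->
  dotp (U^T *m x) (U^T *m x) <= dotp x x.
Proof.
move=> oU; have := dotp_ge0 (x - U *m (U^T *m x)).
rewrite dotpBr !dotpBl (orthonormal_dotp _ _ oU) [dotp x (U *m _)]dotpC.
by rewrite dotp_mul subrr subr0 subr_ge0.
Qed.

Definition rowv m k (U : 'M[R]_(m, k)) (i : 'I_m) : 'cV[R]_k := (row i U)^T.

Lemma gram_rows_in m k (U : 'M[R]_(m, k)) (J : {set 'I_m}) :
  (rows_in J U)^T *m rows_in J U = gram (rowv U) J.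
Proof.
apply/matrixP => a b; rewrite mxE /gram summxE [RHS]big_enum_val /=.
by apply: eq_bigr => i _; rewrite !mxE big_ord1 !mxE.
Qed.

Lemma gram_rowvT m k (U : 'M[R]_(m, k)) : gram (rowv U) [set: 'I_m]%SET = U^T *m U.
Proof.
apply/matrixP => a b; rewrite mxE /gram summxE.
by apply: eq_big => [i|i _]; rewrite ?inE// !mxE big_ord1 !mxE.
Qed.

(** The sampled subvector padded by zeros, so that it remains in the ambient space and [U^T] can act
    on it. *)
Definition restr m (J : {set 'I_m}) (x : 'cV[R]_m) : 'cV[R]_m :=
  \col_i (if i \in J then x i 0 else 0).

Lemma tr_mul_restr m k (U : 'M[R]_(m, k)) (J : {set 'I_m}) x :
  U^T *m restr J x = \sum_(i in J) x i 0 *: rowv U i.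
Proof.
apply/colP => a; rewrite mxE summxE [RHS]big_mkcond /=; apply: eq_bigr => i _.
by rewrite !mxE; case: (i \in J); rewrite ?mulr0// mulrC.
Qed.

Lemma rows_in_tr_mul m k (U : 'M[R]_(m, k)) (J : {set 'I_m}) (x : 'cV[R]_m) :
  (rows_in J U)^T *m rows_in J x = U^T *m restr J x.
Proof.
rewrite tr_mul_restr; apply/colP => a; rewrite mxE summxE [RHS]big_enum_val /=.
by apply: eq_bigr => i _; rewrite !mxE mulrC.
Qed.

Lemma gram_restr m k (U : 'M[R]_(m, k)) (J : {set 'I_m}) (w : 'cV[R]_k) :
  gram (rowv U) J *m w = U^T *m restr J (U *m w).
Proof.
rewrite -rows_in_tr_mul -gram_rows_in -mulmxA; congr (_ *m _).
by apply/colP => i; rewrite !mxE; apply: eq_bigr => j _; rewrite !mxE.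
Qed.

Lemma dotp_restr m (J : {set 'I_m}) (x y : 'cV[R]_m) :
  dotp (restr J x) y = \sum_(i in J) x i 0 * y i 0.
Proof.
rewrite dotpE [RHS]big_mkcond /=; apply: eq_bigr => i _.
by rewrite mxE; case: ifP => _; rewrite ?mul0r.
Qed.

Lemma dotp_restr2 m (J : {set 'I_m}) (x y : 'cV[R]_m) :
  dotp (restr J x) (restr J y) = dotp (restr J x) y.
Proof.
by rewrite !dotp_restr; apply: eq_bigr => i iJ; rewrite mxE iJ.
Qed.

Lemma dotp_restr_le m (J : {set 'I_m}) (x : 'cV[R]_m) :
  dotp (restr J x) (restr J x) <= dotp x x.
Proof.
rewrite !dotpE; apply: ler_sum => i _; rewrite mxE; case: ifP => // _.
by rewrite mul0r -expr2 sqr_ge0.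
Qed.

Lemma restrB m (J : {set 'I_m}) (x y : 'cV[R]_m) : restr J (x - y) = restr J x - restr J y.
Proof. by apply/colP => i; rewrite !mxE; case: ifP; rewrite ?subr0. Qed.

(** The solution of the normal equations minimizes by Pythagoras, so [xget] does return a minimizer;
    the same identity forces its image under [A] to be that of the solution. *)
Lemma lstsq_normal_eq m k (A : 'M[R]_(m, k)) (b : 'cV[R]_m) : A^T *m A \in unitmx ->
  A^T *m A *m lstsq A b = A^T *m b.
Proof.
move=> uG; set G := A^T *m A.
pose w0 := invmx G *m (A^T *m b).
have Gw0 : G *m w0 = A^T *m b by rewrite mulKVmx.
have E w : fnorm (A *m w - b) ^+ 2 = fnorm (A *m w0 - b) ^+ 2 + fnorm (A *m (w - w0)) ^+ 2.
  have -> : A *m w - b = (A *m w0 - b) + A *m (w - w0).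
    by rewrite mulmxBr [RHS]addrC addrA subrK.
  have : dotp (A *m (w - w0)) (A *m w0 - b) = 0.
    by rewrite dotp_mul mulmxBr mulmxA Gw0 subrr dotp0r.
  rewrite !fnorm_dotp; move: (A *m w0 - b) (A *m (w - w0)) => X Y h.
  by rewrite dotpDr !dotpDl h [dotp X Y]dotpC h addr0 add0r.
have min0 : forall w, fnorm (A *m w0 - b) ^+ 2 <= fnorm (A *m w - b) ^+ 2.
  by move=> w; rewrite (E w) lerDl sqr_ge0.
have := @xgetPex _ 0 [set w | forall w' : 'cV[R]_k,
  fnorm (A *m w - b) ^+ 2 <= fnorm (A *m w' - b) ^+ 2] (ex_intro _ w0 min0).
rewrite -/(lstsq A b) /= => /(_ w0); rewrite E gerDl => h.
have /eqP : fnorm (A *m (lstsq A b - w0)) ^+ 2 = 0 by apply/eqP; rewrite eq_le h sqr_ge0.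
rewrite sqrf_eq0 fnorm_eq0 => /eqP h0.
rewrite -Gw0 -[lstsq A b](subrK w0) mulmxDr -[X in X + _]mulmxA h0 mulmx0 add0r//.
Qed.

End Frobenius.

Section GrouseStep.
Context {R : realType} {n d : nat}.
Variables (U : 'M[R]_(n, d)) (v : 'cV[R]_n) (J : {set 'I_n}).
Hypothesis oU : orthonormal_cols U.
Hypothesis J_gt0 : (0 < #|J|)%N.

Let g : R := 1 / 2 * (#|J|%:R / n%:R).

Let g_gt0 : 0 < g.
Proof.
rewrite mulr_gt0// divr_gt0 ?ltr0n// (leq_trans J_gt0)//.
by rewrite -[X in (_ <= X)%N](card_ord n) max_card.
Qed.

Lemma well_conditioned_gram : well_conditioned U J -> forall x,
  g * dotp x x <= dotp x (gram (rowv U) J *m x).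
Proof.
move=> wc; apply: psd_eigenvalue_ge; first exact: gram_psd.
by move=> a; rewrite -gram_rows_in => /wc/andP[].
Qed.

Hypothesis wc : well_conditioned U J.

Let w := grouse_w U v J.
Let p := grouse_p U v J.
Let r := grouse_r U v J.
Let x := v - U *m (U^T *m v).
(** The deviation from the weights that full data would give. By [grouse_gram_a] it is driven by [b]
    alone, the failure of the sampled residual to be orthogonal to [U]. *)
Let a := w - U^T *m v.
Let b := U^T *m restr J x.

Lemma grouse_normal_eq : gram (rowv U) J *m w = U^T *m restr J v.
Proof.
rewrite -rows_in_tr_mul -gram_rows_in; apply: lstsq_normal_eq.
rewrite -row_free_unit -kermx_eq0; apply/negPn/negP => h.
have /wc : eigenvalue ((rows_in J U)^T *m rows_in J U) 0.
  by rewrite /eigenvalue /eigenspace raddf0 subr0.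
by rewrite leNgt -/g g_gt0.
Qed.

Lemma grouse_r_restr : r = restr J (v - p).
Proof. by apply/colP => i; rewrite !mxE. Qed.

Lemma grouse_z : v - p = x - U *m a.
Proof. by rewrite /x /a mulmxBr opprB addrA subrK. Qed.

Lemma grouse_r_orth : U^T *m r = 0.
Proof. by rewrite grouse_r_restr restrB mulmxBr -gram_restr grouse_normal_eq subrr. Qed.

Lemma grouse_gram_a : gram (rowv U) J *m a = b.
Proof.
by rewrite mulmxBr grouse_normal_eq gram_restr /b /x restrB mulmxBr.
Qed.

Lemma grouse_x_orth : U^T *m x = 0.
Proof. by rewrite mulmxBr [U^T *m (U *m _)]mulmxA oU mul1mx subrr. Qed.

Lemma dotp_r_p : dotp r p = 0.
Proof. by rewrite dotpC /p /grouse_p dotp_mul grouse_r_orth dotp0r. Qed.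

Lemma dotp_r_z : dotp r (v - p) = dotp r r.
Proof. by rewrite grouse_r_restr dotp_restr2. Qed.

Lemma dotp_rr : dotp r r = dotp (restr J x) (restr J x) - dotp a b.
Proof.
rewrite -dotp_r_z grouse_z dotpBr.
have -> : dotp r (U *m a) = 0 by rewrite dotpC dotp_mul grouse_r_orth dotp0r.
rewrite subr0 grouse_r_restr grouse_z restrB dotpBl dotp_restr2; congr (_ - _).
by rewrite -dotp_restr2 dotpC dotp_restr2 dotpC dotp_mul.
Qed.

Lemma grouse_a_le : g * dotp a a <= dotp a b.
Proof. by rewrite -grouse_gram_a; apply: well_conditioned_gram. Qed.

(** Combine g |a|^2 <= <a, b> with <a, b>^2 <= |a|^2 |b|^2 and cancel <a, b>, which is why its
    vanishing is treated apart. *)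
Lemma grouse_ab_le : dotp a b <= g^-1 * dotp b b.
Proof.
have h := grouse_a_le; have cs := cauchy_schwarz a b.
have [->|ab0] := eqVneq (dotp a b) 0; first by rewrite mulr_ge0 ?dotp_ge0// invr_ge0 ltW.
have ab : 0 < dotp a b.
  by rewrite lt_neqAle eq_sym ab0 (le_trans _ h)// mulr_ge0 ?dotp_ge0// ltW.
rewrite mulrC ler_pdivlMr// -(ler_pM2r ab) mulrAC -expr2.
apply: (@le_trans _ _ (g * (dotp a a * dotp b b))).
  by rewrite mulrC ler_wpM2l// ltW.
by rewrite mulrA mulrC ler_wpM2l// dotp_ge0.
Qed.

Lemma grouse_norm_p : fnorm p = fnorm w.
Proof. by rewrite !fnorm_sqrt orthonormal_dotp. Qed.

(** The step rotates p / |p| towards r / |r|, and r is orthogonal to the columns of [U] by the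
    normal equations. In the Gram matrix the coefficient of w w^T is proportional to 2 (cos - 1) +
    (cos - 1)^2 + 1 - cos^2 = 0. *)
Lemma grouse_step_orthonormal eta : orthonormal_cols (grouse_step U v J eta).
Proof.
rewrite /grouse_step; case: asboolP => // _.
rewrite -/w -/p -/r; set th := grouse_sigma _ _ _ * _.
have [w0|w0] := eqVneq w 0; first by rewrite w0 trmx0 scaler0 mulmx0 addr0.
set y := _ *: p + _; rewrite -scalemxAr; set c := (fnorm w)^-1.
have nw : fnorm w != 0 by rewrite fnorm_eq0.
have yr : U^T *m y = ((cos th - 1) / fnorm p) *: w.
  rewrite /y mulmxDr -!scalemxAr grouse_r_orth scaler0 addr0.
  by rewrite /p /grouse_p mulmxA oU mul1mx.
have yy : dotp y y = (cos th - 1) ^+ 2 + (1 - cos th ^+ 2).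
  rewrite /y dotpDr !dotpDl !dotpZl !dotpZr [dotp p r]dotpC dotp_r_p !mulr0 addr0 add0r.
  congr (_ + _).
    by rewrite -fnorm_dotp grouse_norm_p; field.
  (* For r = 0 the missing unit vector is read as 0, but then sigma = 0, so the angle is 0 and 1 -
     cos^2 vanishes as well. *)
  rewrite -fnorm_dotp; have [r0|r0] := eqVneq (fnorm r) 0.
    have -> : th = 0 by rewrite /th /grouse_sigma -/r r0 !mul0r.
    by rewrite r0 cos0; ring.
  by rewrite -sin2cos2; field.
have tE : (U + c *: (y *m w^T))^T = U^T + c *: (w *m y^T).
  by rewrite [LHS]raddfD /= linearZ /= trmx_mul trmxK.
have wyU : w *m y^T *m U = ((cos th - 1) / fnorm p) *: (w *m w^T).
  have -> : w *m y^T *m U = w *m (U^T *m y)^T by rewrite trmx_mul trmxK mulmxA.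
  by rewrite yr linearZ /= -scalemxAr.
have wyyw : w *m y^T *m (y *m w^T) = dotp y y *: (w *m w^T).
  by rewrite -mulmxA [y^T *m _]mulmxA [y^T *m y]mx11_scalar mul_scalar_mx -scalemxAr.
rewrite /orthonormal_cols tE mulmxDl !mulmxDr oU -addrA -[RHS]addr0; congr (_ + _).
rewrite -!scalemxAl -!scalemxAr wyU wyyw [U^T *m (_ *m w^T)]mulmxA yr -scalemxAl.
rewrite !scalerA -!scalerDl yy grouse_norm_p.
rewrite (_ : _ + _ = 0) ?scale0r// /c; by field.
Qed.

End GrouseStep.

(** With the greedy angle sin / |r| = 1 / |p|, so the step replaces p by cos p + r up to the factor
    |p| = |w|. The right side is therefore |c P + r|^2 - |P|^2, the change in captured energy along
    that one direction. *)
Lemma grouse_error_update (R : realType) (n d : nat) (Ubar U : 'M[R]_(n, d))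
  (v : 'cV[R]_n) (J : {set 'I_n}) (eta : R) :
  orthonormal_cols U -> well_conditioned U J -> grouse_w U v J != 0 ->
  fnorm (grouse_r U v J) <= fnorm (grouse_p U v J) ->
  sin (grouse_sigma U v J * eta) = fnorm (grouse_r U v J) / fnorm (grouse_p U v J) ->
  let c := cos (grouse_sigma U v J * eta) in
  let P := Ubar^T *m grouse_p U v J in
  let r := Ubar^T *m grouse_r U v J in
  let W := dotp (grouse_w U v J) (grouse_w U v J) in
  W * (subspace_error Ubar U - subspace_error Ubar (grouse_step U v J eta)) =
  (c ^+ 2 - 1) * dotp P P + 2 * c * dotp P r + dotp r r.
Proof.
move=> oU wc w0 rp sinE c P rb W.
have nw : fnorm (grouse_w U v J) != 0 by rewrite fnorm_eq0.
have WE : W = fnorm (grouse_w U v J) ^+ 2 by rewrite fnorm_dotp.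
have npE := grouse_norm_p v J oU.
rewrite /grouse_step; case: asboolP => // _; rewrite sinE -/c.
set y := _ *: _ + _ *: _.
have yE : Ubar^T *m y = (fnorm (grouse_w U v J))^-1 *: ((c - 1) *: P + rb).
  rewrite /y mulmxDr -!scalemxAr -/P -/rb npE scalerDr scalerA; congr (_ *: _ + _).
    by rewrite mulrC.
  rewrite /rb; have [->|r0] := eqVneq (grouse_r U v J) 0.
    by rewrite mulmx0 !scaler0.
  by congr (_ *: _); field; rewrite nw fnorm_eq0.
rewrite /subspace_error mulmxDr mulmxA yE -scalemxAr scalemxAl fnorm_rank1_update.
rewrite -mulmxA -/(grouse_p U v J) -/P -/W !dotpZl !dotpZr.
rewrite dotpDl dotpDr !(dotpDl, dotpZl, dotpZr) [dotp rb P]dotpC WE.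
by field.
Qed.

(* phi stands for an upper bound of the failure indicator: where no step is
   taken, phi >= 1 makes the claimed gain nonpositive. *)
Lemma grouse_step_decrease (R : realType) (n d : nat) (Ubar U : 'M[R]_(n, d))
  (s : 'cV[R]_d) (J : {set 'I_n}) (eta Q phi : R) :
  let v := Ubar *m s in
  let x := residual_mx U Ubar *m s in
  let b := U^T *m restr J x in
  let e := subspace_error Ubar U in
  let k : R := #|J|%:R / n%:R in
  orthonormal_cols Ubar -> orthonormal_cols U -> 0 < Q -> Q <= k ->
  e <= Q ^+ 2 / 128 -> 0 <= phi -> (~ well_conditioned U J -> 1 <= phi) ->
  (well_conditioned U J -> 0 <= grouse_sigma U v J * eta <= pi / 2) ->
  (well_conditioned U J -> fnorm (grouse_r U v J) <= fnorm (grouse_p U v J) ->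
     sin (grouse_sigma U v J * eta) = fnorm (grouse_r U v J) / fnorm (grouse_p U v J)) ->
  subspace_error Ubar (grouse_step U v J eta) <=
  e + 16 * (e ^+ 2 / Q)
  - 1 / 2 * ((dotp (restr J x) (restr J x) - phi * dotp x x - 2 / k * dotp b b) / dotp s s).
Proof.
move=> v x b e k oB oU Q0 Qk eQ phi0 nwc angle greedy.
have k0 : 0 < k by apply: lt_le_trans Qk.
have e0 : 0 <= e by apply: subspace_error_ge0.
have JX : dotp (restr J x) (restr J x) <= dotp x x by apply: dotp_restr_le.
have X0 := dotp_ge0 x; have b0 := dotp_ge0 b.
have kb : 0 <= 2 / k * dotp b b by rewrite mulr_ge0// divr_ge0// ltW.
have eQ0 : 0 <= e ^+ 2 / Q by rewrite divr_ge0 ?sqr_ge0// ltW.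
have trivial_case : dotp (restr J x) (restr J x) - phi * dotp x x - 2 / k * dotp b b <= 0 ->
    e <= e + 16 * (e ^+ 2 / Q)
  - 1 / 2 * ((dotp (restr J x) (restr J x) - phi * dotp x x - 2 / k * dotp b b) / dotp s s).
  move=> h; have : (dotp (restr J x) (restr J x) - phi * dotp x x - 2 / k * dotp b b) / dotp s s <= 0.
    by rewrite mulr_le0_ge0// invr_ge0 dotp_ge0.
  move: (_ / dotp s s) => z hz; lra.
have [wc|nwc'] := pselect (well_conditioned U J); last first.
  rewrite [X in subspace_error _ X](_ : _ = U); last first.
    by rewrite /grouse_step; case: asboolP.
  apply: trivial_case; have := ler_wpM2r X0 (nwc nwc'); rewrite mul1r; lra.
have Jn : (#|J| <= n)%N by rewrite -[X in (_ <= X)%N](card_ord n) max_card.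
have J0 : (0 < #|J|)%N by rewrite lt0n; apply: contraTneq k0 => J0; rewrite /k J0 mul0r ltxx.
have n0 : 0 < n%:R :> R by rewrite ltr0n (leq_trans J0).
have k1 : k <= 1 by rewrite ler_pdivrMr// mul1r ler_nat.
have vv : dotp v v = dotp s s by apply: orthonormal_dotp.
have xE : x = v - U *m (U^T *m v) by rewrite /x mulmxBl -!mulmxA.
set w := grouse_w U v J; set p := grouse_p U v J; set r := grouse_r U v J.
have [a aE] : {a | a = w - U^T *m v} by exists (w - U^T *m v).
(* For s = 0 the normal equations and the lower eigenvalue bound give w = 0, so no movement takes
   place. *)
have [s0|s0] := eqVneq s 0.
  rewrite [X in subspace_error _ X](_ : _ = U); last first.
    rewrite /grouse_step; case: asboolP => // _.
    suff -> : grouse_w U v J = 0 by rewrite trmx0 scaler0 mulmx0 addr0.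
    apply/eqP; rewrite -dotp_eq0 eq_le dotp_ge0 andbT.
    have := well_conditioned_gram wc (grouse_w U v J).
    rewrite (grouse_normal_eq _ J0 wc) /v s0 mulmx0.
    have -> : restr J (0 : 'cV[R]_n) = 0 by apply/colP => i; rewrite !mxE if_same.
    by rewrite mulmx0 dotp0r -/k pmulr_rle0//; lra.
  apply: trivial_case; move: JX X0; rewrite /x s0 mulmx0 dotp0r; lra.
have S0 : 0 < dotp s s by rewrite lt_neqAle dotp_ge0 andbT eq_sym dotp_eq0.
have xS : dotp x x <= e * dotp s s by rewrite /e subspace_error_residual// fnorm_mul_le.
have rr := dotp_rr v J0 wc; rewrite -xE -/b -/w -aE -/r in rr.
have ga := grouse_a_le v J0 wc; rewrite -xE -/b -/w -aE -/k in ga.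
have ab := grouse_ab_le v J0 wc; rewrite -xE -/b -/w -aE -/k in ab.
have rr0 := dotp_ge0 r.
have a0 := dotp_ge0 a.
have ux0 : U^T *m x = 0 by rewrite xE; apply: grouse_x_orth.
have cc : dotp (U^T *m v) (U^T *m v) = dotp s s - dotp x x.
  rewrite -vv xE dotpBr !dotpBl (orthonormal_dotp _ _ oU) [dotp v (U *m _)]dotpC.
  by rewrite (dotp_mul U); ring.
have wE : w = U^T *m v + a by rewrite aE addrCA subrr addr0.
(* These two squares bound the cross term by 2 |<U^T v, a>| <= |U^T v|^2 / 8 + 8 |a|^2. With |a|^2
   <= |s|^2 / 64 this confines |w|^2 between 3/4 and 127/100 of |s|^2. *)
have W1 := dotp_ge0 (U^T *m v + 8 *: a); have W2 := dotp_ge0 (U^T *m v - 8 *: a).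
have WE : dotp w w = dotp (U^T *m v) (U^T *m v) + 2 * dotp (U^T *m v) a + dotp a a.
  by rewrite wE dotpDr !dotpDl [dotp a (U^T *m v)]dotpC; ring.
rewrite !(dotpDr, dotpNr, dotpDl, dotpZr, dotpZl) [dotp a (U^T *m v)]dotpC in W1.
rewrite dotpBr !dotpBl !(dotpZr, dotpZl) [dotp a (U^T *m v)]dotpC in W2.
have Q1 : Q <= 1 by apply: le_trans k1.
(* Since |r|^2 >= 0, [dotp_rr] bounds <a, b> by the sampled part of |x|^2, and (k/2) |a|^2 <= <a,
   b>. *)
have Qa : Q * dotp a a <= 2 * (e * dotp s s).
  by have := ler_wpM2r a0 Qk; move: ga rr rr0 JX xS; clear; lra.
have aS : dotp a a <= dotp s s / 64.
  have h : 2 * (e * dotp s s) <= Q * (Q * dotp s s / 64).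
    by have := ler_wpM2r (ltW S0) eQ; rewrite expr2; clear; lra.
  have := le_trans Qa h; rewrite ler_pM2l// => h2.
  by have := ler_wpM2r (ltW S0) Q1; move: h2; clear; lra.
have e1 : e <= 1 / 128.
  have : Q ^+ 2 <= 1 by rewrite expr_le1// ltW.
  by move: eQ; clear; lra.
have eS : e * dotp s s <= dotp s s / 128.
  by have := ler_wpM2r (ltW S0) e1; clear; lra.
have Wlo : 3 / 4 * dotp s s <= dotp w w.
  by move: S0 W1 WE cc xS eS aS; clear; lra.
have Whi : dotp w w <= 127 / 100 * dotp s s.
  by move: S0 W2 WE cc X0 aS; clear; lra.
have W0 : 0 < dotp w w by move: S0 Wlo; clear; lra.
have w0 : w != 0 by rewrite -dotp_eq0 gt_eqF.
have ab0 : 0 <= dotp a b by apply: le_trans ga; rewrite !mulr_ge0// ltW.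
have rS : dotp r r <= dotp s s / 128.
  by move: rr ab0 JX xS eS; clear; lra.
have rW : dotp r r <= dotp w w / 96.
  by move: rS Wlo; clear; lra.
have npE : fnorm p = fnorm w by apply: grouse_norm_p.
(* The smallness of the error thus guarantees that the greedy angle exists. *)
have rp : fnorm r <= fnorm p.
  by rewrite npE !fnorm_sqrt ler_sqrt ?(ltW W0)//; move: rW W0; clear; lra.
have sinE := greedy wc rp; have /andP[th0 th1] := angle wc.
have := grouse_error_update Ubar oU wc w0 rp sinE.
rewrite -/e -/w -/p -/r; set c := cos _; set e' := subspace_error _ (grouse_step _ _ _ _).
set P := Ubar^T *m p; set Rb := Ubar^T *m r => errE.
have c0 : 0 <= c by apply: cos_ge0_pihalf; rewrite th1 andbT (le_trans _ th0)// oppr_le0 divr_ge0 ?pi_ge0.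
have c1 : c <= 1 by apply: cos_le1.
have c2 : (1 - c ^+ 2) * dotp w w = dotp r r.
  rewrite -sin2cos2 sinE npE -!fnorm_dotp; field.
  by rewrite fnorm_eq0.
have chi : 95 / 96 <= c.
  have h : 95 / 96 <= c ^+ 2.
    by rewrite -(ler_pM2r W0); move: c2 rW; clear; lra.
  by apply: le_trans h _; rewrite expr2 ler_piMl.
set z := v - p.
have zE : z = x - U *m a by rewrite /z (grouse_z U v J) -xE -/w -aE.
have zz : dotp z z = dotp x x + dotp a a.
  rewrite zE dotpBr !dotpBl (orthonormal_dotp _ _ oU) [dotp x (U *m _)]dotpC.
  by rewrite (dotp_mul U) ux0 dotp0r; ring.
(* Because P = s - Ubar^T z and <s, Ubar^T r> = <v, r> = |r|^2, the last by <p, r> = 0. *)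
have PR : dotp P Rb = dotp r r - dotp (Ubar^T *m z) Rb.
  have -> : P = s - Ubar^T *m z.
    by rewrite /z mulmxBr /v mulmxA oB mul1mx opprB addrCA subrr addr0.
  rewrite dotpBl; congr (_ - _); rewrite /Rb -dotp_mul -/v.
  rewrite -(dotp_r_z U v J) -/r -/p dotpBr (dotp_r_p v J0 wc) subr0.
  by rewrite dotpC.
(* Since U^T r = 0, only the residual of [Ubar] acts on r; this gains the factor e that makes the
   cross term of second order. *)
have RbE : Rb = (residual_mx U Ubar)^T *m r.
  have Ur : U^T *m r = 0 by apply: grouse_r_orth.
  have -> : (residual_mx U Ubar)^T = Ubar^T - (U *m (U^T *m Ubar))^T by exact: raddfB.
  by rewrite mulmxBl trmx_mul -mulmxA Ur mulmx0 subr0.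
have RR : dotp Rb Rb <= e * dotp r r.
  by rewrite /e subspace_error_residual// -fnorm_tr RbE fnorm_mul_le.
have RR0 := dotp_ge0 Rb.
have PP : dotp P P <= dotp w w.
  by apply: le_trans (orthonormal_tr_le _ oB) _; rewrite (orthonormal_dotp _ _ oU).
have PP0 := dotp_ge0 P.
set t := dotp (Ubar^T *m z) Rb in PR.
have t2 : t ^+ 2 <= dotp z z * (e * dotp r r).
  apply: le_trans (cauchy_schwarz _ _) _.
  by rewrite ler_pM ?dotp_ge0 ?orthonormal_tr_le.
have Z0 := dotp_ge0 z.
(* Arithmetic-geometric mean inequality, with weights whose product 4 (1/8) 2 is 1, so that the
   square of the right side dominates |z|^2 e |r|^2. *)
have tle : t <= dotp r r / 8 + 2 * (e * dotp z z).
  have m0 : 0 <= dotp r r / 8 + 2 * (e * dotp z z).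
    by rewrite addr_ge0 ?mulr_ge0 ?divr_ge0.
  rewrite leNgt; apply/negP => ht.
  have : (dotp r r / 8 + 2 * (e * dotp z z)) ^+ 2 < t ^+ 2.
    by rewrite ltrXn2r ?nnegrE ?(le_trans m0 (ltW ht)).
  by have := sqr_ge0 (dotp r r / 8 - 2 * (e * dotp z z)); move: t2; clear; lra.
have ct : 2 * c * t <= dotp r r / 4 + 4 * (e * dotp z z).
  apply: (@le_trans _ _ (2 * c * (dotp r r / 8 + 2 * (e * dotp z z)))).
    by rewrite ler_wpM2l// mulr_ge0.
  have := @ler_wpM2r _ (dotp r r / 8 + 2 * (e * dotp z z)) _ c 1; rewrite mul1r.
  move=> /(_ _ c1); rewrite addr_ge0 ?mulr_ge0 ?divr_ge0// => /(_ isT); clear; lra.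
(* In units of |r|^2: the term (1 - c^2) |P|^2 costs at most 1, twice c <P, r> brings 2 (95/96), and
   [ct] takes back 1/4. *)
have main : 71 / 100 * dotp r r - 4 * (e * dotp z z) <= dotp w w * (e - e').
  rewrite errE PR.
  have h1 : (1 - c ^+ 2) * dotp P P <= (1 - c ^+ 2) * dotp w w.
    by rewrite ler_wpM2l// subr_ge0 expr_le1.
  have h2 : 95 / 96 * dotp r r <= c * dotp r r by rewrite ler_wpM2r.
  by move: h1 h2 ct c2 RR0 rr0; clear; lra.
have zQ : 4 * (e * dotp z z) <= 12 * (e ^+ 2 / Q * dotp s s).
  have h : Q * dotp z z <= 3 * (e * dotp s s).
    by have := ler_wpM2r X0 Q1; rewrite zz; move: xS Qa; clear; lra.
  have -> : 12 * (e ^+ 2 / Q * dotp s s) = 12 * (e * (e * dotp s s)) / Q by ring.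
  rewrite ler_pdivlMr//.
  by have := ler_wpM2l e0 h; clear; lra.
have rrlo : dotp (restr J x) (restr J x) - phi * dotp x x - 2 / k * dotp b b <= dotp r r.
  have -> : 2 / k * dotp b b = (1 / 2 * k)^-1 * dotp b b.
    by congr (_ * _); field; rewrite gt_eqF.
  by have := mulr_ge0 phi0 X0; move: rr ab; clear; lra.
have lo : (dotp (restr J x) (restr J x) - phi * dotp x x - 2 / k * dotp b b) / dotp s s <= dotp r r / dotp s s.
  by rewrite ler_wpM2r// invr_ge0 ltW.
apply: le_trans (_ : e + 16 * (e ^+ 2 / Q) - 1 / 2 * (dotp r r / dotp s s) <= _); last first.
  by move: (_ / dotp s s) lo => y; move: (_ / dotp s s); clear => ? ?; lra.
(* Division by |w|^2 explains the final constants: (71/100) / (127/100) exceeds 1/2, and 12 / (3/4)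
   = 16. *)
rewrite -subr_ge0 -(pmulr_rge0 _ W0).
set q := dotp r r / dotp s s; set f := e ^+ 2 / Q in eQ0 zQ *.
have rq : dotp r r = q * dotp s s by rewrite divfK// gt_eqF.
have q0 : 0 <= q by rewrite divr_ge0// ltW.
have h1 := ler_wpM2l q0 Whi; have h2 := ler_wpM2l eQ0 Wlo.
have qS := mulr_ge0 q0 (ltW S0).
by rewrite rq in main; move: main zQ h1 h2 qS; clear; lra.
Qed.

(** * The quadratic form bounding the gain *)

Section ExpectedGain.
Context {R : realType} {n d : nat}.
Implicit Types (U Ubar : 'M[R]_(n, d)) (J : {set 'I_n}).

Lemma coherence_row Ubar i :
  fnorm (row i Ubar) ^+ 2 <= \big[Num.max/0]_(i < n) fnorm (row i Ubar) ^+ 2.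
Proof. exact: le_bigmax. Qed.

Lemma dotp_rowv Ubar i : dotp (rowv Ubar i) (rowv Ubar i) = fnorm (row i Ubar) ^+ 2.
Proof. by rewrite -fnorm_dotp /rowv fnorm_tr. Qed.

Lemma sum_rowv Ubar : \sum_i dotp (rowv Ubar i) (rowv Ubar i) = fnorm Ubar ^+ 2.
Proof.
rewrite fnormE; apply: eq_bigr => i _; rewrite dotpE.
by apply: eq_bigr => j _; rewrite !mxE expr2.
Qed.

Lemma rowv_coherence Ubar i : (0 < d)%N ->
  dotp (rowv Ubar i) (rowv Ubar i) <= d%:R * coherence Ubar / n%:R.
Proof.
move=> d0; have n0 : 0 < n%:R :> R by rewrite ltr0n; case: (n) i => [[]|].
rewrite dotp_rowv /coherence; set b := \big[_/_]_(i < n) _.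
have -> : d%:R * (n%:R / d%:R * b) / n%:R = b.
  by field; rewrite (gt_eqF n0) gt_eqF// ltr0n.
exact: coherence_row.
Qed.

(** The squared rows sum to d, so the largest is at least the mean d / n. *)
Lemma coherence_ge1 Ubar : (0 < d)%N -> orthonormal_cols Ubar -> 1 <= coherence Ubar.
Proof.
move=> d0 oB; have dR : 0 < d%:R :> R by rewrite ltr0n.
have H : \sum_i dotp (rowv Ubar i) (rowv Ubar i) = d%:R.
  by rewrite sum_rowv fnorm_trace oB mxtrace1.
have n0 : (0 < n)%N.
  rewrite lt0n; apply/negP => n0; move: dR; rewrite -H big1 ?ltxx// => i _.
  by have := leq_ltn_trans (leq0n i) (ltn_ord i); rewrite lt0n n0.
have : \sum_i dotp (rowv Ubar i) (rowv Ubar i) <= \sum_(i < n) (d%:R * coherence Ubar / n%:R).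
  by apply: ler_sum => i _; apply: rowv_coherence.
rewrite H sumr_const card_ord -[X in _ <= X -> _]mulr_natr divfK ?gt_eqF ?ltr0n//.
by rewrite ler_pMr.
Qed.

Lemma subspace_errorC Ubar U : subspace_error Ubar U = subspace_error U Ubar.
Proof. by rewrite /subspace_error -fnorm_tr trmx_mul trmxK. Qed.

(** This transfers incoherence from [Ubar] to [U]: a row of [U] splits into its part through [Ubar]
    and a row of the residual, whose total squared norm is the error by symmetry of the error in its
    two arguments. *)
Lemma rowv_error_le Ubar U i : orthonormal_cols Ubar -> orthonormal_cols U ->
  dotp (rowv U i) (rowv U i) <=
  2 * dotp (rowv Ubar i) (rowv Ubar i) + 2 * subspace_error Ubar U.
Proof.
move=> oB oU; set N := residual_mx Ubar U.
set y := U^T *m (Ubar *m rowv Ubar i).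
have uE : rowv U i = y + rowv N i.
  rewrite -[in LHS](subrK (Ubar *m (Ubar^T *m U)) U) -/(residual_mx Ubar U) -/N addrC.
  rewrite /rowv [row i _]raddfD [LHS]raddfD /= row_mul trmx_mul; congr (_ + _).
  by rewrite trmx_mul trmxK /y mulmxA.
have hy : dotp y y <= dotp (rowv Ubar i) (rowv Ubar i).
  by rewrite -(orthonormal_dotp (rowv Ubar i) _ oB) orthonormal_tr_le.
have hN : dotp (rowv N i) (rowv N i) <= subspace_error Ubar U.
  rewrite subspace_errorC subspace_error_residual// -/N -sum_rowv (bigD1 i)//=.
  by rewrite lerDl sumr_ge0// => j _; apply: dotp_ge0.
have := dotp_ge0 (y - rowv N i); rewrite uE; move: hy hN; clear.
move: (rowv N i) => z; rewrite !dotpBr !dotpBl !dotpDr !dotpDl [dotp z y]dotpC; lra.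
Qed.

(** In units of (c/n) |x|^2 per set: the sampled energy has mean 1, the failure bound costs at most
    1/10 because 40 d <= c, and the last term at most 2/900. For the last one the vectors x_i U_i
    are summed over J; they are centered exactly because U^T x = 0. *)
Lemma sum_restr_gain U c (rho : R) (p q : nat) (x : 'cV[R]_n) :
  orthonormal_cols U -> U^T *m x = 0 ->
  (forall i, dotp (rowv U i) (rowv U i) <= rho) -> 0 <= rho ->
  (0 < c <= n)%N -> 6 <= ln (n%:R : R) -> 150 * ln n%:R * rho <= c%:R / n%:R ->
  (40 * d <= c)%N ->
  10 * ln (n%:R : R) <= p%:R <= 11 * ln (n%:R : R) ->
  8 * ln (n%:R : R) <= c%:R / n%:R * q%:R <= 8 * ln (n%:R : R) + 1 ->
  1 / 2 * (c%:R / n%:R) * 'C(n, c)%:R * dotp x x <=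
  \sum_(J : {set 'I_n} | #|J| == c) (dotp (restr J x) (restr J x)
     - ill_bound (rowv U) rho p q J * dotp x x
     - 2 / (#|J|%:R / n%:R) * dotp (U^T *m restr J x) (U^T *m restr J x)).
Proof.
move=> oU Ux hr r0 cn L6 small dc hp hq.
have n0 : 0 < n%:R :> R by case/andP: cn => c0 cn; rewrite ltr0n (leq_trans c0).
have tight : gram (rowv U) [set: 'I_n]%SET = 1%:M by rewrite gram_rowvT.
have h1 := sum_ill_bound_le tight hr r0 cn L6 small hp hq.
have h2 := sum_card_sq c (fun i => x i 0).
have h3 : \sum_(J : {set 'I_n} | #|J| == c) dotp (U^T *m restr J x) (U^T *m restr J x)
    <= c%:R / n%:R * 'C(n, c)%:R * (rho * dotp x x).
  have y0 : \sum_i x i 0 *: rowv U i = 0.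
    have xT : restr [set: 'I_n]%SET x = x by apply/colP => i; rewrite mxE inE.
    have := tr_mul_restr U [set: 'I_n]%SET x; rewrite xT Ux => /esym h.
    by rewrite -[RHS]h; apply: eq_bigl => i; rewrite inE.
  apply: le_trans (_ : _ <= c%:R / n%:R * 'C(n, c)%:R * \sum_i dotp (x i 0 *: rowv U i) (x i 0 *: rowv U i)) _.
    apply: le_trans (sum_card_centered c y0); rewrite le_eqVlt; apply/orP; left.
    by apply/eqP; apply: eq_bigr => J _; rewrite tr_mul_restr.
  rewrite ler_wpM2l// [dotp x x]dotpE mulr_sumr; apply: ler_sum => i _.
  by rewrite dotpZl dotpZr mulrA -expr2 mulrC ler_wpM2r// -?expr2 ?sqr_ge0.
rewrite !sumrB -mulr_suml.
have -> : \sum_(J : {set 'I_n} | #|J| == c) dotp (restr J x) (restr J x) =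
    c%:R / n%:R * 'C(n, c)%:R * dotp x x.
  rewrite dotpE; under [in RHS]eq_bigr do rewrite -expr2.
  rewrite -h2; apply: eq_bigr => J _; rewrite dotp_restr2 dotp_restr.
  by apply: eq_bigr => i _; rewrite expr2.
have -> : \sum_(J : {set 'I_n} | #|J| == c)
      2 / (#|J|%:R / n%:R) * dotp (U^T *m restr J x) (U^T *m restr J x) =
    2 / (c%:R / n%:R) *
      \sum_(J : {set 'I_n} | #|J| == c) dotp (U^T *m restr J x) (U^T *m restr J x).
  by rewrite mulr_sumr; apply: eq_bigr => J /eqP ->.
have k0 : 0 < c%:R / n%:R :> R by case/andP: cn => c0 _; rewrite divr_gt0// ltr0n.
have k2 : 0 <= 2 / (c%:R / n%:R) :> R by rewrite divr_ge0// ltW.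
have h3' := ler_wpM2l k2 h3.
have h1' : \sum_(J : {set 'I_n} | #|J| == c) ill_bound (rowv U) rho p q J <=
    'C(n, c)%:R * (c%:R / n%:R / 10).
  apply: le_trans h1 _; rewrite ler_wpM2l// [leRHS]mulrAC ler_wpM2r// ?invr_ge0 ?(ltW n0)//.
  have : (40 * d)%:R <= c%:R :> R by rewrite ler_nat.
  by rewrite natrM; clear; lra.
have h1'' := ler_wpM2r (dotp_ge0 x) h1'.
have rk : 900 * rho <= c%:R / n%:R.
  by apply: le_trans small; rewrite ler_wpM2r//; move: L6; clear; lra.
have h4 : 2 / (c%:R / n%:R) * (c%:R / n%:R * 'C(n, c)%:R * (rho * dotp x x)) =
    2 * rho * ('C(n, c)%:R * dotp x x).
  by field; rewrite !gt_eqF//; move: k0; rewrite pmulr_lgt0 ?invr_gt0.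
rewrite h4 in h3'; have X0 : 0 <= 'C(n, c)%:R * dotp x x by rewrite mulr_ge0// dotp_ge0.
have h5 := ler_wpM2r X0 rk; have h6 : 0 <= c%:R / n%:R * ('C(n, c)%:R * dotp x x).
  by rewrite mulr_ge0// ltW.
move: h1'' h3' h5 h6; clear.
move: (c%:R / n%:R) 'C(n, c)%:R (dotp x x) (\sum_(J | _) ill_bound _ _ _ _ _)
  (2 / _ * _) => k C X S1 S2; lra.
Qed.

(** The matrix of the quadratic form subtracted in [grouse_step_decrease]. The diagonal 0-1 matrix
    realizes [restr J] as a matrix product. *)
Definition gain_mx (phi : {set 'I_n} -> R) Ubar U J : 'M[R]_d :=
  let M := residual_mx U Ubar in
  let D := diag_mx (\row_i ((i \in J)%:R : R)) in
  (D *m M)^T *m (D *m M) - phi J *: (M^T *m M)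
  - (2 / (#|J|%:R / n%:R)) *: ((U^T *m (D *m M))^T *m (U^T *m (D *m M))).

Lemma diag_mx_restr J (x : 'cV[R]_n) :
  diag_mx (\row_i ((i \in J)%:R : R)) *m x = restr J x.
Proof.
by apply/colP => i; rewrite mul_diag_mx !mxE; case: (i \in J); rewrite ?mul1r ?mul0r.
Qed.

Lemma gain_mxE phi Ubar U J (s : 'cV[R]_d) :
  let x := residual_mx U Ubar *m s in
  dotp s (gain_mx phi Ubar U J *m s) =
  dotp (restr J x) (restr J x) - phi J * dotp x x
  - 2 / (#|J|%:R / n%:R) * dotp (U^T *m restr J x) (U^T *m restr J x).
Proof.
move=> x; rewrite /gain_mx !mulmxBl !dotpBr -!scalemxAl !dotpZr -!mulmxA.
rewrite -diag_mx_restr /x !dotp_mul.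
by rewrite !trmx_mul !mulmxA.
Qed.

Lemma tr_gain_mx phi Ubar U J :
  let M := residual_mx U Ubar in
  \tr (gain_mx phi Ubar U J) =
  \sum_l (dotp (restr J (col l M)) (restr J (col l M)) - phi J * dotp (col l M) (col l M)
  - 2 / (#|J|%:R / n%:R) * dotp (U^T *m restr J (col l M)) (U^T *m restr J (col l M))).
Proof.
have trB (A B : 'M[R]_d) : \tr (A - B) = \tr A - \tr B by exact: raddfB.
move=> M; rewrite /gain_mx !trB !mxtraceZ -!fnorm_trace !fnorm_col !mulr_sumr -!sumrB.
apply: eq_bigr => l _.
have colM m k (A : 'M[R]_(m, k)) (B : 'M[R]_(k, d)) : col l (A *m B) = A *m col l B.
  by rewrite !colE mulmxA.
by rewrite !colM !diag_mx_restr.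
Qed.

End ExpectedGain.

(** With ln 20 >= 5/2 the sample bound gives q >= (160/3) L^2 d mu, and q <= n then forces n to be
    large. Finally (160/3) 6 = 320 exceeds 150 (17/8), which is the second claim. *)
Lemma sampling_regime (R : realType) (n d : nat) (mu C1 q : R) :
  (1 <= d)%N -> (2 * d <= n)%N -> 1 <= mu -> 64 / 3 <= C1 ->
  C1 * ln n%:R ^+ 2 * d%:R * mu * ln (20 * d%:R) <= q -> q <= n%:R ->
  [/\ 6 <= ln (n%:R : R),
      150 * ln n%:R * (17 / 8 * (d%:R * mu / n%:R)) <= q / n%:R,
      40 * d%:R <= q & 0 < q].
Proof.
move=> d1 n2 mu1 C1ge hq qn; have dR : 1 <= d%:R :> R by rewrite ler1n.
have nR : 2 <= n%:R :> R.
  by rewrite -[2]/(2%:R) ler_nat (leq_trans _ n2)// leq_pmulr.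
set L := ln n%:R in hq *; set l := ln (20 * d%:R) in hq.
have l1 : 5 / 2 <= l.
  have h : 5 / 2 <= ln 20 :> R.
    have := @ln_ge_natr R 5 (20 ^+ 2); rewrite lnXn// => /(_ ltac:(lra)); lra.
  by apply: le_trans h _; rewrite /l ler_ln ?posrE//; lra.
have L0 : 1 / 2 <= L.
  have := @ln_ge_natr R 2 (2 ^+ 4); rewrite lnXn// => /(_ ltac:(lra)) h.
  have : ln 2 <= L :> R by rewrite /L ler_ln ?posrE//; lra.
  lra.
have dm : d%:R <= d%:R * mu by rewrite ler_peMr//; lra.
have dm0 : 0 <= d%:R * mu by lra.
have base : 64 / 3 * (5 / 2) * L ^+ 2 * (d%:R * mu) <= q.
  apply: le_trans hq.
  have -> : C1 * L ^+ 2 * d%:R * mu * l = (C1 * l) * (L ^+ 2 * (d%:R * mu)) by ring.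
  rewrite -[leLHS]mulrA; apply: ler_wpM2r; first by rewrite mulr_ge0 ?sqr_ge0.
  by apply: ler_pM => //; lra.
have nL : 160 / 3 * L ^+ 2 <= n%:R.
  apply: le_trans (le_trans base qn).
  have : L ^+ 2 * 1 <= L ^+ 2 * (d%:R * mu) by rewrite ler_wpM2l ?sqr_ge0//; lra.
  lra.
have half_ge0 : 0 <= 1 / 2 :> R by clear; lra.
(* Bootstrapping on n >= (160/3) L^2: a lower bound a for L makes n at least a power of 3, hence
   improves the bound for L. The chain is 1/2, 2, 4, 6. *)
have boot (a : R) (m : nat) : 0 <= a -> a <= L -> 3 ^+ m <= 160 / 3 * a ^+ 2 -> m%:R <= L.
  move=> a0 aL h; apply: ln_ge_natr; apply: le_trans h (le_trans _ nL).
  apply: ler_wpM2l; first by clear; lra.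
  by rewrite !expr2; apply: ler_pM.
have L2 : 2 <= L by apply: (boot (1 / 2) 2%N half_ge0 L0); clear; lra.
have L4 : 4 <= L by apply: (boot 2 4%N _ L2); clear; lra.
have L6 : 6 <= L by apply: (boot 4 6%N _ L4); clear; lra.
have LL : 6 * L <= L ^+ 2 by rewrite expr2 ler_wpM2r//; lra.
have h := ler_wpM2r dm0 LL; have h' := ler_wpM2r dm0 L6.
split; [exact: L6| | |].
- have -> : 150 * L * (17 / 8 * (d%:R * mu / n%:R)) = (150 * (17 / 8) * (L * (d%:R * mu))) / n%:R.
    by ring.
  by rewrite ler_wpM2r ?invr_ge0//; move: base h h' dm0; clear; lra.
- by move: base h h' dm dm0 dR; clear; lra.
- by move: base h h' dm dm0 dR; clear; lra.
Qed.

(** * Equality of laws and bounded random variables *)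

Section LawExtensionality.
Context {R : realType} {disp : measure_display} {T : measurableType disp}.
Variables (P : probability T R) (N : nat).

Definition tuple_rect (B : 'I_N -> set R) : set (N.-tuple R) :=
  [set y | forall i, B i (tnth y i)].

(** Rectangles are stable under intersection and generate the sigma-algebra of tuples, so the two
    image measures coincide. *)
Lemma integral_tuple_ext (X Y : T -> N.-tuple R) (f : N.-tuple R -> R) :
  (forall i, measurable_fun [set: T] (fun x => tnth (X x) i)) ->
  (forall i, measurable_fun [set: T] (fun x => tnth (Y x) i)) ->
  (forall B : 'I_N -> set R, (forall i, measurable (B i)) ->
     P [set x | forall i, B i (tnth (X x) i)] = P [set x | forall i, B i (tnth (Y x) i)]) ->
  measurable_fun [set: N.-tuple R] f ->
  P.-integrable [set: T] (EFin \o (f \o X)) ->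
  P.-integrable [set: T] (EFin \o (f \o Y)) ->
  \int[P]_x f (X x) = \int[P]_x f (Y x).
Proof.
move=> mX mY XY mf iX iY.
have mX' : measurable_fun [set: T] X by apply/measurable_fun_tnthP.
have mY' : measurable_fun [set: T] Y by apply/measurable_fun_tnthP.
pose G := [set C | exists2 B : 'I_N -> set R, (forall i, measurable (B i)) & C = tuple_rect B].
have mG C : G C -> measurable C.
  move=> [B mB ->]; have -> : tuple_rect B = \bigcap_(i in [set: 'I_N]) ((@tnth _ R ^~ i) @^-1` B i).
    by apply/seteqP; split => [y h i _|y h i]; [exact: h|exact: (h i)].
  apply: fin_bigcap_measurable => // i _.
  by rewrite -[X in measurable X]setTI; apply: measurable_tnth.
have GT : G setT.
  by exists (fun=> setT) => //; apply/seteqP; split => // y.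
have GI : setI_closed G.
  move=> _ _ [B mB ->] [B' mB' ->]; exists (fun i => B i `&` B' i).
    by move=> i; apply: measurableI.
  by apply/seteqP; split => y /=; [move=> [h h'] i; split|move=> h; split => i; have [] := h i].
pose mu1 := pushforward P X; pose mu2 := pushforward P Y.
have mu12 C : measurable C -> mu1 C = mu2 C.
  move=> mC; apply: (@g_sigma_algebra_measure_unique _ R _ G mG (fun=> setT)) => //.
  - by apply/seteqP; split => // y _; exists 0%N.
  - move=> _ [B mB ->]; exact: XY.
  - by move=> k; apply: le_lt_trans (probability_le1 P _) (ltry _); rewrite preimage_setT.
  - suff : @measurable _ (N.-tuple R) `<=` <<s G >> by apply.
    apply: smallest_sub; first exact: smallest_sigma_algebra.
    move=> A; rewrite -bigcup_seq => -[i /= _ [B mB <-]].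
    apply: sub_sigma_algebra; exists (fun j => if j == i then B else setT).
      by move=> j; case: ifP.
    apply/seteqP; split => y /=.
      by move=> [_ By] j; case: eqP => // ->.
    by move=> /(_ i); rewrite eqxx.
rewrite /Rintegral; congr fine.
have mfE : measurable_fun [set: N.-tuple R] (fun y => (f y)%:E) by apply/measurable_EFinP.
have push Z : measurable_fun [set: T] Z -> P.-integrable [set: T] (EFin \o (f \o Z)) ->
    (\int[pushforward P Z]_y (f y)%:E = \int[P]_x (f (Z x))%:E)%E.
  by move=> mZ iZ; rewrite integral_pushforward// preimage_setT.
rewrite -push// -(push Y)//.
by apply: eq_measure_integral => C mC _; apply: mu12.
Qed.

End LawExtensionality.

Section BoundedMeasurable.
Context {R : realType} {disp : measure_display} {T : measurableType disp}.
Variable P : probability T R.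
Implicit Types f g : T -> R.

Definition bounded_on_T f : Prop := exists C : R, forall x, `|f x| <= C.

Definition bdm f : Prop := measurable_fun [set: T] f /\ bounded_on_T f.

Lemma bdm_integrable f : bdm f -> P.-integrable [set: T] (EFin \o f).
Proof.
move=> [mf [C hC]]; apply: measurable_bounded_integrable => //.
  exact: le_lt_trans (probability_le1 P measurableT) (ltry _).
exists C; split; first by rewrite num_real.
by move=> M CM x _; apply: le_trans (hC x) (ltW CM).
Qed.

Lemma bounded_cst c : bounded_on_T (fun=> c).
Proof. by exists `|c|. Qed.

Lemma boundedD f g : bounded_on_T f -> bounded_on_T g -> bounded_on_T (fun x => f x + g x).
Proof.
move=> [C hC] [D hD]; exists (C + D) => x.
by rewrite (le_trans (ler_normD _ _))// lerD.
Qed.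

Lemma boundedM f g : bounded_on_T f -> bounded_on_T g -> bounded_on_T (fun x => f x * g x).
Proof.
move=> [C hC] [D hD]; exists (C * D) => x.
by rewrite normrM ler_pM.
Qed.

Lemma bdm_cst c : bdm (fun=> c).
Proof. by split; [exact: measurable_cst|exact: bounded_cst]. Qed.

Lemma bdmD f g : bdm f -> bdm g -> bdm (fun x => f x + g x).
Proof.
by move=> [mf bf] [mg bg]; split; [exact: measurable_funD|exact: boundedD].
Qed.

Lemma bdmM f g : bdm f -> bdm g -> bdm (fun x => f x * g x).
Proof.
by move=> [mf bf] [mg bg]; split; [exact: measurable_funM|exact: boundedM].
Qed.

Lemma bdm_sum (I : Type) (r : seq I) (Q : pred I) (F : I -> T -> R) :
  (forall i, bdm (F i)) -> bdm (fun x => \sum_(i <- r | Q i) F i x).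
Proof.
move=> h; elim: r => [|i r IH].
  by under eq_fun do rewrite big_nil; apply: bdm_cst.
under eq_fun do rewrite big_cons; case: (Q i) => //.
exact: bdmD.
Qed.

Lemma bdm_indic (A : set T) : measurable A -> bdm (\1_A).
Proof.
move=> mA; split; first exact: measurable_indic.
by exists 1 => x; rewrite indicE; case: (x \in A); rewrite ?normr1 ?normr0.
Qed.

Lemma expD f g : bdm f -> bdm g -> \int[P]_x (f x + g x) = \int[P]_x f x + \int[P]_x g x.
Proof. by move=> bf bg; rewrite RintegralD//; apply: bdm_integrable. Qed.

Lemma expZ c f : bdm f -> \int[P]_x (c * f x) = c * \int[P]_x f x.
Proof. by move=> bf; rewrite RintegralZl//; apply: bdm_integrable. Qed.

Lemma exp_sum (I : Type) (r : seq I) (Q : pred I) (F : I -> T -> R) :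
  (forall i, bdm (F i)) ->
  \int[P]_x (\sum_(i <- r | Q i) F i x) = \sum_(i <- r | Q i) \int[P]_x F i x.
Proof.
move=> h; elim: r => [|i r IH].
  under eq_Rintegral do rewrite big_nil; rewrite big_nil.
  by rewrite Rintegral_cst// mul0r.
under eq_Rintegral do rewrite big_cons; rewrite big_cons; case: (Q i) => //.
by rewrite expD ?IH//; apply: bdm_sum.
Qed.

Lemma exp_le f g : bdm f -> bdm g -> (forall x, f x <= g x) ->
  \int[P]_x f x <= \int[P]_x g x.
Proof. by move=> bf bg fg; apply: le_Rintegral => //; apply: bdm_integrable. Qed.

Lemma exp_null f (A : set T) : bdm f -> measurable A -> P A = 0 ->
  \int[P]_x (\1_A x * f x) = 0.
Proof.
move=> [mf [C hC]] mA PA; apply/eqP; rewrite -normr_le0.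
have bA := bdm_indic mA.
have bAf : bdm (fun x => \1_A x * f x) by apply: bdmM => //; split=> //; exists C.
apply: le_trans (le_normr_Rintegral measurableT (bdm_integrable bAf)) _.
have -> : 0 = C * \int[P]_x (\1_A x : R).
  rewrite /Rintegral integral_indic// setIT.
  by rewrite -[X in fine X]/(P A) PA mulr0.
rewrite -expZ//; apply: exp_le => [||x].
- split; first by apply: measurableT_comp => //; case: bAf.
  by case: bAf => _ [D hD]; exists D => x; rewrite normr_id.
- by apply: bdmM => //; apply: bdm_cst.
rewrite normrM mulrC ler_pM//.
by rewrite ger0_norm// indicE.
Qed.

End BoundedMeasurable.

(** * Matrix expressions with entries in an algebra of functions *)

Section FunctionAlgebra.
Context {R : realType} {A : Type} (K : (A -> R) -> Prop).
Hypothesis K_cst : forall c, K (fun=> c).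
Hypothesis K_add : forall f g, K f -> K g -> K (fun a => f a + g a).
Hypothesis K_mul : forall f g, K f -> K g -> K (fun a => f a * g a).

(** [K] is later taken to be the measurable functions, the bounded ones, and those that are both;
    closure under matrix operations is proved once for all three. *)
Definition mx_in m k (M : A -> 'M[R]_(m, k)) : Prop :=
  forall i j, K (fun a => M a i j).

Lemma in_sum (I : Type) (r : seq I) (Q : pred I) (F : I -> A -> R) :
  (forall i, K (F i)) -> K (fun a => \sum_(i <- r | Q i) F i a).
Proof.
move=> h; elim: r => [|i r IH].
  by under eq_fun do rewrite big_nil; apply: K_cst.
under eq_fun do rewrite big_cons; case: (Q i) => //.
exact: K_add.
Qed.

Lemma mx_in_cst m k (M : 'M[R]_(m, k)) : mx_in (fun=> M).
Proof. by move=> i j; apply: K_cst. Qed.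

Lemma mx_in_add m k (M N : A -> 'M[R]_(m, k)) :
  mx_in M -> mx_in N -> mx_in (fun a => M a + N a).
Proof.
move=> hM hN i j; under eq_fun do rewrite mxE.
exact: K_add.
Qed.

Lemma mx_in_scale m k (c : A -> R) (M : A -> 'M[R]_(m, k)) :
  K c -> mx_in M -> mx_in (fun a => c a *: M a).
Proof.
move=> hc hM i j; under eq_fun do rewrite mxE.
exact: K_mul.
Qed.

Lemma mx_in_sub m k (M N : A -> 'M[R]_(m, k)) :
  mx_in M -> mx_in N -> mx_in (fun a => M a - N a).
Proof.
move=> hM hN; under eq_fun do rewrite -scaleN1r.
by apply: mx_in_add => //; apply: mx_in_scale.
Qed.

Lemma mx_in_mul m k l (M : A -> 'M[R]_(m, k)) (N : A -> 'M[R]_(k, l)) :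
  mx_in M -> mx_in N -> mx_in (fun a => M a *m N a).
Proof.
move=> hM hN i j; under eq_fun do rewrite mxE.
by apply: in_sum => b; apply: K_mul.
Qed.

Lemma mx_in_tr m k (M : A -> 'M[R]_(m, k)) : mx_in M -> mx_in (fun a => (M a)^T).
Proof. by move=> hM i j; under eq_fun do rewrite mxE; apply: hM. Qed.

Lemma mx_in_exp m (M : A -> 'M[R]_m) p : mx_in M -> mx_in (fun a => M a ^+ p).
Proof.
move=> hM; elim: p => [|p IH].
  by under eq_fun do rewrite expr0; apply: mx_in_cst.
by under eq_fun do rewrite exprS -mulmxE; apply: mx_in_mul.
Qed.

Lemma in_trace m (M : A -> 'M[R]_m) : mx_in M -> K (fun a => \tr (M a)).
Proof. by move=> hM; apply: in_sum => i; apply: hM. Qed.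

Lemma in_dotp m (x y : A -> 'cV[R]_m) : mx_in x -> mx_in y -> K (fun a => dotp (x a) (y a)).
Proof. by move=> hx hy; apply: mx_in_mul => //; apply: mx_in_tr. Qed.

Context {n d : nat} (U : A -> 'M[R]_(n, d)).
Hypothesis hU : mx_in U.

Lemma mx_in_gram J : mx_in (fun a => gram (rowv (U a)) J).
Proof.
move=> i j; under eq_fun do rewrite /gram summxE.
apply: in_sum => l; apply: mx_in_mul.
  by apply: mx_in_tr => a b; under eq_fun do rewrite mxE; apply: hU.
by apply: mx_in_tr; apply: mx_in_tr => a b; under eq_fun do rewrite mxE; apply: hU.
Qed.

Lemma in_ill_bound rho p q J : K (fun a => ill_bound (rowv (U a)) rho p q J).
Proof.
apply: K_add; apply: K_mul; try exact: K_cst; apply/in_trace/mx_in_exp.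
  exact: mx_in_gram.
by apply: mx_in_add; [apply: mx_in_gram|apply: mx_in_cst].
Qed.

Lemma mx_in_residual (Ubar : 'M[R]_(n, d)) : mx_in (fun a => residual_mx (U a) Ubar).
Proof.
apply: mx_in_sub; first exact: mx_in_cst.
by apply: mx_in_mul => //; apply: mx_in_mul; [apply: mx_in_tr|apply: mx_in_cst].
Qed.

Lemma mx_in_gain (Ubar : 'M[R]_(n, d)) rho (p q : nat -> nat) J :
  mx_in (fun a => gain_mx (fun J => ill_bound (rowv (U a)) rho (p #|J|) (q #|J|) J) Ubar (U a) J).
Proof.
have hM := mx_in_residual Ubar.
have hDM : mx_in (fun a => diag_mx (\row_i ((i \in J)%:R : R)) *m residual_mx (U a) Ubar).
  by apply: mx_in_mul => //; apply: mx_in_cst.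
have hUDM : mx_in (fun a => (U a)^T *m (diag_mx (\row_i ((i \in J)%:R : R)) *m residual_mx (U a) Ubar)).
  by apply: mx_in_mul => //; apply: mx_in_tr.
apply: mx_in_sub; first apply: mx_in_sub.
- by apply: mx_in_mul => //; apply: mx_in_tr.
- apply: mx_in_scale; first exact: in_ill_bound.
  by apply: mx_in_mul => //; apply: mx_in_tr.
- apply: mx_in_scale; first exact: K_cst.
  by apply: mx_in_mul => //; apply: mx_in_tr.
Qed.

Lemma in_error (Ubar : 'M[R]_(n, d)) : K (fun a => subspace_error Ubar (U a)).
Proof.
rewrite /subspace_error; under eq_fun do rewrite fnorm_trace -mulN1r.
apply: K_add; first exact: K_cst.
apply: K_mul; first exact: K_cst.
have h : mx_in (fun a => Ubar^T *m U a) by apply: mx_in_mul => //; apply: mx_in_cst.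
by apply/in_trace/mx_in_mul => //; apply: mx_in_tr.
Qed.

End FunctionAlgebra.

(** The power -1 agrees with the inverse on all nonnegative reals, 0 included, and is measurable. *)
Lemma measurable_inv_ge0 (R : realType) (disp : measure_display) (T : measurableType disp)
  (f : T -> R) : (forall x, 0 <= f x) -> measurable_fun [set: T] f ->
  measurable_fun [set: T] (fun x => (f x)^-1).
Proof.
move=> f0 mf; have -> : (fun x => (f x)^-1) = (@powR R ^~ (-1)) \o f.
  by apply/funext => x /=; rewrite powR_inv1.
by apply: measurableT_comp => //; apply: measurable_powR.
Qed.

(** * The direction of s and its symmetries *)

Section Projections.
Context {R : realType} {d : nat}.

(* The value at y = 0 is 0. *)
Definition dir_prod (j l : 'I_d) (y : 'cV[R]_d) : R := y j 0 * y l 0 * (dotp y y)^-1.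

Lemma dir_prod_bounded j l y : `|dir_prod j l y| <= 1.
Proof.
have [y0|y0] := eqVneq y 0; first by rewrite /dir_prod y0 dotp0r invr0 mulr0 normr0.
have D : 0 < dotp y y by rewrite lt_neqAle dotp_ge0 andbT eq_sym dotp_eq0.
rewrite normrM normfV (gtr0_norm D) ler_pdivrMr// mul1r.
have h i : y i 0 ^+ 2 <= dotp y y.
  rewrite dotpE (bigD1 i)//= expr2 lerDl sumr_ge0// => b _.
  by rewrite -expr2 sqr_ge0.
have hj := h j; have hl := h l; rewrite ler_norml.
have h1 := sqr_ge0 (y j 0 + y l 0); have h2 := sqr_ge0 (y j 0 - y l 0).
by apply/andP; split; move: hj hl h1 h2; clear; lra.
Qed.

Lemma sum_dir_prod y : \sum_j dir_prod j j y = (y != 0)%:R.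
Proof.
rewrite -mulr_suml -dotpE; have [->|y0] := eqVneq y 0.
  by rewrite dotp0r mul0r.
by rewrite divff ?dotp_eq0.
Qed.

Lemma quadratic_dir_prod (H : 'M[R]_d) y :
  dotp y (H *m y) / dotp y y = \sum_j \sum_l H j l * dir_prod j l y.
Proof.
rewrite dotpE mulr_suml; apply: eq_bigr => j _.
rewrite mxE mulr_sumr mulr_suml; apply: eq_bigr => l _.
by rewrite /dir_prod; ring.
Qed.

Definition flip (j : 'I_d) (y : 'cV[R]_d) : 'cV[R]_d :=
  \col_i (if i == j then - y i 0 else y i 0).

Definition swap (j l : 'I_d) (y : 'cV[R]_d) : 'cV[R]_d := \col_i y (tperm j l i) 0.

Lemma dir_prod_flip j l y : j != l -> dir_prod j l (flip j y) = - dir_prod j l y.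
Proof.
move=> jl; rewrite /dir_prod !mxE eqxx eq_sym (negbTE jl).
have -> : dotp (flip j y) (flip j y) = dotp y y.
  by rewrite !dotpE; apply: eq_bigr => i _; rewrite !mxE; case: ifP => _; rewrite ?mulrNN.
by rewrite !mulNr.
Qed.

Lemma dir_prod_swap j l y : dir_prod j j (swap j l y) = dir_prod l l y.
Proof.
rewrite /dir_prod !mxE tpermL; congr (_ * _^-1).
rewrite !dotpE [RHS](reindex_inj (@perm_inj _ (tperm j l))) /=.
by apply: eq_bigr => i _; rewrite !mxE.
Qed.

End Projections.

(** The centered density is even and Lebesgue measure is invariant under negation. *)
Lemma normal_prob0_sym (R : realType) (B : set R) : measurable B ->
  normal_prob 0 1 (-%R @^-1` B) = normal_prob 0 1 B :> \bar R.
Proof.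
move=> mB; rewrite /normal_prob.
have sym x : normal_pdf 0 1 (- x) = normal_pdf 0 1 x :> R.
  by rewrite /normal_pdf oner_eq0 /normal_fun !subr0 sqrrN.
have mN : measurable_fun [set: measurableTypeR R] (-%R : measurableTypeR R -> measurableTypeR R).
  exact: oppr_measurable.
transitivity (\int[pushforward lebesgue_measure (-%R : measurableTypeR R -> measurableTypeR R)]_(y in B)
   (normal_pdf 0 1 y)%:E)%E.
  rewrite ge0_integral_pushforward//.
  - by apply: eq_integral => x _; rewrite /= sym.
  - apply/measurable_EFinP; apply: measurable_funTS.
    exact: measurable_normal_pdf.
  - by move=> y _; rewrite lee_fin normal_pdf_ge0.
by apply: eq_measure_integral => C mC _; apply: lebesgue_measureN.
Qed.

(** * Averaging over s and over the sample *)

Section DrawsOnto.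
Context {n m : nat}.
Implicit Types J K : {set 'I_n}.

(** Listing J and then its complement, and likewise for K, yields an injection h of the index set
    into itself with h x in K exactly when x is in J. Composing draws with h is injective and sends
    draws onto J to draws onto K. *)
Lemma draws_onto_le J K : #|J| = #|K| -> (draws_onto m J <= draws_onto m K)%N.
Proof.
move=> JK; have [J0|/set0Pn[x0 x0J]] := eqVneq J finset.set0.
  have -> : K = finset.set0 by apply/eqP; rewrite -cards_eq0 -JK J0 cards0.
  by rewrite J0.
have uE (L : {set 'I_n}) : uniq (enum L ++ enum (~: L)%SET).
  rewrite cat_uniq !enum_uniq /= andbT; apply/hasPn => x.
  by rewrite !mem_enum inE.
have mE (L : {set 'I_n}) x : x \in enum L ++ enum (~: L)%SET.
  by rewrite mem_cat !mem_enum inE orbN.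
have sE (L : {set 'I_n}) : size (enum L ++ enum (~: L)%SET) = n.
  by rewrite size_cat -!cardE cardsC card_ord.
pose h x := nth x0 (enum K ++ enum (~: K)%SET) (index x (enum J ++ enum (~: J)%SET)).
have ix x : (index x (enum J ++ enum (~: J)%SET) < n)%N by rewrite -[X in (_ < X)%N](sE J) index_mem.
have hI : injective h.
  move=> x y /eqP; rewrite nth_uniq ?sE// => /eqP E.
  by rewrite -(nth_index x0 (mE J x)) E nth_index.
have hJ x : (h x \in K) = (x \in J).
  have sJK : size (enum K) = size (enum J) by rewrite -!cardE.
  rewrite /h nth_cat index_cat mem_enum sJK; have [xJ|xJ] := boolP (x \in J).
    have iJ : (index x (enum J) < size (enum J))%N by rewrite index_mem mem_enum.
    by rewrite iJ -mem_enum mem_nth// sJK.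
  rewrite ltnNge leq_addr /= addKn; apply/negbTE.
  have sC : size (enum (~: K)%SET) = size (enum (~: J)%SET).
    by rewrite -!cardE; apply/eqP; rewrite -(eqn_add2l #|J|) {1}JK !cardsC.
  have : nth x0 (enum (~: K)%SET) (index x (enum (~: J)%SET)) \in enum (~: K)%SET.
    by apply: mem_nth; rewrite sC index_mem mem_enum inE.
  by rewrite mem_enum inE.
pose H (f : {ffun 'I_m -> 'I_n}) : {ffun 'I_m -> 'I_n} := [ffun i => h (f i)].
have HI : injective H.
  by move=> f f' /ffunP E; apply/ffunP => i; have := E i; rewrite !ffunE => /hI.
rewrite /draws_onto -(card_imset _ HI); apply/subset_leq_card/fintype.subsetP => _ /imsetP[f /forallP fJ ->].
have hsurj k : k \in K -> exists2 x, x \in J & h x = k.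
  move=> kK; have : k \in h @: J.
    suff -> : h @: J = K by [].
    apply/eqP; rewrite eqEcard card_imset// JK leqnn andbT.
    by apply/fintype.subsetP => _ /imsetP[x xJ ->]; rewrite hJ.
  by case/imsetP => x xJ ->; exists x.
apply/forallP => k; apply/eqP; apply/idP/idP.
  by move=> /codomP[i ->]; rewrite ffunE hJ -(eqP (fJ (f i))) codom_f.
move=> /hsurj[x xJ <-]; have := fJ x; rewrite xJ => /eqP/codomP[i ->].
by apply/codomP; exists i; rewrite ffunE.
Qed.

Lemma draws_onto_card J K : #|J| = #|K| -> draws_onto m J = draws_onto m K.
Proof. by move=> JK; apply/eqP; rewrite eqn_leq !draws_onto_le. Qed.

(** A witness lists J and then repeats one of its elements, the default of [nth]. Positivity allows
    the counts to be cancelled from the odds. *)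
Lemma draws_onto_gt0 J : (0 < #|J| <= m)%N -> (0 < draws_onto m J)%N.
Proof.
case/andP => /card_gt0P[x0 x0J] Jm.
pose f : {ffun 'I_m -> 'I_n} := [ffun i : 'I_m => nth x0 (enum J) i].
rewrite /draws_onto; apply/card_gt0P; exists f; apply/forallP => k.
apply/eqP; apply/idP/idP.
  move=> /codomP[i ->]; rewrite ffunE; have [iJ|iJ] := ltnP i (size (enum J)).
    by rewrite -mem_enum mem_nth.
  by rewrite nth_default.
move=> kJ; have kE : (index k (enum J) < #|J|)%N by rewrite cardE index_mem mem_enum.
apply/codomP; exists (Ordinal (leq_trans kE Jm)).
by rewrite ffunE /= nth_index// mem_enum.
Qed.

End DrawsOnto.

Section OneStep.
Context {R : realType} {disp : measure_display} {T : measurableType disp}.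
Variables (P : probability T R) (n d : nat) (F : set (set T)) (m : nat).
Variables (U : T -> 'M[R]_(n, d)) (s : T -> 'cV[R]_d) (Om : T -> {set 'I_n}).
Hypothesis F_sigma : sigma_algebra [set: T] F.
Hypothesis F_meas : F `<=` measurable.
Hypothesis U_meas : mx_measurable F U.
Hypothesis s_meas : forall i, measurable_fun [set: T] (fun x => s x i 0).
Hypothesis Om_meas : forall J : {set 'I_n}, measurable [set x | Om x = J].
Hypothesis s_normal : iid_std_normal P s.
Hypothesis indep : independent_of_past P F s Om.
Hypothesis sampling : sampled_with_replacement P m Om.

Local Open Scope ereal_scope.

(** The two counts of draws are equal, so they cancel from the odds once positive. The empty set is
    alone of its size, and sets larger than m have probability 0. *)
Lemma sample_law_card (J K : {set 'I_n}) : #|J| = #|K| ->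
  P [set x | Om x = J] = P [set x | Om x = K].
Proof.
move=> JK; have [J0|J0] := posnP #|J|.
  have -> : J = finset.set0 by apply/eqP; rewrite -cards_eq0 J0.
  by have -> : K = finset.set0 by apply/eqP; rewrite -cards_eq0 -JK J0.
have [Jm|mJ] := leqP #|J| m; last first.
  have Z (L : {set 'I_n}) : #|L| = #|J| -> P [set x | Om x = L] = 0.
    move=> LJ; rewrite (_ : [set x | _] = set0) ?measure0//.
    apply/seteqP; split => // x /= OL.
    by have := swr_size sampling x; rewrite OL LJ leqNgt mJ.
  by rewrite !Z.
have := swr_odds sampling JK; rewrite (@draws_onto_card _ m J K)// => h.
have D : (draws_onto m K)%:R != 0%R :> R.
  by rewrite pnatr_eq0 -lt0n draws_onto_gt0// -JK J0.
have fin A : measurable A -> P A \is a fin_num by move=> mA; apply: fin_num_measure.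
move: h; rewrite -(fineK (fin _ (Om_meas J))) -(fineK (fin _ (Om_meas K))) -!EFinM.
by move=> [/(mulIf D) ->].
Qed.

Lemma Om_in_meas (C : pred {set 'I_n}) : measurable [set x | C (Om x)].
Proof.
have -> : [set x | C (Om x)] = \bigcup_(J in [set J | C J]) [set x | Om x = J].
  apply/seteqP; split => x /=; first by move=> h; exists (Om x).
  by move=> [J /= CJ ->].
by apply: fin_bigcup_measurable => // J _; apply: Om_meas.
Qed.

Lemma sample_indicator_law (J K : {set 'I_n}) (B : set R) : #|J| = #|K| ->
  P [set x | B ((Om x == J)%:R)] = P [set x | B ((Om x == K)%:R)].
Proof.
move=> JK; have E (L : {set 'I_n}) : [set x | B ((Om x == L)%:R)] =
    (if `[< B 1%R >] then [set x | Om x = L] else set0) `|`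
    (if `[< B 0%R >] then ~` [set x | Om x = L] else set0).
  apply/seteqP; split => x /=.
    by case: eqVneq => [<-|/eqP OL] h; [left|right]; case: asboolP.
  move=> [|]; case: asboolP => // h.
    by move=> /= ->; rewrite eqxx.
  by move=> /= OL; case: eqVneq.
have PC (L : {set 'I_n}) : P (~` [set x | Om x = L]) = 1 - P [set x | Om x = L].
  exact: probability_setC.
rewrite !E; case: asboolP => h1; case: asboolP => h0; rewrite ?setU0 ?set0U ?setUv//.
  exact: sample_law_card.
by rewrite !PC (sample_law_card JK).
Qed.

(* Maps of R^d that carry measurable boxes back to measurable boxes of the same
   probability under the law of s. *)
Definition box_preserving (g : 'cV[R]_d -> 'cV[R]_d) : Prop :=
  forall B : 'I_d -> set R, (forall i, measurable (B i)) ->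
  exists B' : 'I_d -> set R, [/\ forall i, measurable (B' i),
    forall y, (forall i, B i (g y i ord0)) <-> (forall i, B' i (y i ord0)) &
    P [set x | forall i, B' i (s x i ord0)] = P [set x | forall i, B i (s x i ord0)]].

Lemma box_preserving_id : box_preserving id.
Proof. by move=> B mB; exists B. Qed.

Lemma box_preserving_flip j : box_preserving (flip j).
Proof.
move=> B mB; exists (fun i => if i == j then -%R @^-1` B i else B i).
have mB' i : measurable (if i == j then -%R @^-1` B i else B i).
  by case: ifP => // _; rewrite -[X in measurable X]setTI; apply: oppr_measurable.
split => //.
  move=> y; split => h i; have := h i; rewrite mxE; case: eqP => //.
apply: etrans (isn_independent s_normal mB') _.
rewrite (isn_independent s_normal mB); apply: eq_bigr => i _; case: ifP => // _.
rewrite (isn_marginal s_normal i (mB i)) -(normal_prob0_sym (mB i)).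
by apply: (isn_marginal s_normal); rewrite -[X in measurable X]setTI; apply: oppr_measurable.
Qed.

Lemma box_preserving_swap j l : box_preserving (swap j l).
Proof.
move=> B mB; exists (fun i => B (tperm j l i)); split => //.
  by move=> y; split => h i; have := h (tperm j l i); rewrite mxE tpermK.
apply: etrans (isn_independent s_normal (fun i => mB (tperm j l i))) _.
rewrite (isn_independent s_normal mB) [RHS](reindex_inj (@perm_inj _ (tperm j l))) /=.
by apply: eq_bigr => i _; rewrite !(isn_marginal s_normal).
Qed.

Local Notation idx := (option ('I_n * 'I_d + 'I_d)).

(** The sample indicator, the entries of [U] and those of [s] are flattened into one tuple of reals,
    so that their joint law is determined by rectangles. *)
Definition coordv (b : R) (A : 'M[R]_(n, d)) (y : 'cV[R]_d) (o : idx) : R :=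
  match o with
  | None => b
  | Some (inl ij) => A ij.1 ij.2
  | Some (inr j) => y j ord0
  end.

Definition encode (b : R) (A : 'M[R]_(n, d)) (y : 'cV[R]_d) : #|{: idx}|.-tuple R :=
  [tuple coordv b A y (enum_val i) | i < #|{: idx}|].

Definition decode_b (y : #|{: idx}|.-tuple R) : R := tnth y (enum_rank (None : idx)).
Definition decode_A (y : #|{: idx}|.-tuple R) : 'M[R]_(n, d) :=
  \matrix_(i, j) tnth y (enum_rank (Some (inl (i, j)) : idx)).
Definition decode_y (y : #|{: idx}|.-tuple R) : 'cV[R]_d :=
  \col_j tnth y (enum_rank (Some (inr j) : idx)).

Lemma encodeK b A y : [/\ decode_b (encode b A y) = b, decode_A (encode b A y) = A &
  decode_y (encode b A y) = y].
Proof.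
split; first by rewrite /decode_b tnth_mktuple enum_rankK.
  by apply/matrixP => i j; rewrite mxE tnth_mktuple enum_rankK.
by apply/colP => i; rewrite mxE tnth_mktuple enum_rankK.
Qed.

Lemma past_box (B : 'I_n -> 'I_d -> set R) : (forall i j, measurable (B i j)) ->
  F [set x | forall i j, B i j (U x i j)].
Proof.
move=> mB; have E : <<s [set: T], F >> = F by apply: sigma_algebra_id.
have -> : [set x | forall i j, B i j (U x i j)] =
    \bigcap_(ij in [set: 'I_n * 'I_d]) [set x | B ij.1 ij.2 (U x ij.1 ij.2)].
  apply/seteqP; split => x /=; first by move=> h ij _; apply: h.
  by move=> h i j; apply: (h (i, j)).
(* [F] is a bare collection of sets; identified with the sigma-algebra it generates, it admits the
   lemma on finite intersections. *)
rewrite -E.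
have := @fin_bigcap_measurable _ (g_sigma_algebraType F) _ [set: 'I_n * 'I_d]
  (fun ij => [set x | B ij.1 ij.2 (U x ij.1 ij.2)]).
apply => // ij _; rewrite /measurable /= E.
exact: U_meas.
Qed.

Lemma joint_law_box (J : {set 'I_n}) g (B : idx -> set R) :
  box_preserving g -> (forall o, measurable (B o)) ->
  P [set x | forall o, B o (coordv (Om x == J)%:R (U x) (g (s x)) o)] =
  P [set x | forall i j, B (Some (inl (i, j))) (U x i j)] *
  P [set x | forall i, B (Some (inr i)) (s x i ord0)] *
  P [set x | B None ((Om x == J)%:R)].
Proof.
move=> sg mB; have [B' [mB' hB' PB']] := sg _ (fun i => mB (Some (inr i))).
rewrite -PB'.
have := @indep _ _ [set L | B None ((L == J)%:R)]
  (past_box (fun i j => mB (Some (inl (i, j))))) mB'.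
have -> : [set x | Om x \in [set L | B None ((L == J)%:R)]] = [set x | B None ((Om x == J)%:R)].
  by apply/seteqP; split => x /=; rewrite inE.
move=> <-; congr (P _); apply/seteqP; split => x /=.
  move=> h; split; [split => [i j|]|exact: (h None)].
    exact: (h (Some (inl (i, j)))).
  by apply/hB' => i; apply: (h (Some (inr i))).
move=> [[hU hs] hO] [[[i j]|i]|] //=.
by move: i; apply/hB'.
Qed.

Local Close Scope ereal_scope.

Lemma U_entry_meas i j : measurable_fun [set: T] (fun x => U x i j).
Proof. by move=> _ B mB; rewrite setTI; apply/F_meas/U_meas. Qed.

Lemma Om_indic_meas (C : pred {set 'I_n}) : bdm (fun x => (C (Om x))%:R : R).
Proof.
have -> : (fun x => (C (Om x))%:R : R) = \1_[set x | C (Om x)].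
  by apply/funext => x; rewrite indicE mem_setE.
by apply: bdm_indic; apply: Om_in_meas.
Qed.

(** Independence makes rectangles of the triple (indicator, U, s) factor. Trading J for K of the
    same size, or s for its image under [g], leaves each factor unchanged, hence also the joint
    law. *)
Lemma joint_expectation_inv (J K : {set 'I_n}) g (f : 'M[R]_(n, d) -> R) (r : 'cV[R]_d -> R) :
  #|J| = #|K| -> box_preserving g ->
  (forall i, measurable_fun [set: T] (fun x => g (s x) i ord0)) ->
  measurable_fun setT (f \o decode_A) -> measurable_fun setT (r \o decode_y) ->
  bounded_on_T (fun x => f (U x)) -> (exists C, forall y, `|r y| <= C) ->
  \int[P]_x ((Om x == J)%:R * (f (U x) * r (s x))) =
  \int[P]_x ((Om x == K)%:R * (f (U x) * r (g (s x)))).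
Proof.
move=> JK sg mg mf mr bf [C hC].
pose X x := encode (Om x == J)%:R (U x) (s x).
pose Y x := encode (Om x == K)%:R (U x) (g (s x)).
pose phi t := decode_b t * (f (decode_A t) * r (decode_y t)).
have phiE b A y : phi (encode b A y) = b * (f A * r y).
  by rewrite /phi; have [-> -> ->] := encodeK b A y.
have mX (h : 'cV[R]_d -> 'cV[R]_d) L i :
    (forall i, measurable_fun [set: T] (fun x => h (s x) i ord0)) ->
    measurable_fun [set: T] (fun x => tnth (encode (Om x == L)%:R (U x) (h (s x))) i).
  move=> mh; under eq_fun do rewrite tnth_mktuple.
  case: (enum_val i) => [[[a b]|a]|] /=.
  - exact: U_entry_meas.
  - exact: mh.
  - by have [] := Om_indic_meas (pred1 L).
have mphi : measurable_fun setT phi.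
  apply: measurable_funM; first exact: measurable_tnth.
  exact: measurable_funM.
have iX (h : 'cV[R]_d -> 'cV[R]_d) L :
    (forall i, measurable_fun [set: T] (fun x => h (s x) i ord0)) ->
    P.-integrable [set: T] (EFin \o (phi \o (fun x => encode (Om x == L)%:R (U x) (h (s x))))).
  move=> mh; apply: bdm_integrable; split.
    apply: measurableT_comp => //; apply/measurable_fun_tnthP => i.
    exact: mX.
  have [D hD] := bf; exists (1 * (D * C)) => x; rewrite /= phiE !normrM.
  apply: ler_pM => //; first by case: eqP; rewrite ?normr1 ?normr0.
  by apply: ler_pM.
transitivity (\int[P]_x phi (X x)); first by apply: eq_Rintegral => x _; rewrite phiE.
transitivity (\int[P]_x phi (Y x)); last by apply: eq_Rintegral => x _; rewrite phiE.
apply: integral_tuple_ext => //; try by move=> i; apply: (mX id).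
- by move=> i; apply: mX.
- move=> B mB.
  have E (h : 'cV[R]_d -> 'cV[R]_d) L :
    [set x | forall i, B i (tnth (encode (Om x == L)%:R (U x) (h (s x))) i)] =
    [set x | forall o, B (enum_rank o) (coordv (Om x == L)%:R (U x) (h (s x)) o)].
    apply/seteqP; split => x /= hx o.
      by have := hx (enum_rank o); rewrite tnth_mktuple enum_rankK.
    by have := hx (enum_val o); rewrite tnth_mktuple enum_valK.
  have L1 := @joint_law_box J id (fun o => B (enum_rank o)) box_preserving_id (fun o => mB _).
  have L2 := @joint_law_box K g (fun o => B (enum_rank o)) sg (fun o => mB _).
  rewrite (E id) E [LHS]L1 [RHS]L2.
  by rewrite (sample_indicator_law _ JK).
- exact: (iX id).
- exact: iX.
Qed.

(** Measurability in the entries is expressed on tuples through [decode_A]. Boundedness is asked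
    only along [U], since polynomials in the entries are bounded on orthonormal matrices but not on
    all. *)
Definition admissible (f : 'M[R]_(n, d) -> R) : Prop :=
  measurable_fun setT (f \o decode_A) /\ bounded_on_T (fun x => f (U x)).

Lemma admissible_bdm f : admissible f -> bdm (fun x => f (U x)).
Proof.
move=> [mf bf]; split => //.
have -> : (fun x => f (U x)) = (f \o decode_A) \o (fun x => encode 0 (U x) 0).
  by apply/funext => x /=; have [_ ->] := encodeK 0 (U x) 0.
apply: measurableT_comp => //; apply/measurable_fun_tnthP => i.
rewrite /comp; under eq_fun do rewrite tnth_mktuple.
case: (enum_val i) => [[[a b]|a]|] /=; last exact: measurable_cst.
  exact: U_entry_meas.
exact: measurable_cst.
Qed.

Lemma measurable_dir_prod (disp' : measure_display) (T' : measurableType disp')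
    (y : T' -> 'cV[R]_d) j l :
  (forall i, measurable_fun [set: T'] (fun x => y x i 0)) ->
  measurable_fun [set: T'] (fun x => dir_prod j l (y x)).
Proof.
move=> my; apply: measurable_funM; first exact: measurable_funM.
apply: measurable_inv_ge0; first by move=> x; apply: dotp_ge0.
apply: (@in_dotp _ _ (fun f => measurable_fun [set: T'] f)).
- by move=> c; apply: measurable_cst.
- by move=> f g mf mg; apply: measurable_funD.
- by move=> f g mf mg; apply: measurable_funM.
- by move=> i k; rewrite ord1; apply: my.
- by move=> i k; rewrite ord1; apply: my.
Qed.

Lemma decode_y_meas i : measurable_fun setT (fun t => decode_y t i 0).
Proof. by under eq_fun do rewrite mxE; apply: measurable_tnth. Qed.

Lemma dir_prod_bdm j l : bdm (fun x => dir_prod j l (s x)).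
Proof.
split; first exact: measurable_dir_prod.
by exists 1 => x; apply: dir_prod_bounded.
Qed.

Lemma sample_dir_bdm J f j l : admissible f ->
  bdm (fun x => (Om x == J)%:R * (f (U x) * dir_prod j l (s x))).
Proof.
move=> af; apply: bdmM; first exact: (Om_indic_meas (pred1 J)).
by apply: bdmM; [apply: admissible_bdm|apply: dir_prod_bdm].
Qed.

Lemma sample_bdm J f : admissible f -> bdm (fun x => (Om x == J)%:R * f (U x)).
Proof.
move=> af; apply: bdmM; first exact: (Om_indic_meas (pred1 J)).
exact: admissible_bdm.
Qed.

(** Flipping coordinate j preserves the joint law and changes the sign of the integrand, so the
    integral equals its own negative. *)
Lemma exp_dir_offdiag J f j l : admissible f -> j != l ->
  \int[P]_x ((Om x == J)%:R * (f (U x) * dir_prod j l (s x))) = 0.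
Proof.
move=> af jl; have [mf bf] := af.
have mflip : forall i, measurable_fun [set: T] (fun x => flip j (s x) i ord0).
  move=> i; under eq_fun do rewrite mxE.
  case: (i == j) => /=; last exact: s_meas.
  exact: measurable_funN (s_meas i).
have h := @joint_expectation_inv J J (flip j) f (dir_prod j l) erefl
  (box_preserving_flip j) mflip mf (measurable_dir_prod j l decode_y_meas) bf
  (ex_intro _ 1 (dir_prod_bounded j l)).
have := h; under [in RHS]eq_Rintegral do
  rewrite (dir_prod_flip _ jl) mulrN mulrN -mulN1r.
by rewrite expZ; [move=> h'; lra|apply: sample_dir_bdm].
Qed.

(** The index witnesses that the dimension is positive; coordinate j alone already vanishes with
    probability 0. *)
Lemma s_zero_null (j : 'I_d) :
  measurable [set x | s x = 0] /\ P [set x | s x = 0] = 0%E.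
Proof.
have m0 : measurable [set x | s x = 0].
  have -> : [set x | s x = 0] = (fun x => dotp (s x) (s x)) @^-1` [set 0].
    apply/seteqP; split => x /=; first by move=> ->; rewrite dotp0r.
    by move/eqP; rewrite dotp_eq0 => /eqP.
  rewrite -[X in measurable X]setTI.
  suff : measurable_fun [set: T] (fun x => dotp (s x) (s x)) by apply.
  apply: (@in_dotp _ _ (fun f => measurable_fun [set: T] f)).
  - by move=> c; apply: measurable_cst.
  - by move=> f g mf mg; apply: measurable_funD.
  - by move=> f g mf mg; apply: measurable_funM.
  - by move=> i k; rewrite ord1; apply: s_meas.
  - by move=> i k; rewrite ord1; apply: s_meas.
split => //; apply/eqP; rewrite eq_le measure_ge0 andbT.
have <- : P [set x | [set 0] (s x j ord0)] = 0%E.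
  rewrite (isn_marginal s_normal)//.
  have /null_content_dominatesP D := @normal_prob_dominates R 0 1.
  by apply: D => //; apply: lebesgue_measure_set1.
apply: le_measure; rewrite ?inE//; last by move=> x /= ->; rewrite mxE.
by rewrite -[X in measurable X]setTI; apply: s_meas.
Qed.

(** Exchanging coordinates makes the d diagonal integrals equal, and the diagonal products sum to 1
    outside the null event s = 0. *)
Lemma exp_dir_diag J f j : admissible f ->
  d%:R * \int[P]_x ((Om x == J)%:R * (f (U x) * dir_prod j j (s x))) =
  \int[P]_x ((Om x == J)%:R * f (U x)).
Proof.
move=> af; have [mf bf] := af.
have E l : \int[P]_x ((Om x == J)%:R * (f (U x) * dir_prod l l (s x))) =
    \int[P]_x ((Om x == J)%:R * (f (U x) * dir_prod j j (s x))).
  have mswap : forall i, measurable_fun [set: T] (fun x => swap j l (s x) i ord0).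
    by move=> i; under eq_fun do rewrite mxE; apply: s_meas.
  have := @joint_expectation_inv J J (swap j l) f (dir_prod j j) erefl
    (box_preserving_swap j l) mswap mf (measurable_dir_prod j j decode_y_meas) bf
    (ex_intro _ 1 (dir_prod_bounded j j)).
  by move=> ->; apply: eq_Rintegral => x _; rewrite dir_prod_swap.
transitivity (\sum_(l < d) \int[P]_x ((Om x == J)%:R * (f (U x) * dir_prod l l (s x)))).
  by under eq_bigr do rewrite E; rewrite sumr_const card_ord mulr_natl.
rewrite -exp_sum; last by move=> l; apply: sample_dir_bdm.
have [m0 P0] := s_zero_null j.
have bA := bdm_indic m0; have bf' := sample_bdm J af.
have := exp_null bf' m0 P0.
transitivity (\int[P]_x ((Om x == J)%:R * f (U x) + -1 * (\1_[set x | s x = 0] x * ((Om x == J)%:R * f (U x))))).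
  apply: eq_Rintegral => x _; rewrite -!mulr_sumr sum_dir_prod indicE.
  have [s0|/eqP s0] := eqVneq (s x) 0; first by rewrite mem_set// mul1r !mulr0 mulN1r subrr.
  by rewrite memNset// mul0r mulr0 addr0 mulr1.
rewrite expD ?expZ//; [by rewrite H mulr0 addr0|exact: bdmM|].
by apply: bdmM; [exact: bdm_cst|exact: bdmM].
Qed.

(** All sets of one size contribute equally, and their events partition the event that the sample
    has that size. *)
Lemma exp_sample_card J f : admissible f ->
  \int[P]_x ((Om x == J)%:R * f (U x)) =
  'C(n, #|J|)%:R^-1 * \int[P]_x ((#|Om x| == #|J|)%:R * f (U x)).
Proof.
move=> af; have [mf bf] := af.
have C0 : 'C(n, #|J|)%:R != 0 :> R.
  by rewrite pnatr_eq0 -lt0n bin_gt0 -[X in (_ <= X)%N](card_ord n) max_card.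
have E (K : {set 'I_n}) : #|K| == #|J| -> \int[P]_x ((Om x == K)%:R * f (U x)) =
    \int[P]_x ((Om x == J)%:R * f (U x)).
  move=> /eqP KJ.
  have := @joint_expectation_inv K J id f (fun=> 1) KJ box_preserving_id s_meas mf
    (@measurable_cst _ _ _ _ _ _) bf (ex_intro _ 1 (fun=> _)).
  move=> /(_ ltac:(by move=> ?; rewrite normr1)).
  by under eq_Rintegral do rewrite mulr1; under [in RHS]eq_Rintegral do rewrite mulr1.
apply: (mulfI C0); rewrite mulVKf//.
transitivity (\sum_(K : {set 'I_n} | #|K| == #|J|) \int[P]_x ((Om x == K)%:R * f (U x))).
  under eq_bigr => K KJ do rewrite E//.
  rewrite sumr_const -[RHS]mulr_natl; congr (_%:R * _).
  have := card_draws 'I_n #|J|; rewrite card_ord => <-.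
  by apply: eq_card => K; rewrite [LHS]inE.
rewrite -exp_sum; last by move=> K; apply: sample_bdm.
apply: eq_Rintegral => x _; rewrite -mulr_suml; congr (_ * _).
rewrite big_mkcond (bigD1 (Om x))//= eqxx big1 ?addr0; first by case: ifP.
by move=> K /negbTE; rewrite eq_sym => ->; rewrite if_same.
Qed.

Lemma exp_quadratic (G : {set 'I_n} -> 'I_d -> 'I_d -> 'M[R]_(n, d) -> R) :
  (0 < d)%N -> (forall J j l, admissible (G J j l)) ->
  \int[P]_x (\sum_J (Om x == J)%:R * \sum_j \sum_l G J j l (U x) * dir_prod j l (s x)) =
  d%:R^-1 * \int[P]_x (\sum_(J : {set 'I_n})
     'C(n, #|J|)%:R^-1 * ((#|Om x| == #|J|)%:R * \sum_j G J j j (U x))).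
Proof.
move=> d0 aG; have dR : d%:R != 0 :> R by rewrite pnatr_eq0 -lt0n.
have bcard (J : {set 'I_n}) : bdm (fun x => (#|Om x| == #|J|)%:R : R).
  exact: (Om_indic_meas (fun K => #|K| == #|J|)).
have bG J j l := sample_dir_bdm J j l (aG J j l).
have bC (J : {set 'I_n}) j : bdm (fun x => (#|Om x| == #|J|)%:R * G J j j (U x)).
  by apply: bdmM => //; apply: admissible_bdm.
transitivity (\int[P]_x (\sum_J \sum_j \sum_l
    (Om x == J)%:R * (G J j l (U x) * dir_prod j l (s x)))).
  apply: eq_Rintegral => x _; apply: eq_bigr => J _; rewrite mulr_sumr.
  by apply: eq_bigr => j _; rewrite mulr_sumr.
rewrite exp_sum; last by move=> J; do 2!(apply: bdm_sum => ?); apply: bG.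
transitivity (d%:R^-1 * \int[P]_x (\sum_(J : {set 'I_n}) \sum_j
     'C(n, #|J|)%:R^-1 * ((#|Om x| == #|J|)%:R * G J j j (U x)))); last first.
  congr (_ * _); apply: eq_Rintegral => x _; apply: eq_bigr => J _.
  by rewrite -!mulr_sumr.
rewrite exp_sum; last first.
  by move=> J; apply: bdm_sum => j; apply: bdmM; [exact: bdm_cst|exact: bC].
rewrite mulr_sumr; apply: eq_bigr => J _.
rewrite exp_sum; last by move=> j; apply: bdm_sum => l; apply: bG.
rewrite exp_sum; last by move=> j; apply: bdmM; [exact: bdm_cst|exact: bC].
rewrite mulr_sumr; apply: eq_bigr => j _.
rewrite exp_sum; last by move=> l; apply: bG.
rewrite expZ; last exact: bC.
rewrite -exp_sample_card; last exact: aG.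
rewrite -(exp_dir_diag J j (aG J j j)) mulKf// (bigD1 j)//= big1 ?addr0//.
by move=> l lj; apply: exp_dir_offdiag; rewrite // eq_sym.
Qed.

End OneStep.

(** * The conditional expectation *)

(** The exceptional event is the preimage under Y of a Borel set B, so the defining identity of h
    applies to it. There h(Y) - c Y is positive, while the hypothesis makes its integral
    nonpositive; hence the event is null. *)
Lemma cond_expectation_ae_le (R : realType) (disp : measure_display) (T : measurableType disp)
  (P : probability T R) (X Y : T -> R) (h : R -> R) (c : R) (loc : set R) :
  is_cond_expectation P X Y h -> measurable loc -> bdm X -> bdm Y ->
  (forall B, measurable B -> B `<=` loc ->
    \int[P]_x (\1_B (Y x) * X x) <= c * \int[P]_x (\1_B (Y x) * Y x)) ->
  {ae P, forall x, loc (Y x) -> h (Y x) <= c * Y x}.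
Proof.
move=> [mh ih hE] mloc bX bY hle; have [mY _] := bY.
pose B := loc `&` ((fun y => h y - c * y) @^-1` `]0, +oo[%classic).
have mB : measurable B.
  apply: measurableI => //; rewrite -[X in measurable X]setTI.
  suff : measurable_fun [set: R] (fun y => h y - c * y) by apply.
  by apply: measurable_funB => //; apply: measurable_funM => //.
pose D := Y @^-1` B.
have mD : measurable D by rewrite -[D]setTI; apply: mY.
have Bpos x : D x -> 0 < h (Y x) - c * Y x.
  by move=> [_] /=; rewrite in_itv /= andbT.
have toind f : \int[P]_(x in D) f x = \int[P]_x (\1_B (Y x) * f x).
  rewrite Rintegral_mkcond; apply: eq_Rintegral => x _.
  rewrite patchE indicE; have [DY|DY] := pselect (D x).
    by rewrite mem_set// mem_set// mul1r.
  by rewrite memNset// memNset// mul0r.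
have sub f : P.-integrable [set: T] (EFin \o f) -> P.-integrable D (EFin \o f).
  by apply: integrableS.
have iX := sub _ (bdm_integrable P bX); have iY := sub _ (bdm_integrable P bY).
have ih' := sub (fun x => h (Y x)) ih.
have icY : P.-integrable D (EFin \o (fun x => c * Y x)).
  by apply: sub; apply: bdm_integrable; apply: bdmM => //; apply: bdm_cst.
have ig : P.-integrable D (EFin \o (fun x => h (Y x) - c * Y x)).
  have := integrableB mD ih' icY.
  by apply: eq_integrable => // x _; rewrite /= EFinB.
have g0 : \int[P]_(x in D) (h (Y x) - c * Y x) = 0.
  apply/eqP; rewrite eq_le; apply/andP; split; last first.
    by apply: Rintegral_ge0 => x Dx; apply/ltW/Bpos.
  rewrite RintegralB// RintegralZl// subr_le0.
  have -> : \int[P]_(x in D) h (Y x) = \int[P]_(x in D) X x by congr fine; apply: hE.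
  by rewrite !toind; apply: hle => // y [].
have gE : (\int[P]_(x in D) `|(h (Y x) - c * Y x)%:E| = 0)%E.
  transitivity (\int[P]_(x in D) (h (Y x) - c * Y x)%:E)%E.
    by apply: eq_integral => x; rewrite inE => Dx; rewrite abse_EFin gtr0_norm// Bpos.
  by rewrite -[LHS]fineK ?integrable_fin_num// -[fine _]/(Rintegral P D _) g0.
have mg : measurable_fun D (fun x => (h (Y x) - c * Y x)%:E).
  by case/integrableP: ig.
have := (ae_eq_integral_abs P mD mg).1 gE.
apply: filterS => x /= gx lY; rewrite leNgt; apply/negP => hlt.
have Dx : D x by split => //=; rewrite in_itv /= andbT subr_gt0.
by have := Bpos x Dx; case: (gx Dx) => ->; rewrite ltxx.
Qed.

Lemma expected_gain_ge (R : realType) (n d c : nat) (Ubar U : 'M[R]_(n, d)) (rho : R)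
  (p q : nat -> nat) :
  orthonormal_cols Ubar -> orthonormal_cols U ->
  (forall i, dotp (rowv U i) (rowv U i) <= rho) -> 0 <= rho ->
  (0 < c <= n)%N -> 6 <= ln (n%:R : R) -> 150 * ln n%:R * rho <= c%:R / n%:R ->
  (40 * d <= c)%N ->
  10 * ln (n%:R : R) <= (p c)%:R <= 11 * ln (n%:R : R) ->
  8 * ln (n%:R : R) <= c%:R / n%:R * (q c)%:R <= 8 * ln (n%:R : R) + 1 ->
  1 / 2 * (c%:R / n%:R) * subspace_error Ubar U <=
  'C(n, c)%:R^-1 * \sum_(J : {set 'I_n} | #|J| == c)
    \tr (gain_mx (fun J => ill_bound (rowv U) rho (p #|J|) (q #|J|) J) Ubar U J).
Proof.
move=> oB oU hr r0 cn L6 small dc hp hq.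
have C0 : 0 < 'C(n, c)%:R :> R by case/andP: cn => _ cn; rewrite ltr0n bin_gt0.
rewrite ler_pdivlMl// (eq_bigr _ (fun J _ => tr_gain_mx _ _ _ _)) exchange_big /=.
rewrite subspace_error_residual// fnorm_col !mulr_sumr; apply: ler_sum => l _.
set x := col l _; have Ux : U^T *m x = 0.
  by rewrite /x colE mulmxA tr_mul_residual_mx// mul0mx.
rewrite mulrCA mulrA; apply: le_trans (sum_restr_gain oU Ux hr r0 cn L6 small dc hp hq) _.
by rewrite le_eqVlt; apply/orP; left; apply/eqP; apply: eq_bigr => J /eqP ->.
Qed.

Lemma orthonormal_entry_le1 (R : realType) (n d : nat) (U : 'M[R]_(n, d)) i j :
  orthonormal_cols U -> `|U i j| <= 1.
Proof.
move=> oU; have : (U^T *m U) j j = 1 by rewrite oU mxE eqxx.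
rewrite mxE (bigD1 i)//= mxE => h.
have : U i j ^+ 2 <= 1.
  rewrite -h expr2 lerDl; apply: sumr_ge0 => k _.
  by rewrite mxE -expr2 sqr_ge0.
by rewrite -real_normK ?num_real// expr_le1.
Qed.

(** With y = Q / D, the first order terms leave a margin of at least (1/4 - 0.096) y e, because a <=
    6/10. The cubic smallness of e bounds the quadratic term by 16 (8 / 10^6) a^2 y^2 e, far below
    that margin. *)
Lemma contraction_rate (R : realFieldType) (e Q D a : R) :
  0 <= e -> 0 < Q -> Q <= 1 -> 1 <= D -> 0 < a -> a <= 6 / 10 ->
  e <= 8 / 10 ^+ 6 * a ^+ 2 * (Q ^+ 3 / D ^+ 2) ->
  e + 16 * (e ^+ 2 / Q) - 1 / 4 * (Q / D * e) <= (1 - 16 / 100 * a * (Q / D)) * e.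
Proof.
move=> e0 Q0 Q1 D1 a0 a6 he; have D0 : 0 < D by lra.
pose y := Q / D; have y0 : 0 < y by rewrite divr_gt0.
have y1 : y <= 1 by rewrite ler_pdivrMr// mul1r; lra.
have eQ : e / Q <= 8 / 10 ^+ 6 * a ^+ 2 * y ^+ 2.
  rewrite ler_pdivrMr// (le_trans he)// le_eqVlt; apply/orP; left; apply/eqP.
  by rewrite /y; field; rewrite gt_eqF.
have a2 : a ^+ 2 <= 36 / 100 by rewrite expr2; nra.
have y2 : a ^+ 2 * y ^+ 2 <= 36 / 100 * y.
  apply: (@le_trans _ _ (36 / 100 * y ^+ 2)); first by rewrite ler_wpM2r ?sqr_ge0.
  by rewrite expr2; nra.
have ay : a * y <= 6 / 10 * y by rewrite ler_wpM2r// ltW.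
have E : e ^+ 2 / Q = e * (e / Q) by rewrite mulrA.
have h1 := ler_wpM2l e0 eQ; have h2 := ler_wpM2l e0 y2; have h3 := ler_wpM2l e0 ay.
have ye : 0 <= e * y by rewrite mulr_ge0// ltW.
rewrite E -/y; move: h1 h2 h3 ye; clear; move: (e / Q) => z; lra.
Qed.

Theorem corollary2p15 (R : realType) (disp : measure_display)
  (T : measurableType disp) (P : probability T R)
  (n d : nat) (d_ge1 : (1 <= d)%N) (n_ge2d : (2 * d <= n)%N)
  (Ubar : 'M[R]_(n, d)) (Ubar_orth : orthonormal_cols Ubar)
  (F : nat -> set (set T)) (m : nat -> nat)
  (U : nat -> T -> 'M[R]_(n, d)) (s : nat -> T -> 'cV[R]_d)
  (Om : nat -> T -> {set 'I_n}) (eta : nat -> T -> R)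
  (gr : grouse P Ubar F m U s Om eta)
  (gr_eta_greedy : greedy_step_length Ubar U s Om eta)
  (q C1 : R)
  (C1_ge : 64 / 3 <= C1)
  (q_ge : C1 * ln n%:R ^+ 2 * d%:R * coherence Ubar * ln (20 * d%:R) <= q)
  (Om_ge : forall t x, q <= #|Om t x|%:R)
  (t : nat) (delta : R) (delta_bounds : 0 < delta < 6 / 10) :
  let eps : nat -> T -> R := error Ubar U in
  let local (e : R) : Prop :=
    [/\ e <= 1 / 128 * (q ^+ 2 / (n%:R ^+ 2 * d%:R)),
        e <= d%:R / (16 * n%:R) * coherence Ubar
      & e <= 8 / 10 ^+ 6 * (6 / 10 - delta) ^+ 2
             * (q ^+ 3 / (n%:R ^+ 3 * d%:R ^+ 2))] in
  let incoherent (x : T) : Prop :=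
    vcoherence (residual Ubar U s t x)
      <= ln n%:R * Num.sqrt (45 / 1000 / ln 10 * C1 * d%:R * coherence Ubar
                             * ln (20 * d%:R))
    /\
    vcoherence (residual Ubar U s t x)
      <= ln n%:R ^+ 2 * (5 / 100 / (8 * ln 10) * C1 * ln (20 * d%:R)) in
  forall (g : R -> R),
  is_cond_probability P [set x | incoherent x] (eps t) g ->
  {ae P, forall x, local (eps t x) -> 1 - delta <= g (eps t x)} ->
  forall (h : R -> R),
  is_cond_expectation P (eps t.+1) (eps t) h ->
  {ae P, forall x, local (eps t x) ->
     h (eps t x)
       <= (1 - 16 / 100 * (6 / 10 - delta) * (q / (n%:R * d%:R))) * eps t x}.
Proof.
move=> eps local incoherent g _ _ h hce.
(* A probability space is inhabited; one outcome turns the lower bound on sample sizes into q <=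
   n. *)
have [x0 _] : exists x : T, True.
  apply/not_existsP => nox; have : P [set: T] = 0%E.
    by rewrite (_ : [set: T] = set0) ?measure0//; apply/seteqP; split => // x; have := nox x.
  by rewrite probability_setT => -[] /eqP; rewrite oner_eq0.
have card_le (J : {set 'I_n}) : (#|J| <= n)%N.
  by rewrite -[X in (_ <= X)%N](card_ord n) max_card.
have qn : q <= n%:R by apply: le_trans (Om_ge t x0) _; rewrite ler_nat.
have mu1 := coherence_ge1 d_ge1 Ubar_orth.
have [L6 rho_small d40 q0] := sampling_regime d_ge1 n_ge2d mu1 C1_ge q_ge qn.
have dR : 1 <= d%:R :> R by rewrite ler1n.
have nR : 0 < n%:R :> R by apply: lt_le_trans qn.
set rho := 17 / 8 * (d%:R * coherence Ubar / n%:R) in rho_small.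
have rho0 : 0 <= rho.
  by rewrite mulr_ge0// divr_ge0// mulr_ge0//; move: mu1; clear; lra.
pose Q := q / n%:R.
have Q0 : 0 < Q by rewrite divr_gt0.
have Q1 : Q <= 1 by rewrite ler_pdivrMr// mul1r.
pose a := 6 / 10 - delta.
have [a0 a6] : 0 < a /\ a <= 6 / 10 by case/andP: delta_bounds; rewrite /a; split; lra.
have Om_gt0 t' x : (0 < #|Om t' x|)%N by rewrite -(ltr0n R); apply: lt_le_trans (Om_ge t' x).
have orth t' x : orthonormal_cols (U t' x).
  elim: t' => [|t' IH]; first exact: gr_init gr x.
  rewrite (gr_step gr); have [wc|nwc] := pselect (well_conditioned (U t' x) (Om t' x)).
    exact: grouse_step_orthonormal.
  by rewrite /grouse_step; case: asboolP.
(* The moment orders depend on the sample only through its size, so a single pair serves when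
   averaging over all sets of that size. *)
have [pq hpq] : exists pq : nat -> nat * nat, forall c, (0 < c <= n)%N ->
    10 * ln (n%:R : R) <= (pq c).1%:R <= 11 * ln (n%:R : R) /\
    8 * ln (n%:R : R) <= c%:R / n%:R * (pq c).2%:R <= 8 * ln (n%:R : R) + 1.
  suff /choice[f Hf] : forall c, exists pq : nat * nat, (0 < c <= n)%N ->
    10 * ln (n%:R : R) <= pq.1%:R <= 11 * ln (n%:R : R) /\
    8 * ln (n%:R : R) <= c%:R / n%:R * pq.2%:R <= 8 * ln (n%:R : R) + 1 by exists f.
  move=> c; have [cn|cn] := boolP (0 < c <= n)%N; last by exists (0%N, 0%N).
  by have [p [r pr]] := moment_orders_exist cn L6; exists (p, r).
pose phi (A : 'M[R]_(n, d)) (J : {set 'I_n}) := ill_bound (rowv A) rho (pq #|J|).1 (pq #|J|).2 J.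
have F_meas t' : F t' `<=` measurable by exact: (filt_measurable (gr_filtration gr)).
have Umeas t' i j : measurable_fun [set: T] (fun x => U t' x i j).
  by move=> _ B mB; rewrite setTI; apply: (F_meas t'); apply: (gr_U_adapted gr).
have bU t' : mx_in bdm (U t').
  by move=> i j; split => //; exists 1 => x; apply: orthonormal_entry_le1.
have beps t' : bdm (eps t') := in_error bdm_cst bdmD bdmM (bU t') Ubar.
have eps0 x : 0 <= eps t x := subspace_error_ge0 Ubar_orth (orth t x).
apply: (@cond_expectation_ae_le _ _ _ P (eps t.+1) (eps t) h _ [set e | local e]) => //.
  have -> : [set e | local e] = `]-oo, 1 / 128 * (q ^+ 2 / (n%:R ^+ 2 * d%:R))] `&`
      `]-oo, d%:R / (16 * n%:R) * coherence Ubar] `&`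
      `]-oo, 8 / 10 ^+ 6 * (6 / 10 - delta) ^+ 2 * (q ^+ 3 / (n%:R ^+ 3 * d%:R ^+ 2))].
    apply/seteqP; split => e /=; rewrite !in_itv /=; first by case=> *; split; first split.
    by case=> [[]] *; split.
  by apply: measurableI; [apply: measurableI|].
move=> B mB Bloc.
have B_meas : measurable (eps t @^-1` B).
  by rewrite -[X in measurable X]setTI; have [me _] := beps t; apply: me.
have bB : bdm (fun x => \1_B (eps t x) : R).
  have -> : (fun x => \1_B (eps t x) : R) = \1_(eps t @^-1` B) by [].
  exact: bdm_indic.
(* The indicator of the conditioning event is a function of [U] alone and is absorbed into the
   coefficients, so [exp_quadratic] integrates over that event. *)
pose G J j l A : R := \1_B (subspace_error Ubar A) * gain_mx (phi A) Ubar A J j l.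
have aG J j l : admissible (U t) (G J j l).
  pose K f := measurable_fun [set: #|{: option ('I_n * 'I_d + 'I_d)}|.-tuple R] (f : _ -> R).
  have Kc c : K (fun=> c) by apply: measurable_cst.
  have Kd f1 f2 : K f1 -> K f2 -> K (fun y => f1 y + f2 y) by apply: measurable_funD.
  have Km f1 f2 : K f1 -> K f2 -> K (fun y => f1 y * f2 y) by apply: measurable_funM.
  have KA : mx_in K (@decode_A R n d).
    by move=> i k; rewrite /K; under eq_fun do rewrite mxE; apply: measurable_tnth.
  split.
    apply: (Km _ _); last exact: (mx_in_gain Kc Kd Km KA Ubar rho (fun c => (pq c).1) (fun c => (pq c).2)).
    by apply: (measurableT_comp _ (in_error Kc Kd Km KA Ubar)); apply: measurable_indic.
  apply: boundedM; first by have [] := bB.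
  apply: (mx_in_gain (@bounded_cst R disp T) (@boundedD R disp T) (@boundedM R disp T) _ Ubar rho
    (fun c => (pq c).1) (fun c => (pq c).2)) => i k.
  by have [] := bU t i k.
have s_meas i : measurable_fun [set: T] (fun x => s t x i 0).
  by move=> _ C mC; rewrite setTI; apply: (F_meas t.+1); apply: (gr_s_adapted gr).
have Om_meas J : measurable [set x | Om t x = J] by apply/(F_meas t.+1)/(gr_Om_adapted gr).
have F_sigma : sigma_algebra [set: T] (F t) by exact: (filt_sigma (gr_filtration gr)).
have U_adapted : mx_measurable (F t) (U t) by exact: (gr_U_adapted gr).
have s_normal : iid_std_normal P (s t) by exact: (gr_normal gr).
have s_indep : independent_of_past P (F t) (s t) (Om t) by exact: (gr_independent gr).
have Om_law : sampled_with_replacement P (m t) (Om t) by exact: (gr_sampling gr).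
have quad := exp_quadratic F_sigma (F_meas t) U_adapted s_meas Om_meas s_normal s_indep
  Om_law d_ge1 aG.
pose gain x := \sum_J (Om t x == J)%:R *
  \sum_j \sum_l G J j l (U t x) * dir_prod j l (s t x).
have bgain : bdm gain.
  apply: bdm_sum => J; apply: bdmM; first exact: (Om_indic_meas Om_meas (pred1 J)).
  apply: bdm_sum => j; apply: bdm_sum => l; apply: bdmM.
    exact: (admissible_bdm (F_meas t) U_adapted (aG J j l)).
  exact: dir_prod_bdm.
pose gain' x := \sum_(J : {set 'I_n})
  'C(n, #|J|)%:R^-1 * ((#|Om t x| == #|J|)%:R * \sum_j G J j j (U t x)).
have bgain' : bdm gain'.
  apply: bdm_sum => J; apply: bdmM; first exact: bdm_cst.
  apply: bdmM; first exact: (Om_indic_meas Om_meas (fun K => #|K| == #|J|)).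
  apply: bdm_sum => j.
  exact: (admissible_bdm (F_meas t) U_adapted (aG J j j)).
(* The deterministic decrease holds on B, which lies inside [local]; off B both sides are 0. The
   bound e <= Q^2 / 128 comes from the first smallness condition with d >= 1. *)
have gain_le x : \1_B (eps t x) * eps t.+1 x <=
    \1_B (eps t x) * (eps t x + 16 * (eps t x ^+ 2 / Q)) + - (1 / 2) * gain x.
  have gainE : gain x = \sum_j \sum_l G (Om t x) j l (U t x) * dir_prod j l (s t x).
    rewrite /gain (bigD1 (Om t x))//= eqxx mul1r [X in _ + X]big1 ?addr0// => J JO.
    by rewrite eq_sym (negbTE JO) mul0r.
  rewrite gainE /G -/(error Ubar U t x) -/(eps t x).
  rewrite indicE; have [Be|nBe] := pselect (B (eps t x)); last first.
    rewrite memNset// !mul0r big1 ?mulr0 ?addr0// => j _.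
    by rewrite big1// => l _; rewrite !mul0r.
  rewrite mem_set// !mul1r.
  under eq_bigr => j _ do under eq_bigr => l _ do rewrite mul1r.
  rewrite -quadratic_dir_prod gain_mxE.
  have [e1 _ _] : local (eps t x) by apply: Bloc.
  have := @grouse_step_decrease _ _ _ Ubar (U t x) (s t x) (Om t x) (eta t x) Q
    (phi (U t x) (Om t x)) Ubar_orth (orth t x) Q0.
  rewrite -(gr_step gr) -/(error Ubar U t.+1 x) -/(eps t.+1 x).
  rewrite -/(error Ubar U t x) -/(eps t x) mulNr !div1r; apply.
  - by rewrite ler_wpM2r ?invr_ge0// ltW.
  - apply: le_trans e1 _.
    have -> : Q ^+ 2 / 128 = 1 / 128 * (q ^+ 2 / n%:R ^+ 2) by rewrite /Q expr_div_n; ring.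
    rewrite ler_wpM2l// ler_wpM2l ?sqr_ge0// lef_pV2 ?posrE ?mulr_gt0 ?exprn_gt0//; last lra.
    by rewrite ler_peMr// sqr_ge0.
  - exact: ill_bound_ge0.
  - move=> nwc; rewrite leNgt; apply/negP => hphi; apply: nwc => b.
    rewrite gram_rows_in; apply: (gram_eigenvalue_bounds _ rho0 (Om_gt0 t x) hphi).
    by rewrite gram_rowvT; apply: orth.
  - by move=> wc; have [] := gr_eta gr wc.
  - by move=> wc rp; apply: gr_eta_greedy.
have gain'_ge x : 1 / 2 * Q * (\1_B (eps t x) * eps t x) <= gain' x.
  rewrite /gain' /G -/(error Ubar U t x) -/(eps t x).
  rewrite indicE; have [Be|nBe] := pselect (B (eps t x)); last first.
    rewrite memNset// !mul0r mulr0 big1// => J _.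
    by rewrite big1 ?mulr0// => j _; rewrite mul0r.
  rewrite mem_set// !mul1r; set c := #|Om t x|.
  have -> : \sum_(J : {set 'I_n}) 'C(n, #|J|)%:R^-1 * ((c == #|J|)%:R *
      \sum_j (1 * gain_mx (phi (U t x)) Ubar (U t x) J j j)) =
      'C(n, c)%:R^-1 * \sum_(J : {set 'I_n} | #|J| == c) \tr (gain_mx (phi (U t x)) Ubar (U t x) J).
    rewrite mulr_sumr [RHS]big_mkcond /=; apply: eq_bigr => J _.
    rewrite eq_sym; case: eqP => [->|_]; last by rewrite mul0r mulr0.
    by rewrite mul1r; congr (_ * _); apply: eq_bigr => j _; rewrite mul1r.
  have cn : (0 < c <= n)%N by rewrite Om_gt0 card_le.
  have qc : Q <= c%:R / n%:R.
    apply: ler_wpM2r; first by rewrite invr_ge0 ler0n.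
    exact: Om_ge t x.
  have [hp hq] := hpq c cn.
  have [_ e2 _] : local (eps t x) by apply: Bloc.
  apply: (@le_trans _ _ (1 / 2 * (c%:R / n%:R) * eps t x)).
    by rewrite div1r ler_wpM2r// ler_wpM2l// invr_ge0 ler0n.
  apply: (@expected_gain_ge _ _ _ _ _ _ _ (fun c => (pq c).1) (fun c => (pq c).2)) => //.
  (* Origin of 17/8: twice the row bound d mu / n, plus twice the second smallness condition, which
     is one sixteenth of it. *)
  - move=> i; apply: le_trans (rowv_error_le i Ubar_orth (orth t x)) _.
    have := rowv_coherence Ubar i d_ge1.
    have E : d%:R / (16 * n%:R) * coherence Ubar = 1 / 16 * (d%:R * coherence Ubar / n%:R).
      by field; rewrite gt_eqF.
    move: e2; rewrite E -/(error Ubar U t x) -/(eps t x) /rho; clear; lra.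
  - exact: le_trans qc.
  - by rewrite -(ler_nat R) natrM; apply: le_trans d40 (Om_ge t x).
have be1 : bdm (fun x => \1_B (eps t x) * eps t x) by apply: bdmM.
have be2 : bdm (fun x => \1_B (eps t x) * (eps t x + 16 * (eps t x ^+ 2 / Q))).
  apply: bdmM => //; apply: bdmD => //; apply: bdmM; first exact: bdm_cst.
  by apply: bdmM; [under eq_fun do rewrite expr2; apply: bdmM|exact: bdm_cst].
(* The factor 1/2 of the deterministic decrease, 1/d from averaging over directions and 1/2 Q from
   averaging over samples combine to the rate Q / (4 d). *)
apply: (@le_trans _ _ (\int[P]_x (\1_B (eps t x) * (eps t x + 16 * (eps t x ^+ 2 / Q)))
    + - (1 / 2) * (d%:R^-1 * (1 / 2 * Q * \int[P]_x (\1_B (eps t x) * eps t x))))).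
  apply: (@le_trans _ _ (\int[P]_x (\1_B (eps t x) * (eps t x + 16 * (eps t x ^+ 2 / Q)))
    + - (1 / 2) * \int[P]_x gain x)).
    rewrite -expZ// -expD//; last by apply: bdmM => //; apply: bdm_cst.
    apply: exp_le => //; first exact: bdmM.
    by apply: bdmD => //; apply: bdmM => //; apply: bdm_cst.
  rewrite lerD2l !mulNr lerN2 ler_wpM2l// quad ler_wpM2l ?invr_ge0//.
  rewrite -expZ//; apply: exp_le => //.
  by apply: bdmM => //; apply: bdm_cst.
have -> : - (1 / 2) * (d%:R^-1 * (1 / 2 * Q * \int[P]_x (\1_B (eps t x) * eps t x))) =
    - (1 / 4 * (Q / d%:R)) * \int[P]_x (\1_B (eps t x) * eps t x).
  by field; rewrite gt_eqF//; lra.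
rewrite -!expZ// -expD//; last by apply: bdmM => //; apply: bdm_cst.
apply: exp_le.
- by apply: bdmD => //; apply: bdmM => //; apply: bdm_cst.
- by apply: bdmM => //; apply: bdm_cst.
move=> x; rewrite indicE; have [Be|nBe] := pselect (B (eps t x)); last first.
  by rewrite memNset// !mul0r !mulr0 addr0.
rewrite mem_set// !mul1r.
have [_ _ e3] : local (eps t x) by apply: Bloc.
have E : q / (n%:R * d%:R) = Q / d%:R by rewrite /Q invfM mulrA.
have := @contraction_rate _ (eps t x) Q d%:R a (eps0 x) Q0 Q1 dR a0 a6.
rewrite -/a E mulNr div1r -[4^-1 * _ * _]mulrA; apply.
by apply: le_trans e3 _; rewrite /Q -/a expr_div_n [(_ * d%:R ^+ 2)^-1]invfM [q ^+ 3 * _]mulrA.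
Qed.
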